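(* Let $\lambda$ and $\gamma$ be partitions and let $\alpha=(\alpha_1,\ldots,\alpha_{\ell})$ be a composition. Then the coefficient of $\tilde s_\gamma$ in the expansion of $\tilde h_{\alpha_1}\tilde h_{\alpha_2}\cdots\tilde h_{\alpha_{\ell}}\,\tilde s_\lambda$ in the basis $\{\tilde s_\nu\}_\nu$ equals the number of tableaux $T\in\mathcal{MCT}_\gamma(\lambda,\alpha)$ whose labels are all sets (no repeated letters) and which are lattice tableaux.
   Context: For $\mu\vdash n$, $\Xi_\mu$ is the multiset of $n$ complex numbers consisting, for each part $\mu_i$, of all $\mu_i$-th roots of unity; $f[\Xi_\mu]$ is the evaluation of the symmetric function $f$ at these values (other variables $0$). For a partition $\lambda$, $\tilde s_\lambda$ is the symmetric function characterized by $\tilde s_\lambda[\Xi_\mu]=\chi^{(n-|\lambda|,\lambda)}(\mu)$ for all $n\ge|\lambda|+\lambda_1$, $\mu\vdash n$ ($\chi^\nu$ the irreducible $S_n$-character), and $\tilde h_\lambda$ is the symmetric function characterized by $\tilde h_\lambda[\Xi_\mu]=\langle h_{(n-|\lambda|,\lambda)},p_\mu\rangle$ for all such $n,\mu$ (Hall inner product, $h$ complete homogeneous, $p$ power sums); for a single integer $k$, $\tilde h_k=\tilde h_{(k)}$. The $\tilde s_\lambda$ form a basis of the symmetric functions. Tableaux conventions: French notation (row 1 at the bottom). Alphabet $\bar1<\bar2<\cdots<1<2<\cdots$. Multisets over it with at most one barred letter are ordered by reverse lex order: compare largest elements, then second largest, etc.; $M<N$ if at the first difference $M$'s element is smaller,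 or if all compared agree and $M$ has fewer elements. For a partition $\gamma$ and $r\ge\gamma_1$, shape $(r,\gamma)/(\gamma_1)$ has cells $(1,j)$, $\gamma_1<j\le r$, and $(i+1,j)$, $i\ge1$, $1\le j\le\gamma_i$. $\mathcal{MCT}_\gamma(\lambda,\alpha)$ is the set of fillings of some shape $(r,\gamma)/(\gamma_1)$ by nonempty multisets with at most one barred letter each, weakly increasing along rows and strictly increasing up columns in reverse lex order, with multiset union of labels $\{\bar1^{\lambda_1},\bar2^{\lambda_2},\ldots,1^{\alpha_1},2^{\alpha_2},\ldots\}$, and with no row-1 cell labeled only by a barred letter. Reading order: bottom row to top row, right to left within rows. For a multiset $S$ of unbarred letters, $read(T|_S)$ is the word of barred letters $\bar j$ (in reading order) of cells labeled $\{\bar j\}\cup S$; $read(T|_-)$ is the case $S=\emptyset$. With $S_1<\cdots<S_d$ the distinct nonempty unbarred parts of labels of $T$, $T$ is a lattice tableau if $read(T|_-)read(T|_{S_1})\cdots read(T|_{S_d})$ (reading $\bar j$ as $j$) is lattice: every prefix has at least as many $j$'s as $(j+1)$'s for all $j\ge1$. *)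

(* Defs.v *)
From mathcomp Require Import all_boot all_order all_algebra all_fingroup.
From mathcomp Require Import all_solvable all_field all_character.
From mathcomp.multinomials Require Import mpoly.

Set Implicit Arguments.
Unset Strict Implicit.
Unset Printing Implicit Defensive.

Import Order.TTheory GRing.Theory Num.Theory.
Local Open Scope ring_scope.

Definition is_part (s : seq nat) : bool := sorted geq s && (0%N \notin s).

Definition is_comp (s : seq nat) : bool := 0%N \notin s.

(* (n - |la|, la) *)
Definition add_row (n : nat) (la : seq nat) : seq nat := (n - sumn la)%N :: la.

(** * Symmetric functions over the rationals *)

(* A symmetric function is encoded by its truncations f(x_1, ..., x_n, 0, ...)
   to finitely many variables: the ring of symmetric functions is the inverse
   limit, in the category of graded rings, of the rings of symmetric
   polynomials. Ring operations are taken for each n separately. *)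
Definition symfam := forall n : nat, {mpoly rat[n]}.

Definition kill_last (n : nat) (p : {mpoly rat[n.+1]}) : {mpoly rat[n]} :=
  p \mPo [tuple if unlift ord_max i is Some j then 'X_j else 0 | i < n.+1].

Definition is_symfun (f : symfam) : Prop :=
  [/\ forall n, f n \is symmetric,
      forall n, kill_last (f n.+1) = f n
    & exists d, forall n, (msize (f n) <= d)%N].

Definition sf_p (mu : seq nat) : symfam := fun n =>
  \prod_(k <- mu) \sum_(i < n) 'X_i ^+ k.

Definition sf_h (mu : seq nat) : symfam := fun n =>
  \prod_(k <- mu) \sum_(m : 'X_{1..n < k.+1} | mdeg m == k) 'X_[m].

Definition sf_m (mu : seq nat) : symfam := fun n =>
  \sum_(m : 'X_{1..n < (sumn mu).+1} | perm_eq [seq e <- val m | e != 0%N] mu)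
    'X_[m].

(* f = \sum_nu c_nu b_nu, a finite sum over partitions *)
Definition is_expansion (b : seq nat -> symfam) (f : symfam)
    (c : seq nat -> rat) : Prop :=
  exists s : seq (seq nat),
    [/\ uniq s, all is_part s, forall nu, nu \notin s -> c nu = 0
      & forall n, f n = \sum_(nu <- s) c nu *: b nu n].

(* <f, g> = r for the Hall inner product, i.e. the bilinear form for which
   <h_la, m_mu> = [la = mu]. *)
Definition hall_eq (f g : symfam) (r : rat) : Prop :=
  exists (s : seq (seq nat)) (a b : seq nat -> rat),
    [/\ uniq s, all is_part s,
        forall n, f n = \sum_(nu <- s) a nu *: sf_h nu n,
        forall n, g n = \sum_(nu <- s) b nu *: sf_m nu n
      & r = \sum_(nu <- s) a nu * b nu].

Definition unity_roots (m : nat) : seq algC :=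
  sval (closed_field_poly_normal ('X^m - 1 : {poly algC})).

Definition Xi (mu : seq nat) : seq algC := flatten [seq unity_roots m | m <- mu].

(* f[Xi_mu] *)
Definition sf_eval (f : symfam) (mu : seq nat) : algC :=
  (map_mpoly ratr (f (sumn mu))).@[fun i : 'I_(sumn mu) => (Xi mu)`_i].

(** * Irreducible characters of the symmetric group *)

Definition cycle_type (n : nat) (s : 'S_n) : seq nat :=
  sort geq [seq #|pred_of_set A| | A <- enum (porbits s)].

(* Row and column stabilizers of the tableau of shape nu in which 0, ..., n-1
   are written row by row: the entry i lies in row reshape_index nu i and
   column reshape_offset nu i. *)
Definition row_stab (n : nat) (nu : seq nat) : {set 'S_n} :=
  [set s : 'S_n | [forall i, reshape_index nu (s i) == reshape_index nu i]].

Definition col_stab (n : nat) (nu : seq nat) : {set 'S_n} :=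
  [set s : 'S_n | [forall i, reshape_offset nu (s i) == reshape_offset nu i]].

Definition Sn_regular (n : nat) := regular_repr algC [set: 'S_n]%G.

Definition young_symmetrizer (n : nat) (nu : seq nat) :=
  gring_row (\sum_(g in row_stab n nu) \sum_(h in col_stab n nu)
               (-1) ^+ odd_perm h *: Sn_regular n (g * h)%g).

(* The Specht module of shape nu, as the right ideal of the group algebra
   generated by the Young symmetrizer, and its character chi^nu. *)
Definition specht_repr (n : nat) (nu : seq nat) :=
  submod_repr (cyclic_mx_module (Sn_regular n) (young_symmetrizer n nu)).

Definition specht_char (n : nat) (nu : seq nat) : 'CF([set: 'S_n]) :=
  cfRepr (specht_repr n nu).

(** * The bases of irreducible and of induced trivial characters *)

Definition is_stilde (la : seq nat) (f : symfam) : Prop :=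
  is_symfun f /\
  forall (n : nat) (mu : seq nat) (s : 'S_n),
    (sumn la + head 0%N la <= n)%N -> cycle_type s = mu ->
    sf_eval f mu = specht_char n (add_row n la) s.

Definition is_htilde (la : seq nat) (f : symfam) : Prop :=
  is_symfun f /\
  forall (n : nat) (mu : seq nat) (r : rat),
    (sumn la + head 0%N la <= n)%N -> is_part mu -> sumn mu = n ->
    hall_eq (sf_h (add_row n la)) (sf_p mu) r ->
    sf_eval f mu = ratr r.

(** * Multiset tableaux *)

(* (false, i) is the barred letter i+1 and (true, i) the unbarred letter i+1;
   the lexicographic order puts barred letters first. *)
Definition letter := (bool *l nat)%type.

Definition barred (x : letter) : bool := ~~ x.1.

(* A multiset is encoded by the weakly decreasing list of its elements, so that
   the lexicographic order on lists is the reverse lex order on multisets. *)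
Definition label := seqlexi letter.

Definition is_label (M : label) : bool :=
  [&& M != [::], sorted >=%O (M : seq letter) & (count barred M <= 1)%N].

Definition unbarred_part (M : label) : label := [seq x <- M | ~~ barred x].

Definition barred_indices (M : label) : seq nat := [seq x.2 | x <- M & barred x].

(* A filling of (r, ga)/(ga_1) is the list of its rows from bottom to top, each
   read from left to right. *)
Definition filling := seq (seq label).

Definition content (la al : seq nat) : seq letter :=
  flatten [seq nseq (nth 0%N la i) ((false, i) : letter) | i <- iota 0 (size la)]
  ++ flatten [seq nseq (nth 0%N al i) ((true, i) : letter) | i <- iota 0 (size al)].

(* Row 1 occupies the columns ga_1 + 1, ..., r, where no other row has a cell:
   its length r - ga_1 is arbitrary and columns only involve the rows above it. *)
Definition MCT (ga la al : seq nat) (T : filling) : bool :=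
  let row1 := head [::] T in
  let rows := behead T in
  [&& T != [::],
      shape rows == ga,
      all (all is_label) T,
      all (sorted <=%O) T,
      sorted (fun R R' : seq label => all (fun p => (p.1 < p.2)%O) (zip R R')) rows,
      perm_eq (flatten [seq flatten (R : seq (seq letter)) | R <- T])
              (content la al)
    & all (fun M : label => ~~ all barred M) row1].

Definition set_valued (T : filling) : bool :=
  all (all (fun M : label => uniq (M : seq letter))) T.

Definition reading (T : filling) : seq label := flatten [seq rev R | R <- T].

Definition read_at (T : filling) (U : label) : seq nat :=
  flatten [seq barred_indices M | M <- reading T & unbarred_part M == U].

(* S_1 < ... < S_d *)
Definition unbarred_parts (T : filling) : seq label :=
  sort <=%O
    (undup [seq U <- [seq unbarred_part M | M <- reading T] | U != [::]]
       : seq label).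

Definition lattice_word (w : seq nat) : Prop :=
  forall k j, (count_mem j.+1 (take k w) <= count_mem j (take k w))%N.

Definition lattice_tableau (T : filling) : Prop :=
  lattice_word (read_at T [::] ++ flatten [seq read_at T U | U <- unbarred_parts T]).

Definition has_card (A : eqType) (P : A -> Prop) (N : nat) : Prop :=
  exists s : seq A, [/\ uniq s, forall x, x \in s <-> P x & size s = N].

(* Main.v *)
Require Import Defs.
From mathcomp Require Import all_boot all_order all_algebra all_fingroup.
From mathcomp Require Import all_solvable all_field all_character.
From mathcomp.multinomials Require Import mpoly.
From mathcomp Require Import zify.

Set Implicit Arguments.
Unset Strict Implicit.
Unset Printing Implicit Defensive.

Import Order.TTheory GRing.Theory Num.Theory.

(* Evaluated at [Xi_mu] with [mu] a large partition of [n], [s~_ga] is the irreducible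
   character of shape [(n - |ga|, ga)] and [h~_a] is the permutation character of [S_n]
   on [a]-subsets, so the statement is about decomposing characters of [S_n] for large
   [n]. Writing the irreducible character attached to [la] as a Jacobi-Trudi alternating
   sum of permutation characters on words, its product with the subset characters is an
   alternating sum of permutation characters on words over pairs (set [S] of unbarred
   letters, row index [j]). Young's rule turns the coefficient of an irreducible character
   into a signed count of semistandard fillings by such pairs, and a sign-reversing
   Bender-Knuth flip at the first violation of the lattice condition leaves exactly the
   lattice fillings. The pair [(set0, 0)] is the empty label: for large [n] it only occurs in
   the bottom row, and deleting its cells gives the lattice set tableaux. Finally, symmetric
   functions that agree at all [Xi_mu] with [|mu|] large are equal, and orthonormality of
   the irreducible characters gives uniqueness of the expansion. *)

(** One matrix carries both conditions on a tableau. If [T i k] is the number of letters [k] in row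
    [i], column strictness is the inequality [interlacing], and the lattice condition is the same
    inequality for the transpose: a row read from right to left is weakly decreasing, so only the
    prefix between its letters [k+1] and its letters [k] has to be tested. For pairs ([S], [j]) the
    matrix row [S * n + r] describes the cells of tableau row [r] with unbarred part [S]. This is
    exactly the reading order of lattice tableaux. For fixed [S] these cells form a skew tableau in
    the letters [j], so the cancellation is carried out for skew shapes. The bottom-row condition of
    the statement comes from the letter [j = 0]: in the first matrix row dominance excludes cells
    with a barred letter alone. All other comparisons of [j = 1] with [j = 0] hold for large [n],
    because the bottom row has enough empty cells. The irreducible characters are given by Young
    symmetrizers and must be identified with the Jacobi-Trudi sums; the number [\sum_k k * nu_k]
    replaces the dominance order there. *)

(** * Semistandard fillings as matrices of multiplicities *)

Definition pchain (rho : nat -> nat) (T : nat -> nat -> nat) (i c : nat) : nat :=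
  rho i + \sum_(0 <= k < c) T i k.

Lemma pchain0 rho T i : pchain rho T i 0 = rho i.
Proof. by rewrite /pchain big_geq ?addn0. Qed.

Lemma pchainS rho T i c : pchain rho T i c.+1 = pchain rho T i c + T i c.
Proof. by rewrite /pchain big_nat_recr //= addnA. Qed.

Lemma eq_pchain rho T T' i c :
  (forall k, k < c -> T i k = T' i k) -> pchain rho T i c = pchain rho T' i c.
Proof.
move=> eqT; rewrite /pchain; congr addn; rewrite !big_nat.
by apply: eq_bigr => k /andP[_ /eqT].
Qed.

(** With inner shape [rho], [pchain rho T i c] is the place where the letters below [c] end in row
    [i], so the inequality is column strictness of a skew tableau. For the transpose, with an
    initial content [mu] in the role of [rho], it bounds the letters [k+1] in the rows up to [i] by
    the letters [k] in the rows before [i], which is the lattice condition. *)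
Definition interlacing (m l : nat) (rho : nat -> nat) (T : nat -> nat -> nat) : bool :=
  [forall i : 'I_m, forall c : 'I_l,
     (i.+1 < m) ==> (pchain rho T i.+1 c.+1 <= pchain rho T i c)].

Lemma interlacingP m l rho T :
  reflect (forall i c, i.+1 < m -> c < l -> pchain rho T i.+1 c.+1 <= pchain rho T i c)
          (interlacing m l rho T).
Proof.
apply: (iffP forallP) => [H i c lt_i lt_c | H i].
  by have /forallP/(_ (Ordinal lt_c))/implyP/(_ lt_i) := H (Ordinal (ltnW lt_i)).
by apply/forallP => c; apply/implyP => lt_i; apply: H.
Qed.

Lemma eq_interlacing m l rho T T' :
  (forall i k, i < m -> k < l -> T i k = T' i k) ->
  interlacing m l rho T = interlacing m l rho T'.
Proof.
move=> eqT; apply/interlacingP/interlacingP => H i c lt_i lt_c.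
  rewrite -(@eq_pchain _ T) -1?(@eq_pchain _ T T' i); first exact: H.
    by move=> k lt_k; apply: eqT; lia.
  by move=> k lt_k; apply: eqT; lia.
rewrite (@eq_pchain _ T T') 1?(@eq_pchain _ T T' i); first exact: H.
  by move=> k lt_k; apply: eqT; lia.
by move=> k lt_k; apply: eqT; lia.
Qed.

(** * The sign-reversing involution *)

Section Flip.

Variables (m l : nat) (rho mu : nat -> nat) (i0 k0 : nat).

Section FlipDef.
Variable T : nat -> nat -> nat.
Let X := pchain rho T.
Let Y := pchain mu (fun k i => T i k).

(** With all other letters fixed, column strictness confines the end of the letters [<= k0] in row
    [i] to the interval from [flip_lo] to [flip_hi]: row [i+1] bounds it from below and row [i-1]
    from above. *)
Definition flip_lo i := maxn (X i k0) (if i.+1 < m then X i.+1 k0.+2 else 0).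
Definition flip_hi i :=
  if i is i'.+1 then minn (X i k0.+2) (X i' k0) else X i k0.+2.

(* The new length of the part of row [i] filled with letters [<= k0]. Rows above
   [i0] undergo the Bender-Knuth reflection; in row [i0] the value is the one
   that makes the total weight satisfy the reflection rule. *)
Definition flip_mid i :=
  if i == i0 then flip_lo i + (Y k0.+1 i0.+1 - Y k0 i0).-1
  else flip_lo i + flip_hi i - X i k0.+1.

Definition flip i k :=
  if i < i0 then T i k
  else if k == k0 then flip_mid i - X i k0
  else if k == k0.+1 then X i k0.+2 - flip_mid i
  else T i k.
End FlipDef.

Definition lattice_at T i k :=
  pchain mu (fun k i => T i k) k.+1 i.+1 <= pchain mu (fun k i => T i k) k i.

(** The first violation in reading order: the least row and, inside it, the largest letter. The flip
    changes the letters [k0] and [k0+1] from row [i0] on; in row [i0] these enter only the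
    conditions with [k <= k0], so everything read before the violation is preserved. *)
Definition first_violation T :=
  [/\ forall i k, i < i0 -> k.+1 < l -> lattice_at T i k,
      forall k, k0 < k -> k.+1 < l -> lattice_at T i0 k
    & ~~ lattice_at T i0 k0].

Variable T : nat -> nat -> nat.
Hypotheses (lt_i0 : i0 < m) (lt_k0 : k0.+1 < l).
Hypothesis mu_dec : forall k, k.+1 < l -> mu k.+1 <= mu k.
Hypothesis T_inter : interlacing m l rho T.
Hypothesis T_first : first_violation T.

Local Notation X := (pchain rho T).
Local Notation Y := (pchain mu (fun k i => T i k)).
Local Notation T' := (flip T).
Local Notation X' := (pchain rho T').
Local Notation Y' := (pchain mu (fun k i => T' i k)).

Let XS i c : X i c.+1 = X i c + T i c. Proof. exact: pchainS. Qed.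
Let YS k i : Y k i.+1 = Y k i + T i k. Proof. exact: pchainS. Qed.
Let XI i c : i.+1 < m -> c < l -> X i.+1 c.+1 <= X i c.
Proof. by move/interlacingP: T_inter; apply. Qed.

Lemma flip_lo_le i : i < m -> flip_lo T i <= X i k0.+1.
Proof.
move=> lt_i; rewrite /flip_lo geq_max XS leq_addr /=.
by case: ifP => // lt_i1; rewrite -XS XI.
Qed.

Lemma flip_hi_ge i : i < m -> X i k0.+1 <= flip_hi T i.
Proof.
case: i => [|i] lt_i /=; first by rewrite (XS _ k0.+1) leq_addr.
by rewrite leq_min (XS _ k0.+1) leq_addr /= XI //; lia.
Qed.

(** Only row [i0] needs an argument. As the row before it has no violation (or by [mu_dec] if there
    is none), the excess at [i0] is at most the number of [k0+1] in row [i0] minus the number of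
    [k0] in row [i0-1], and this much room is left below [flip_hi]. *)
Lemma flip_mid_bounds i : i0 <= i -> i < m ->
  flip_lo T i <= flip_mid T i <= flip_hi T i.
Proof.
move=> le_i lt_i; have lo := flip_lo_le lt_i; have hi := flip_hi_ge lt_i.
rewrite /flip_mid; case: eqVneq => [ei|_]; last by lia.
rewrite leq_addr /=; move: T_first => [before _ viol]; subst i.
move: viol; rewrite /lattice_at -ltnNge YS => viol.
have := XS i0 k0.+1.
case E: i0 lo hi viol le_i lt_i => [|i] lo hi viol le_i lt_i.
  rewrite /= in hi lo viol *; have := mu_dec lt_k0.
  by move: viol; rewrite !pchain0; lia.
have := before i k0; rewrite E ltnSn => /(_ isT lt_k0); rewrite /lattice_at.
have := YS k0.+1 i; have := YS k0 i.
have := XI (i:=i) (c:=k0.+1) lt_i lt_k0.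
have := XI (i:=i) (c:=k0) lt_i (ltnW lt_k0).
have := XS i k0; have := XS i.+1 k0; have := XS i.+1 k0.+1; rewrite /=; lia.
Qed.

Lemma flip_lo_ge i : X i k0 <= flip_lo T i.
Proof. by rewrite leq_maxl. Qed.

Lemma flip_hi_le i : flip_hi T i <= X i k0.+2.
Proof. by case: i => [|i] //=; rewrite geq_minl. Qed.

Lemma flip_above i k : i < i0 -> T' i k = T i k.
Proof. by rewrite /flip => ->. Qed.

Lemma flip_other i k : k != k0 -> k != k0.+1 -> T' i k = T i k.
Proof. by rewrite /flip => /negbTE-> /negbTE->; case: ifP. Qed.

Lemma flip_left i : i0 <= i -> T' i k0 = flip_mid T i - X i k0.
Proof. by rewrite /flip leqNgt => /negbTE->; rewrite eqxx. Qed.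

Lemma flip_right i : i0 <= i -> T' i k0.+1 = X i k0.+2 - flip_mid T i.
Proof. by rewrite /flip leqNgt => /negbTE->; rewrite eqxx -[_ == k0]/(_ == _) gtn_eqF. Qed.

Lemma pchain_flip_above i c : i < i0 -> X' i c = X i c.
Proof. by move=> lt_i; apply: eq_pchain => k _; apply: flip_above. Qed.

Lemma pchain_flip_le i c : c <= k0 -> X' i c = X i c.
Proof. by move=> le_c; apply: eq_pchain => k lt_k; apply: flip_other; lia. Qed.

Lemma pchain_flip_mid i : i0 <= i -> i < m -> X' i k0.+1 = flip_mid T i.
Proof.
move=> le_i lt_i; rewrite pchainS pchain_flip_le // flip_left //.
by have := flip_mid_bounds le_i lt_i; have := flip_lo_ge i; lia.
Qed.

Lemma pchain_flip_gt i c : i < m -> k0.+1 < c -> X' i c = X i c.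
Proof.
move=> lt_i; have [lt_i0i|le_i] := ltnP i i0.
  by rewrite pchain_flip_above.
elim: c => // c IH; rewrite ltnS leq_eqVlt => /predU1P[<-|lt_c].
  rewrite (pchainS _ T') pchain_flip_mid // flip_right //.
  by have := flip_mid_bounds le_i lt_i; have := flip_hi_le i; lia.
by rewrite (pchainS _ T') IH // XS flip_other //; lia.
Qed.

Lemma flip_interlacing : interlacing m l rho T'.
Proof.
apply/interlacingP => i c lt_i lt_c.
have [lt1|le1] := ltnP i.+1 i0.
  by rewrite !pchain_flip_above ?XI //; lia.
have := XI lt_i lt_c.
case: (ltngtP c k0) => [lt_ck|gt_ck|->].
- by rewrite !pchain_flip_le //; lia.
- rewrite (@pchain_flip_gt i.+1) //; case: (ltngtP c k0.+1) => [|gt|->]; first by lia.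
    by rewrite pchain_flip_gt //; lia.
  have [lt_ii|le_ii] := ltnP i i0; first by rewrite pchain_flip_above.
  rewrite pchain_flip_mid //; last by lia.
  have lt_im : i < m by lia.
  by have := flip_mid_bounds le_ii lt_im; rewrite {1}/flip_lo lt_i; lia.
- rewrite (@pchain_flip_le i) // pchain_flip_mid //.
  by have := flip_mid_bounds le1 lt_i; rewrite {1}/flip_hi; lia.
Qed.

Lemma flip_rowsum i : i < m -> \sum_(0 <= k < l) T' i k = \sum_(0 <= k < l) T i k.
Proof.
by move=> lt_i; apply: (@addnI (rho i)); apply: pchain_flip_gt.
Qed.

Lemma cchain_flip k i : i <= i0 -> Y' k i = Y k i.
Proof. by move=> le_i; apply: eq_pchain => j lt_j; apply: flip_above; lia. Qed.

Lemma cchain_flip_other k i : k != k0 -> k != k0.+1 -> Y' k i = Y k i.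
Proof. by move=> n1 n2; apply: eq_pchain => j _; apply: flip_other. Qed.

Lemma flip_mid_i0 : flip_mid T i0 + Y k0 i0 + 1 = flip_lo T i0 + Y k0.+1 i0.+1.
Proof.
by have [_ _] := T_first; rewrite /flip_mid eqxx /lattice_at; lia.
Qed.

(** The flip exchanges two quantities of row [i0]: the excess of the violation minus one, and the
    distance from [flip_lo] to the end of the letters [<= k0]. Hence the new excess is positive, so
    the violation persists, and a second flip restores the row. *)
Lemma cchain_flip_violation : Y' k0.+1 i0.+1 = (Y k0 i0 + X i0 k0.+1 - flip_lo T i0).+1.
Proof.
rewrite pchainS cchain_flip // flip_right //.
have := flip_mid_i0; have := flip_mid_bounds (leqnn i0) lt_i0.
have := flip_hi_le i0; have := XS i0 k0.+1; have := flip_lo_le lt_i0.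
by rewrite YS; lia.
Qed.

Lemma flip_first : first_violation T'.
Proof.
have [before after viol] := T_first; split=> [i k lt_i lt_k | k lt_k0k lt_k | ].
- by rewrite /lattice_at !cchain_flip //; [exact: before | lia].
- rewrite /lattice_at (@cchain_flip k) // cchain_flip_other; try lia.
  exact: after.
rewrite /lattice_at cchain_flip_violation cchain_flip // -ltnNge.
by have := flip_lo_le lt_i0; lia.
Qed.

Lemma flip_loK i : i < m -> flip_lo T' i = flip_lo T i.
Proof.
move=> lt_i; rewrite /flip_lo pchain_flip_le //; case: ifP => // lt_i1.
by rewrite pchain_flip_gt.
Qed.

Lemma flip_hiK i : i < m -> flip_hi T' i = flip_hi T i.
Proof.
case: i => [|i] lt_i /=; first by rewrite pchain_flip_gt.
by rewrite pchain_flip_gt // pchain_flip_le.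
Qed.

Lemma flip_midK i : i0 <= i -> i < m -> flip_mid T' i = X i k0.+1.
Proof.
move=> le_i lt_i; have lo := flip_lo_le lt_i; have hi := flip_hi_ge lt_i.
rewrite {1}/flip_mid flip_loK // flip_hiK //; case: eqP => [ei|/eqP ni].
  by subst i; rewrite cchain_flip_violation cchain_flip //; lia.
rewrite pchain_flip_mid // /flip_mid (negbTE ni); lia.
Qed.

Lemma flipK i k : i < m -> flip T' i k = T i k.
Proof.
move=> lt_i; have [lt_ii|le_i] := ltnP i i0.
  by rewrite {1}/flip lt_ii flip_above.
rewrite {1}/flip [i < i0]ltnNge le_i /=; case: eqP => [->|/eqP n1].
  by rewrite flip_midK // pchain_flip_le // XS addKn.
case: eqP => [->|/eqP n2]; last by rewrite flip_other.
by rewrite flip_midK // pchain_flip_gt // (XS _ k0.+1) addKn.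
Qed.

(* The telescoping quantity: overlap of row [j] (letters [<= k0+1]) with the part
   of row [j-1] filled with letters [< k0]. *)
Let overlap j := if j < m then X j k0.+2 - X j.-1 k0 else 0.

(** The sum telescopes because [flip_lo j] and [flip_hi j.+1] are the maximum and the minimum of the
    same two numbers, so that their sum is linear in the row ends. *)
Lemma flip_weight_prefix j : i0 < j -> j <= m ->
  Y' k0 j + 1 = Y k0.+1 j + overlap j.
Proof.
elim: j => // j IH; rewrite ltnS leq_eqVlt => /predU1P[<-|lt_j] le_j.
  rewrite pchainS cchain_flip // flip_left //.
  have := flip_mid_i0; have := flip_lo_ge i0.
  have /andP[] := flip_mid_bounds (leqnn i0) lt_i0.
  rewrite /overlap /flip_lo /=; case: ifP; lia.
have {}IH := IH lt_j (ltnW le_j).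
rewrite (pchainS mu (fun k i => T' i k)) YS flip_left; last by lia.
rewrite /flip_mid gtn_eqF //.
have lo := flip_lo_le le_j; have hi := flip_hi_ge le_j; have lo2 := flip_lo_ge j.
have := XS j k0.+1.
case: j lt_j le_j IH lo hi lo2 => // j lt_j le_j IH lo hi lo2.
move: IH lo hi lo2; rewrite {1 2}/overlap le_j /= /flip_lo /=; case: ifP; lia.
Qed.

(** With [flip_weight_right] it shows that the flip exchanges the entries [k0] and [k0+1] of content
    plus staircase, that is, multiplies the permutation of the alternating sum by a
    transposition. *)
Lemma flip_weight_left : Y' k0 m + 1 = Y k0.+1 m.
Proof. by rewrite flip_weight_prefix // /overlap ltnn addn0. Qed.

Lemma flip_weight_sum : Y' k0 m + Y' k0.+1 m = Y k0 m + Y k0.+1 m.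
Proof.
suff H j : j <= m -> Y' k0 j + Y' k0.+1 j = Y k0 j + Y k0.+1 j by exact: H.
elim: j => [|j IH] le_j; first by rewrite /pchain !big_geq.
rewrite !(pchainS mu (fun k i => T' i k)) !YS.
suff : T' j k0 + T' j k0.+1 = T j k0 + T j k0.+1 by have := IH (ltnW le_j); lia.
have [lt_j|le_i] := ltnP j i0; first by rewrite !flip_above.
apply: (@addnI (X j k0)); rewrite !addnA -!XS -(pchain_flip_gt (c:=k0.+2)) //.
by rewrite !(pchainS _ T') pchain_flip_le.
Qed.

Lemma flip_weight_right : Y' k0.+1 m = Y k0 m + 1.
Proof. by have := flip_weight_sum; have := flip_weight_left; lia. Qed.

End Flip.

(** * Cancellation in alternating sums over skew tableaux *)

Section SignedSum.

Variables (m l b : nat) (rho mu nu : nat -> nat) (R : nat -> nat).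
Local Notation M := 'M['I_b.+1]_(m, l).

(** The flip acts on functions of natural numbers, whereas finite sums need bounded matrices. The
    bound [b] on the row sums bounds every entry that occurs. *)
Definition entry (T : M) (i k : nat) : nat :=
  if (insub i : option 'I_m, insub k : option 'I_l) is (Some i', Some k')
  then T i' k' else 0.

Lemma entryE (T : M) (i : 'I_m) (k : 'I_l) : entry T i k = T i k.
Proof. by rewrite /entry !valK. Qed.

Definition matrix_of (f : nat -> nat -> nat) : M := \matrix_(i, k) inord (f i k).

Lemma entry_matrix_of f i k : i < m -> k < l -> f i k <= b ->
  entry (matrix_of f) i k = f i k.
Proof.
by move=> lt_i lt_k le_f; rewrite -[i]/(val (Ordinal lt_i)) -[k]/(val (Ordinal lt_k))
  entryE mxE inordK.
Qed.

Lemma entry_inj (T T' : M) :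
  (forall i k, i < m -> k < l -> entry T i k = entry T' i k) -> T = T'.
Proof.
move=> eqT; apply/matrixP => i k; apply/val_inj.
by have := eqT i k; rewrite !entryE; apply.
Qed.

Definition rowsum (f : nat -> nat -> nat) i := \sum_(0 <= k < l) f i k.
Definition colsum (f : nat -> nat -> nat) k := \sum_(0 <= i < m) f i k.

Definition has_rowsums (f : nat -> nat -> nat) := [forall i : 'I_m, rowsum f i == R i].

Definition dominant (f : nat -> nat -> nat) := interlacing l m mu (fun k i => f i k).

(** The condition of the alternant: [mu] plus the content is a permutation of [nu] plus staircase,
    minus the staircase. Having [l - k] on both sides avoids negative numbers. *)
Definition has_weight (f : nat -> nat -> nat) (w : 'S_l) :=
  [forall k : 'I_l, mu k + colsum f k + (l - k) == nu (w k) + (l - w k)].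

Hypothesis R_le : forall i, i < m -> R i <= b.
Hypothesis mu_dec : forall k, k.+1 < l -> mu k.+1 <= mu k.
Hypothesis nu_dec : forall k, k.+1 < l -> nu k.+1 <= nu k.

Definition tabP (T : M) := has_rowsums (entry T) && interlacing m l rho (entry T).

Lemma rowsum_entry_le f i k : k < l -> rowsum f i <= b -> f i k <= b.
Proof.
move=> lt_k; apply: leq_trans; rewrite /rowsum big_mkord.
by rewrite (bigD1 (Ordinal lt_k)) //= leq_addr.
Qed.

Definition violates (T : M) (i : 'I_m) := [exists k : 'I_l, (k.+1 < l) && ~~ lattice_at mu (entry T) i k].

Lemma dominantPn (T : M) : ~~ dominant (entry T) -> exists i : 'I_m, violates T i.
Proof.
move=> /interlacingP ndom; apply/existsP; apply: contra_notT ndom => /existsPn H.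
move=> k i lt_k lt_i; have /existsPn/(_ (Ordinal (ltnW lt_k))) := H (Ordinal lt_i).
by rewrite /= lt_k negbK.
Qed.

Definition viol_row (T : M) : option 'I_m :=
  [pick i | violates T i & [forall j : 'I_m, (j < i) ==> ~~ violates T j]].

Definition viol_col (T : M) (i : 'I_m) : option 'I_l :=
  [pick k : 'I_l | (k.+1 < l) && ~~ lattice_at mu (entry T) i k
     & [forall j : 'I_l, (k < j) && (j.+1 < l) ==> lattice_at mu (entry T) i j]].

Definition viol (T : M) : nat * nat :=
  if viol_row T is Some i then if viol_col T i is Some k then (val i, val k) else (0, 0)
  else (0, 0).

Lemma violP (T : M) : ~~ dominant (entry T) ->
  [/\ (viol T).1 < m, (viol T).2.+1 < l &
      first_violation l mu (viol T).1 (viol T).2 (entry T)].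
Proof.
move=> /dominantPn[i vi]; rewrite /viol /viol_row.
case: pickP => [{vi} {}i /andP[vi /forallP iP] | none]; last first.
  case: (arg_minnP (fun i : 'I_m => val i) vi) => j vj jmin.
  have := none j; rewrite /= vj /= => /negbT/forallPn[j'].
  by rewrite negb_imply negbK => /andP[lt_j /jmin]; rewrite leqNgt lt_j.
rewrite /viol_col; case: pickP => [k /andP[/andP[lt_k vk] /forallP kP] | none]; last first.
  case/existsP: vi => k vk.
  pose P := [pred k : 'I_l | (k.+1 < l) && ~~ lattice_at mu (entry T) i k].
  case: (@arg_maxnP _ k P (fun k : 'I_l => val k) vk) => j vj jmax.
  have := none j; move: vj; rewrite /= => -> /= /negbT/forallPn[j'].
  rewrite negb_imply -andbA => /and3P[lt_j lt_j' nl].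
  by have := jmax j'; rewrite /= lt_j' nl => /(_ isT); rewrite leqNgt lt_j.
split=> //=; split=> // [j k' lt_j lt_k'| k' lt_kk' lt_k'].
  have lt_jm : j < m by apply: ltn_trans lt_j (ltn_ord i).
  have := iP (Ordinal lt_jm); rewrite lt_j /= => /existsPn/(_ (Ordinal (ltnW lt_k'))).
  by rewrite lt_k' negbK.
by have := kP (Ordinal (ltnW lt_k')); rewrite /= lt_kk' lt_k'.
Qed.

(** Through it the violation found after a flip is recognised as the first one, so that a second
    flip acts at the same place. *)
Lemma first_violation_uniq f i k i' k' : k.+1 < l -> k'.+1 < l ->
  first_violation l mu i k f -> first_violation l mu i' k' f -> (i, k) = (i', k').
Proof.
move=> lt_k lt_k' [b1 a1 v1] [b2 a2 v2].
have ei : i = i'.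
  by case: (ltngtP i i') => // lt; [move: v1; rewrite b2 | move: v2; rewrite b1].
subst i'; congr pair.
by case: (ltngtP k k') => // lt; [move: v2; rewrite a1 | move: v1; rewrite a2].
Qed.

Lemma eq_lattice_at f g i k : k.+1 < l -> i < m ->
  (forall i k, i < m -> k < l -> f i k = g i k) ->
  lattice_at mu f i k = lattice_at mu g i k.
Proof.
move=> lt_k lt_i eqfg; rewrite /lattice_at.
by congr (_ <= _); apply: eq_pchain => j lt_j; apply: eqfg; lia.
Qed.

Lemma eq_first_violation f g i k : i < m -> k.+1 < l ->
  (forall i k, i < m -> k < l -> f i k = g i k) ->
  first_violation l mu i k f -> first_violation l mu i k g.
Proof.
move=> lt_i lt_k eqfg [h1 h2 h3]; split.
- move=> j k' lt_j lt_k'; rewrite -(@eq_lattice_at f) //; first exact: h1.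
  exact: ltn_trans lt_j lt_i.
- by move=> k' lt1 lt2; rewrite -(@eq_lattice_at f) //; apply: h2.
- by rewrite -(@eq_lattice_at f).
Qed.

Lemma violE (T : M) i k : i < m -> k.+1 < l ->
  first_violation l mu i k (entry T) -> viol T = (i, k).
Proof.
move=> lt_i lt_k vT; have nd : ~~ dominant (entry T).
  apply/negP => /interlacingP/(_ k i lt_k lt_i); case: vT => _ _; rewrite /lattice_at.
  by move=> /negP.
have [_ lt2 v] := violP nd.
by rewrite [LHS]surjective_pairing; apply: first_violation_uniq lt2 lt_k v vT.
Qed.

Definition flipM (T : M) : M :=
  if dominant (entry T) then T
  else matrix_of (flip m rho mu (viol T).1 (viol T).2 (entry T)).

Definition viol_swap (T : M) : 'S_l :=
  if (insub (viol T).2 : option 'I_l, insub (viol T).2.+1 : option 'I_l)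
    is (Some a, Some a') then tperm a a' else 1%g.

Section FlipM.
Variable T : M.
Hypotheses (tabT : tabP T) (ndT : ~~ dominant (entry T)).
Let i0 := (viol T).1.
Let k0 := (viol T).2.
Let lt_i0 : i0 < m. Proof. by case: (violP ndT). Qed.
Let lt_k0 : k0.+1 < l. Proof. by case: (violP ndT). Qed.
Let T_inter : interlacing m l rho (entry T). Proof. by case/andP: tabT. Qed.
Let T_first : first_violation l mu i0 k0 (entry T). Proof. by case: (violP ndT). Qed.
Local Notation f := (flip m rho mu i0 k0 (entry T)).

Lemma rowsum_flip i : i < m -> rowsum f i = R i.
Proof.
move=> lt_i; rewrite /rowsum (flip_rowsum lt_i0 lt_k0 mu_dec T_inter T_first) //.
by case/andP: tabT => /forallP/(_ (Ordinal lt_i))/eqP.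
Qed.

Lemma entry_flipM i k : i < m -> k < l -> entry (flipM T) i k = f i k.
Proof.
move=> lt_i lt_k; rewrite /flipM (negbTE ndT) entry_matrix_of //.
by apply: rowsum_entry_le => //; rewrite rowsum_flip // R_le.
Qed.

Lemma flipM_tab : tabP (flipM T).
Proof.
apply/andP; split.
  apply/forallP => i; rewrite -(rowsum_flip (ltn_ord i)) /rowsum !big_nat.
  by apply/eqP; apply: eq_bigr => k /andP[_ lt_k]; apply: entry_flipM.
rewrite (eq_interlacing _ entry_flipM).
exact: (flip_interlacing lt_i0 lt_k0 mu_dec T_inter T_first).
Qed.

Lemma flipM_first : first_violation l mu i0 k0 (entry (flipM T)).
Proof.
apply: (@eq_first_violation f) => //.
  by move=> i k lt_i lt_k; rewrite entry_flipM.
exact: (flip_first lt_i0 lt_k0 mu_dec T_inter T_first).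
Qed.

Lemma viol_flipM : viol (flipM T) = viol T.
Proof. by rewrite (violE lt_i0 lt_k0 flipM_first) /i0 /k0; case: (viol T). Qed.

Lemma flipM_ndominant : ~~ dominant (entry (flipM T)).
Proof.
apply/negP => /interlacingP/(_ k0 i0 lt_k0 lt_i0); case: flipM_first => _ _.
by rewrite /lattice_at => /negP.
Qed.

Lemma eq_flip g g' i k : (forall i k, i < m -> k < l -> g i k = g' i k) ->
  i < m -> k < l -> flip m rho mu i0 k0 g i k = flip m rho mu i0 k0 g' i k.
Proof.
move=> eqg lt_i lt_k.
have eX j c : j < m -> c <= l -> pchain rho g j c = pchain rho g' j c.
  by move=> lt_j le_c; apply: eq_pchain => k' lt_k'; apply: eqg => //; lia.
have eY c j : j <= m -> c < l -> pchain mu (fun k i => g i k) c j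
    = pchain mu (fun k i => g' i k) c j.
  by move=> lt_j le_c; apply: eq_pchain => k' lt_k'; apply: eqg => //; lia.
have eM : flip_mid m rho mu i0 k0 g i = flip_mid m rho mu i0 k0 g' i.
  have eI : (if i.+1 < m then pchain rho g i.+1 k0.+2 else 0)
      = (if i.+1 < m then pchain rho g' i.+1 k0.+2 else 0) by case: ifP => // ?; rewrite eX.
  rewrite /flip_mid /flip_lo /flip_hi eI !(eX i) ?eY //; try lia.
  by case: i lt_i {eI} => [|i] lt_i; rewrite ?(eX i) //; lia.
by rewrite /flip eM eqg // !eX //; lia.
Qed.

Lemma flipMK : flipM (flipM T) = T.
Proof.
apply: entry_inj => i k lt_i lt_k.
rewrite {1}/flipM (negbTE flipM_ndominant) viol_flipM.
have E : flip m rho mu i0 k0 (entry (flipM T)) i k = entry T i k.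
  rewrite (eq_flip entry_flipM) //.
  exact: (flipK lt_i0 lt_k0 mu_dec T_inter T_first).
rewrite entry_matrix_of ?E //.
apply: rowsum_entry_le => //; case/andP: tabT => /forallP/(_ (Ordinal lt_i))/eqP -> _.
exact: R_le.
Qed.

Lemma viol_swapE : viol_swap T = tperm (Ordinal (ltnW lt_k0)) (Ordinal lt_k0).
Proof. by rewrite /viol_swap (insubT (fun x => x < l) (ltnW lt_k0))
  (insubT (fun x => x < l) lt_k0). Qed.

Lemma odd_viol_swap : odd_perm (viol_swap T).
Proof. by rewrite viol_swapE odd_tperm; apply/eqP => /(congr1 val) /= /n_Sn. Qed.

Lemma flipM_weight w : has_weight (entry T) w ->
  has_weight (entry (flipM T)) (viol_swap T * w)%g.
Proof.
rewrite viol_swapE; set a := Ordinal _; set a' := Ordinal _.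
move=> /forallP Hw; apply/forallP => k; rewrite permM.
have eqc j : j < l -> mu j + colsum (entry (flipM T)) j = pchain mu (fun k i => f i k) j m.
  move=> lt_j; rewrite /pchain /colsum; congr addn; rewrite !big_nat.
  by apply: eq_bigr => i /andP[_ lt_i]; apply: entry_flipM.
have {}Hw (j : 'I_l) : mu j + colsum (entry T) j + (l - j) = nu (w j) + (l - w j).
  exact/eqP.
rewrite eqc //; have [->|->|na na'] := tpermP a a' k.
- have := flip_weight_left lt_i0 lt_k0 mu_dec T_inter T_first.
  by have := Hw a'; rewrite /colsum /pchain /=; lia.
- have := flip_weight_right lt_i0 lt_k0 mu_dec T_inter T_first.
  by have := Hw a; rewrite /colsum /pchain /=; lia.
rewrite cchain_flip_other; first by rewrite -(Hw k).
  by apply: contra_not_neq na => e; apply/val_inj.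
by apply: contra_not_neq na' => e; apply/val_inj.
Qed.

End FlipM.

Lemma increasing_perm (w : 'S_l) : (forall i j : 'I_l, i < j -> w i < w j) -> w = 1%g.
Proof.
have ge (v : 'S_l) : (forall i j : 'I_l, i < j -> v i < v j) -> forall i : 'I_l, i <= v i.
  move=> vi [i lt_i]; elim: i lt_i => // i IH lt_i.
  have /= h := IH (ltnW lt_i); apply: leq_ltn_trans h _; exact: vi.
move=> wi; apply/permP => i; apply/val_inj/eqP; rewrite perm1 eqn_leq ge // andbT.
have := ge (w^-1)%g; move/(_ _ (w i)); rewrite permK; apply=> j k lt_jk.
case: (ltngtP (val (w^-1 j)%g) (val (w^-1 k)%g)) => // [/wi|/val_inj/perm_inj e].
  by rewrite !permKV; lia.
by rewrite e ltnn in lt_jk.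
Qed.

(** Dominance at the last row makes [mu] plus the content weakly decreasing. After adding the
    staircase both sides of the weight condition are strictly decreasing, so [w] is increasing. *)
Lemma dominant_weight (T : M) (w : 'S_l) : dominant (entry T) ->
  has_weight (entry T) w -> w = 1%g.
Proof.
move=> /interlacingP domT /forallP Hw; apply: increasing_perm => i j lt_ij.
pose u k := mu k + colsum (entry T) k.
have u_dec k : k.+1 < l -> u k.+1 <= u k.
  move=> lt_k; rewrite /u /colsum; case: (posnP m) => [m0|m_gt0].
    by rewrite m0 !big_geq // !addn0 mu_dec.
  have := domT k m.-1 lt_k; rewrite prednK // leqnn /pchain => /(_ isT) /leq_trans; apply.
  by rewrite leq_add2l -{2}(prednK m_gt0) big_nat_recr //= leq_addr.
have strict (g : nat -> nat) : (forall k, k.+1 < l -> g k.+1 <= g k) ->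
    forall a c, a <= c -> c < l -> g c <= g a.
  move=> gd a; elim=> [|c IH]; first by rewrite leqn0 => /eqP->.
  rewrite leq_eqVlt => /predU1P[->//|]; rewrite ltnS => le_ac lt_c.
  exact: leq_trans (gd _ lt_c) (IH le_ac (ltnW lt_c)).
have {}Hw (k : 'I_l) : u k + (l - k) = nu (w k) + (l - w k).
  by apply/eqP; apply: Hw.
rewrite ltnNge; apply/negP => le_w.
have := strict _ u_dec _ _ (ltnW lt_ij) (ltn_ord j).
have := strict _ nu_dec _ _ le_w (ltn_ord (w i)).
have := Hw i; have := Hw j; have := ltn_ord j; have := ltn_ord (w i); lia.
Qed.

(** The generality in [rho] and [R] serves three purposes: disconnected rows give scalar products
    with word characters, straight shapes give orthonormality, and a stack of skew shapes gives the
    coefficients of the product. *)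
Lemma signed_sum_dominant (F : numDomainType) :
  (\sum_(w : 'S_l) \sum_(T : M | tabP T && has_weight (entry T) w) (-1) ^+ odd_perm w
   = #|[set T : M | [&& tabP T, dominant (entry T)
                      & [forall k : 'I_l, mu k + colsum (entry T) k == nu k]]]|%:R :> F)%R.
Proof.
rewrite pair_big_dep /= (bigID (fun p : 'S_l * M => dominant (entry p.2))) /=.
set S1 := (X in (X + _)%R); set S2 := (X in (_ + X)%R).
have -> : S2 = 0%R.
  suff : (S2 *+ 2 == 0)%R by rewrite mulrn_eq0 => /eqP.
  rewrite mulr2n addr_eq0; apply/eqP; rewrite {1}/S2.
  pose P (p : 'S_l * M) :=
    [&& tabP p.2 && has_weight (entry p.2) p.1 & ~~ dominant (entry p.2)].
  pose phi (p : 'S_l * M) := if P p then ((viol_swap p.2 * p.1)%g, flipM p.2) else p.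
  have phiP p : P p -> P (phi p).
    move=> Pp; rewrite /phi Pp; case/andP: Pp => /andP[tp wp] np.
    by rewrite /P flipM_tab // flipM_weight // flipM_ndominant.
  have phiK : involutive phi.
    move=> p; case Pp: (P p); last by rewrite {2}/phi Pp /phi Pp.
    have ephi : phi p = ((viol_swap p.2 * p.1)%g, flipM p.2) by rewrite /phi Pp.
    have := phiP p Pp; rewrite ephi => Pp'; rewrite /phi Pp'.
    case/andP: Pp => /andP[tp wp] np /=.
    rewrite flipMK // mulgA /viol_swap viol_flipM // -/(viol_swap p.2) viol_swapE //.
    by rewrite tperm2 mul1g -surjective_pairing.
  rewrite (reindex_inj (inv_inj phiK)) /= /S2 -sumrN.
  apply: eq_big => [p | p Pp].
    rewrite -/(P p) -/(P (phi p)); apply/idP/idP => [/phiP|]; last exact: phiP.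
    by rewrite phiK.
  have {}Pp : P p by rewrite -[p]phiK; apply: phiP.
  rewrite /phi Pp /=; case/andP: Pp => /andP[tp wp] np.
  by rewrite odd_permM odd_viol_swap // signr_addb mulN1r.
rewrite addr0 /S1 -sum1_card natr_sum.
rewrite (reindex_onto (fun T : M => (1%g : 'S_l, T)) snd) /=; last first.
  by move=> [w T] /= /andP[/andP[_ wT] dT]; rewrite (dominant_weight dT wT).
apply: eq_big => [T | T _]; last by rewrite odd_perm1.
rewrite inE eqxx andbT -andbA; congr (_ && _); rewrite andbC; congr (_ && _).
by apply: eq_forallb => k; rewrite perm1 eqn_add2r.
Qed.
End SignedSum.

(** * Permutation characters on words *)

Section ContentPerm.
Variables (X : finType) (om : X -> nat) (s : X -> X).
Hypothesis om_gt0 : forall x, 0 < om x.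

(** It covers two counts that get compared. Unit weights and a permutation [s] give the words fixed
    by [s]; [s = id] with cycle lengths as weights gives the colourings of the cycles, which are
    also the monomial coefficients of a power sum. *)
Definition weighted_words (A : finType) (c : A -> nat) : {set {ffun X -> A}} :=
  [set f : {ffun X -> A} | [forall x, f (s x) == f x]
     && [forall a, \sum_(x | f x == a) om x == c a]].

(** Positive weights prevent a letter of multiplicity zero from occurring, so a bijection between
    the letters of nonzero multiplicity carries words to words. *)
Let leq_weighted_words (A B : finType) (a0 : A) (b0 : B) (c : A -> nat) (d : B -> nat) :
  perm_eq [seq v <- [seq c a | a <- enum A] | v != 0]
          [seq v <- [seq d b | b <- enum B] | v != 0] ->
  #|weighted_words c| <= #|weighted_words d|.
Proof.
rewrite (@filter_map _ _ c) (@filter_map _ _ d); set sA := filter _ _; set sB := filter _ _.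
case/(perm_iotaP 0) => Is pIs eIs.
pose sB' := map (nth b0 sB) Is.
have pB : perm_eq sB' sB.
  by rewrite -[X in perm_eq _ X](mkseq_nth b0 sB) /mkseq -(size_map d) perm_map.
have dB : map c sA = map d sB'.
  rewrite eIs -map_comp; apply/eq_in_map => i.
  by rewrite (perm_mem pIs) mem_iota size_map /= add0n => lt_i; rewrite (nth_map b0).
have szB : size sA = size sB' by rewrite -(size_map c) dB size_map.
have uA : uniq sA by rewrite filter_uniq ?enum_uniq.
have uB : uniq sB' by rewrite (perm_uniq pB) filter_uniq ?enum_uniq.
pose phi a := nth b0 sB' (index a sA); pose psi b := nth a0 sA (index b sB').
have psiK a : a \in sA -> psi (phi a) = a.
  by move=> aA; rewrite /psi index_uniq ?nth_index // -szB index_mem.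
have phiK b : b \in sB' -> phi (psi b) = b.
  by move=> bB; rewrite /phi index_uniq ?nth_index // szB index_mem.
have psiA b : b \in sB' -> psi b \in sA.
  by move=> bB; rewrite mem_nth // szB index_mem.
have phiB a : a \in sA -> phi a \in sB'.
  by move=> aA; rewrite mem_nth // -szB index_mem.
have dphi a : a \in sA -> d (phi a) = c a.
  move=> aA; rewrite /phi -(nth_map _ 0) -?dB -?szB ?index_mem //.
  by rewrite (nth_map a0) ?index_mem // nth_index.
have memA f x : f \in weighted_words c -> f x \in sA.
  rewrite inE => /andP[_ /forallP/(_ (f x))/eqP fx]; rewrite mem_filter mem_enum andbT /=.
  by rewrite -fx (bigD1 x) //= -lt0n; have := om_gt0 x; lia.
pose F (f : {ffun X -> A}) := [ffun x => phi (f x)].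
rewrite -(@card_in_imset _ _ F (weighted_words c)); last first.
  move=> f g fW gW eF; apply/ffunP => x; have /ffunP/(_ x) := eF.
  by rewrite !ffunE => /(congr1 psi); rewrite !psiK ?memA.
apply/subset_leq_card/subsetP => _ /imsetP[f fW ->]; have := fW.
rewrite !inE => /andP[/forallP st /forallP cf]; apply/andP; split.
  by apply/forallP => x; rewrite !ffunE (eqP (st x)).
apply/forallP => b; have [bB|nbB] := boolP (b \in sB'); last first.
  have -> : d b = 0.
    by move: nbB; rewrite (perm_mem pB) mem_filter mem_enum andbT negbK => /eqP.
  rewrite big1 // => x; rewrite ffunE => /eqP e; case/negP: nbB.
  by rewrite -e phiB ?memA.
have := cf (psi b); rewrite -dphi ?psiA // phiK // => /eqP <-.
apply/eqP; apply: eq_bigl => x; rewrite ffunE; apply/eqP/eqP => [<-|->].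
  by rewrite psiK ?memA.
by rewrite phiK.
Qed.

Lemma card_weighted_words (A B : finType) (a0 : A) (b0 : B) (c : A -> nat) (d : B -> nat) :
  perm_eq [seq v <- [seq c a | a <- enum A] | v != 0]
          [seq v <- [seq d b | b <- enum B] | v != 0] ->
  #|weighted_words c| = #|weighted_words d|.
Proof.
move=> pcd; apply/eqP; rewrite eqn_leq (leq_weighted_words a0 b0 pcd) /=.
by rewrite (leq_weighted_words b0 a0) // perm_sym.
Qed.
End ContentPerm.

Section Words.
Variable n : nat.
Local Notation G := [set: 'S_n]%G.

Definition stable (A : finType) (s : 'S_n) (f : {ffun 'I_n -> A}) :=
  [forall x, f (s x) == f x].
Definition occ (A : finType) (f : {ffun 'I_n -> A}) (a : A) := \sum_(x | f x == a) 1.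
Definition has_content (A : finType) (c : A -> nat) (f : {ffun 'I_n -> A}) :=
  [forall a, occ f a == c a].
Definition fixed_words (A : finType) (c : A -> nat) (s : 'S_n) : {set {ffun 'I_n -> A}} :=
  [set f | stable s f && has_content c f].
Definition shift_word (A : finType) (f : {ffun 'I_n -> A}) (y : 'S_n) :
  {ffun 'I_n -> A} := [ffun x => f (y x)].

Lemma stableP (A : finType) (s : 'S_n) (f : {ffun 'I_n -> A}) :
  reflect (forall x, f (s x) = f x) (stable s f).
Proof. by apply: (iffP forallP) => H x; apply/eqP/H. Qed.

Lemma has_contentP (A : finType) (c : A -> nat) (f : {ffun 'I_n -> A}) :
  reflect (forall a, occ f a = c a) (has_content c f).
Proof. by apply: (iffP forallP) => H x; apply/eqP/H. Qed.

Lemma shift_wordK (A : finType) y : cancel ((@shift_word A)^~ y) ((@shift_word A)^~ (y^-1)%g).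
Proof. by move=> f; apply/ffunP => x; rewrite !ffunE permKV. Qed.

Lemma occ_shift (A : finType) (f : {ffun 'I_n -> A}) y a : occ (shift_word f y) a = occ f a.
Proof.
rewrite /occ [RHS](reindex_inj (@perm_inj _ y)) /=.
by apply: eq_bigl => x; rewrite ffunE.
Qed.

Lemma has_content_shift (A : finType) (c : A -> nat) f y :
  has_content c (shift_word f y) = has_content c f.
Proof. by apply: eq_forallb => a; rewrite occ_shift. Qed.

Lemma stable_shift (A : finType) (f : {ffun 'I_n -> A}) s y :
  stable s (shift_word f y) = stable (s ^ y)%g f.
Proof.
apply/stableP/stableP => H x; last first.
  by have := H (y x); rewrite conjgE !permM permK !ffunE.
by have := H (y^-1 x)%g; rewrite !ffunE permKV conjgE !permM.
Qed.

Fact wordchar_subproof (A : finType) (c : A -> nat) :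
  is_class_fun <<G>>%g [ffun s => #|fixed_words c s|%:R]%R.
Proof.
rewrite genGid; apply: intro_class_fun => [x y _ _ | x]; last by rewrite inE.
congr (_%:R)%R; rewrite -(card_imset _ (can_inj (@shift_wordK A y))).
apply: eq_card => f; apply/imsetP/idP => [[g]|].
  by rewrite !inE => /andP[sg cg] ->; rewrite stable_shift has_content_shift sg.
rewrite inE => /andP[sf cf]; exists (shift_word f (y^-1)%g).
  by rewrite !inE has_content_shift cf stable_shift -conjgM mulgV conjg1 sf.
by apply/ffunP => z; rewrite !ffunE permK.
Qed.
(** The permutation character on words of content [c]; under the Frobenius correspondence it is the
    product of the complete functions [h_(c a)]. *)
Definition wordchar (A : finType) (c : A -> nat) : 'CF([set: 'S_n]) :=
  Cfun 0 (wordchar_subproof c).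

Lemma wordcharE (A : finType) (c : A -> nat) s :
  wordchar c s = (#|fixed_words c s|%:R)%R.
Proof. by rewrite cfunE. Qed.

Lemma eq_wordchar (A : finType) (c d : A -> nat) : c =1 d -> wordchar c = wordchar d.
Proof.
move=> ecd; apply/cfunP => s; rewrite !wordcharE; congr (_%:R)%R; apply: eq_card => f.
by rewrite !inE; congr andb; apply: eq_forallb => a; rewrite ecd.
Qed.

Lemma wordchar_perm (A B : finType) (a0 : A) (b0 : B) (c : A -> nat) (d : B -> nat) :
  perm_eq [seq v <- [seq c a | a <- enum A] | v != 0]
          [seq v <- [seq d b | b <- enum B] | v != 0] ->
  wordchar c = wordchar d.
Proof.
move=> pcd; apply/cfunP => s; rewrite !wordcharE; congr (_%:R)%R.
exact: (@card_weighted_words _ (fun=> 1) s (fun=> isT) _ _ a0 b0 _ _ pcd).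
Qed.

Lemma shift_trans (A : finType) (c : A -> nat) f g :
  has_content c f -> has_content c g -> exists y, g = shift_word f y.
Proof.
move=> /has_contentP cf /has_contentP cg.
have cnt (h : {ffun 'I_n -> A}) a : count_mem a (mktuple h) = occ h a.
  rewrite /occ sum1_card cardE /enum_mem size_filter -enumT /= count_map.
  by apply: eq_count => x /=.
have /tuple_permP[y ey] : perm_eq (mktuple g) (mktuple f).
  by apply/allP => a _ /=; rewrite !cnt cf cg.
exists y; apply/ffunP => x; rewrite ffunE.
have := congr1 (fun t => tnth t x) (val_inj ey : mktuple g = _).
by rewrite !tnth_mktuple.
Qed.

Lemma exists_word (A : finType) (c : A -> nat) :
  \sum_a c a = n -> exists f : {ffun 'I_n -> A}, has_content c f.
Proof.
move=> sum_c; pose w := flatten [seq nseq (c a) a | a <- enum A].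
have sz_w : size w == n.
  rewrite size_flatten /shape -map_comp -sum_c sumnE big_map big_enum /=.
  by apply/eqP; apply: eq_bigr => a _; rewrite /= size_nseq.
exists [ffun x => tnth (Tuple sz_w) x]; apply/has_contentP => a.
transitivity (count_mem a w).
  rewrite -[w]/(tval (Tuple sz_w)); move: (Tuple sz_w) => t.
  rewrite /occ -[in RHS](map_tnth_enum t) count_map -sum1_count big_enum_cond /=.
  by apply: eq_bigl => x; rewrite ffunE.
rewrite count_flatten -map_comp sumnE big_map big_enum /= (bigD1 a) //= big1 => [|b nb].
  by rewrite count_nseq /= eqxx mul1n addn0.
by rewrite count_nseq /= (negbTE nb).
Qed.

Definition word_stab (A : finType) (f : {ffun 'I_n -> A}) : {set 'S_n} :=
  [set s | stable s f].
Lemma word_stab_group (A : finType) (f : {ffun 'I_n -> A}) : group_set (word_stab f).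
Proof.
apply/group_setP; split=> [|x y]; rewrite !inE; first by apply/stableP => x; rewrite perm1.
by move=> /stableP sx /stableP sy; apply/stableP => z; rewrite permM sy sx.
Qed.
Canonical word_stab_grp (A : finType) f := Group (@word_stab_group A f).

(** The words of one content form a single orbit, and each of them is [shift_word f y] for exactly
    [#|word_stab f|] permutations [y]. *)
Lemma wordchar_Ind (A : finType) (c : A -> nat) f :
  has_content c f -> wordchar c = ('Ind[G, word_stab f] 1)%R.
Proof.
move=> cf; apply/cfun_inP => s _; rewrite wordcharE cfIndE ?subsetT //.
rewrite (eq_bigr (fun y => (stable s (shift_word f y))%:R%R)); last first.
  by move=> y _; rewrite cfun1E inE stable_shift.
rewrite -natr_sum (_ : \sum_(y in _) _ = #|word_stab f| * #|fixed_words c s|).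
  by rewrite natrM mulKf // pnatr_eq0 -lt0n cardG_gt0.
rewrite mulnC -sum_nat_const -big_mkcondr /=.
rewrite (partition_big (fun y => shift_word f y) (mem (fixed_words c s))) /=; last first.
  by move=> y /andP[_ sy]; rewrite inE sy has_content_shift.
apply: eq_bigr => g; rewrite inE => /andP[sg cg].
have [y ey] := shift_trans cf cg.
rewrite sum1_card -[RHS](card_imset _ (mulgI y)); apply: eq_card => z.
rewrite unfold_in /= in_setT /=; apply/idP/imsetP => [/andP[_ /eqP ez]|[t]].
  exists (y^-1 * z)%g; last by rewrite mulKVg.
  rewrite inE; apply/stableP => x; rewrite permM.
  have /ffunP/(_ (y^-1 x)%g) : shift_word f z = shift_word f y by rewrite ez.
  by rewrite !ffunE permKV.
rewrite inE => /stableP st ->; have -> : shift_word f (y * t)%g = g.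
  by rewrite ey; apply/ffunP => x; rewrite !ffunE permM st.
by rewrite sg eqxx.
Qed.

Lemma wordchar_char (A : finType) (c : A -> nat) : wordchar c \is a character.
Proof.
have [/existsP[f cf]|/existsPn none] := boolP [exists f, has_content c f].
  by rewrite (wordchar_Ind cf) cfInd_char ?cfun1_char.
rewrite (_ : wordchar c = 0)%R ?cfun0_char //; apply/cfunP => s; rewrite wordcharE !cfunE.
rewrite (_ : fixed_words c s = set0) ?cards0 //; apply/setP => f.
by rewrite !inE (negbTE (none f)) andbF.
Qed.

Lemma wordchar_dot1 (A : finType) (c : A -> nat) :
  \sum_a c a = n -> ('[wordchar c, 1] = 1)%R.
Proof.
move=> /exists_word[f cf]; rewrite (wordchar_Ind cf) -Frobenius_reciprocity.
by rewrite cfRes_cfun1 ?subsetT // cfnorm1.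
Qed.

Definition content_mx m L (h : {ffun 'I_n -> 'I_m * 'I_L}) : 'M['I_n.+1]_(m, L) :=
  \matrix_(i, k) inord (occ h (i, k)).

Lemma occ_le (A : finType) (f : {ffun 'I_n -> A}) a : occ f a < n.+1.
Proof.
by rewrite ltnS /occ sum1_card -[X in _ <= X]card_ord; apply: max_card.
Qed.

Lemma sum_occ (A : finType) (f : {ffun 'I_n -> A}) : \sum_a occ f a = n.
Proof.
by rewrite -[RHS]card_ord -sum1_card (partition_big f xpredT).
Qed.

Lemma content_mxE m L (h : {ffun 'I_n -> 'I_m * 'I_L}) i k :
  content_mx h i k = occ h (i, k) :> nat.
Proof. by rewrite mxE inordK // occ_le. Qed.

Lemma occ_fst m L (h : {ffun 'I_n -> 'I_m * 'I_L}) i :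
  occ [ffun x => (h x).1] i = \sum_k content_mx h i k.
Proof.
rewrite {1}/occ (partition_big (fun x => (h x).2) xpredT) //=.
apply: eq_bigr => k _; rewrite content_mxE /occ; apply: eq_bigl => x.
by rewrite ffunE -pair_eqE.
Qed.

Lemma occ_snd m L (h : {ffun 'I_n -> 'I_m * 'I_L}) k :
  occ [ffun x => (h x).2] k = \sum_i content_mx h i k.
Proof.
rewrite {1}/occ (partition_big (fun x => (h x).1) xpredT) //=.
apply: eq_bigr => i _; rewrite content_mxE /occ; apply: eq_bigl => x.
by rewrite ffunE -pair_eqE /= andbC.
Qed.

Definition margins m L (c : 'I_m -> nat) (d : 'I_L -> nat) (T : 'M['I_n.+1]_(m, L)) :=
  [forall i, \sum_k T i k == c i] && [forall k, \sum_i T i k == d k].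

(** A pair of words is one word over pairs. The product of the two characters therefore splits by
    joint content into transitive permutation characters, each containing the trivial character
    once. *)
Lemma wordchar_dot m L (c : 'I_m -> nat) (d : 'I_L -> nat) : \sum_i c i = n ->
  ('[wordchar c, wordchar d] = #|[set T | margins c d T]|%:R)%R.
Proof.
move=> sum_c; pose cmx (T : 'M['I_n.+1]_(m, L)) (p : 'I_m * 'I_L) : nat := T p.1 p.2.
transitivity (\sum_(T | margins c d T) '[wordchar (cmx T), 1])%R; last first.
  rewrite -sum1_card natr_sum; apply: eq_big => [T | T /andP[/forallP rT _]].
    by rewrite inE.
  rewrite wordchar_dot1 //; apply: etrans sum_c.
  rewrite -(pair_bigA _ (fun i k => T i k : nat)) /=.
  by apply: eq_bigr => i _; apply/eqP/rT.
rewrite -cfdot_suml [LHS]cfdotE [RHS]cfdotE; congr (_ * _)%R; apply: eq_bigr => s _.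
rewrite cfun1E in_setT rmorph1 mulr1 sum_cfunE !wordcharE rmorph_nat -natrM.
rewrite (eq_bigr (fun T => #|fixed_words (cmx T) s|%:R%R)); last by move=> T _; rewrite wordcharE.
rewrite -natr_sum; congr (_%:R)%R; rewrite -cardsX.
pose F (h : {ffun 'I_n -> 'I_m * 'I_L}) :=
  ([ffun x => (h x).1] : {ffun 'I_n -> 'I_m}, [ffun x => (h x).2] : {ffun 'I_n -> 'I_L}).
have F_inj : injective F.
  move=> h h' [/ffunP e1 /ffunP e2]; apply/ffunP => x.
  by have := e1 x; have := e2 x; rewrite !ffunE; case: (h x) (h' x) => ? ? [? ?] /= -> ->.
pose W := [set h | stable s h && margins c d (content_mx h)].
transitivity #|W|.
  rewrite -(card_imset _ F_inj); apply: eq_card => [[f g]]; rewrite !inE /=.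
  have margE (h : {ffun 'I_n -> 'I_m * 'I_L}) : margins c d (content_mx h) =
     has_content c [ffun x => (h x).1] && has_content d [ffun x => (h x).2].
    by congr andb; apply: eq_forallb => i; rewrite ?occ_fst ?occ_snd.
  apply/idP/imsetP => [/andP[/andP[sf cf] /andP[sg cg]] | [h]].
    exists [ffun x => (f x, g x)].
      rewrite inE margE; apply/and3P; split.
      - apply/stableP => x; rewrite !ffunE.
        by rewrite (stableP _ _ sf) (stableP _ _ sg).
      - by rewrite (_ : [ffun x => _] = f) //; apply/ffunP => x; rewrite !ffunE.
      - by rewrite (_ : [ffun x => _] = g) //; apply/ffunP => x; rewrite !ffunE.
    by congr pair; apply/ffunP => x; rewrite !ffunE.
  rewrite inE margE => /and3P[/stableP sh ch dh] [-> ->]; rewrite ch dh !andbT.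
  by apply/andP; split; apply/stableP => x; rewrite !ffunE sh.
rewrite -sum1_card (partition_big (@content_mx m L) (margins c d)) /=; last first.
  by move=> h; rewrite inE => /andP[].
apply: eq_bigr => T mT; rewrite sum1_card; apply: eq_card => h.
rewrite unfold_in /= !inE -andbA; congr (_ && _).
apply/andP/has_contentP => [[_ /eqP eT] [i k]|cT].
  by rewrite /cmx -eT content_mxE.
have eT : content_mx h = T.
  by apply/matrixP => i k; apply/val_inj; rewrite [LHS]content_mxE cT.
by rewrite eT mT.
Qed.

End Words.

(** * Jacobi-Trudi characters and Young's rule *)

Lemma rowsum_entry m L b (T : 'M['I_b.+1]_(m, L)) (i : 'I_m) :
  rowsum L (entry T) i = \sum_k T i k.
Proof. by rewrite /rowsum big_mkord; apply: eq_bigr => k _; rewrite entryE. Qed.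

Lemma colsum_entry m L b (T : 'M['I_b.+1]_(m, L)) (k : 'I_L) :
  colsum m (entry T) k = \sum_i T i k.
Proof. by rewrite /colsum big_mkord; apply: eq_bigr => i _; rewrite entryE. Qed.

Lemma interlacing0 m l T i k : interlacing m l (fun=> 0) T ->
  i < m -> k < l -> k < i -> T i k = 0.
Proof.
move=> /interlacingP H; suff P c : i < m -> c <= l -> c <= i -> pchain (fun=> 0) T i c = 0.
  move=> lt_i lt_k lt_ki; have := P k.+1 lt_i lt_k lt_ki; rewrite pchainS; lia.
elim: i c => [|i IH] [|c] // lt_i lt_c le_c; try by rewrite pchain0.
by apply/eqP; rewrite -leqn0 (leq_trans (H _ _ lt_i lt_c)) // IH //; lia.
Qed.

Section Schur.
Variables (n L : nat).

Definition decreasing (nu : nat -> nat) := forall k, k.+1 < L -> nu k.+1 <= nu k.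

(** Here [ka k] is the index [nu_(w k) - w k + k] of the determinant. If it is negative no [ka]
    satisfies the equation, which encodes the convention that [h] vanishes in negative degrees. *)
Definition alternant_content (nu : nat -> nat) (w : 'S_L) (ka : {ffun 'I_L -> 'I_n.+1}) :=
  [forall k : 'I_L, ka k + (L - k) == nu (w k) + (L - w k)].

Lemma sum_alternant (nu : nat -> nat) w ka : \sum_(k < L) nu k = n ->
  alternant_content nu w ka -> \sum_k ka k = n.
Proof.
move=> sum_nu /forallP H; apply: etrans sum_nu; apply: (@addIn (\sum_(k < L) (L - k))).
rewrite -!big_split /= [RHS](reindex_inj (@perm_inj _ w)) /=.
by apply: eq_bigr => k _; apply/eqP/H.
Qed.

(* The Jacobi-Trudi determinant [det (h_(nu_i - i + j))], each product of [h]'s being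
   replaced by its permutation character. *)
Definition schar (nu : nat -> nat) : 'CF([set: 'S_n]) :=
  (\sum_(w : 'S_L) \sum_(ka | alternant_content nu w ka)
     (-1) ^+ odd_perm w *: wordchar n (fun k => ka k : nat))%R.

(** Read with [T i k] as the number of letters [i] in row [k], these are the semistandard tableaux
    of shape [nu] and content [beta], so the cardinal is a Kostka number. *)
Definition kostka_mx m (beta nu : nat -> nat) : {set 'M['I_n.+1]_(m, L)} :=
  [set T | [&& has_rowsums m L beta (entry T), dominant m L (fun=> 0) (entry T)
             & [forall k : 'I_L, colsum m (entry T) k == nu k]]].

Section Row.
Variables (m : nat) (beta : nat -> nat).
Hypothesis sum_beta : \sum_(i < m) beta i = n.

Lemma beta_le i : i < m -> beta i <= n.
Proof. by move=> lt_i; rewrite -sum_beta (bigD1 (Ordinal lt_i)) //= leq_addr. Qed.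

Lemma sum_colsum (T : 'M['I_n.+1]_(m, L)) : has_rowsums m L beta (entry T) ->
  \sum_(k < L) colsum m (entry T) k = n.
Proof.
move=> /forallP rT; apply: etrans sum_beta.
rewrite (eq_bigr (fun k => \sum_i T i k)); last by move=> k _; rewrite colsum_entry.
rewrite exchange_big /=; apply: eq_bigr => i _.
by rewrite -rowsum_entry; apply/eqP/rT.
Qed.

Lemma colsum_le (T : 'M['I_n.+1]_(m, L)) (k : 'I_L) :
  has_rowsums m L beta (entry T) -> colsum m (entry T) k <= n.
Proof. by move=> /sum_colsum; rewrite (bigD1 k) //=; lia. Qed.

(** Rows have length at most [n] and start [n] columns apart, so no two of them share a column and
    column strictness is vacuous: the skew shape of [h_beta]. *)
Definition spread_rho i := (m - i) * n.

Lemma spread_interlacing (T : 'M['I_n.+1]_(m, L)) : has_rowsums m L beta (entry T) ->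
  interlacing m L spread_rho (entry T).
Proof.
move=> /forallP rT; apply/interlacingP => i c lt_i lt_c.
have : pchain spread_rho (entry T) i.+1 c.+1 <= spread_rho i.+1 + n.
  rewrite leq_add2l (@leq_trans (rowsum L (entry T) i.+1)) //; last first.
    by rewrite (eqP (rT (Ordinal lt_i))) beta_le.
  by rewrite /rowsum (@big_cat_nat _ _ _ c.+1 0 L) //= leq_addr.
move/leq_trans; apply; rewrite /pchain /spread_rho -mulSnr -subSn ?subSS; last by lia.
exact: leq_addr.
Qed.

(** Each term of the determinant counts the matrices with prescribed margins. Seen as fillings of
    the spread rows, they cancel down to the dominant ones. *)
Lemma wordchar_schar nu : decreasing nu ->
  ('[wordchar n (fun i : 'I_m => beta i), schar nu] = #|kostka_mx m beta nu|%:R)%R.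
Proof.
move=> nu_dec; rewrite cfdot_sumr.
have := signed_sum_dominant (m := m) (l := L) (b := n) spread_rho (mu := fun=> 0)
  (nu := nu) (R := beta) beta_le (fun _ _ => leqnn _) nu_dec algC.
rewrite (_ : #|_| = #|kostka_mx m beta nu|); last first.
  apply: eq_card => T; rewrite !inE /tabP -andbA.
  case rT: (has_rowsums m L beta (entry T)) => //=.
  by rewrite spread_interlacing // rT.
move=> <-; apply: eq_bigr => w _; rewrite cfdot_sumr.
pose ka (T : 'M['I_n.+1]_(m, L)) : {ffun 'I_L -> 'I_n.+1} :=
  [ffun k : 'I_L => inord (colsum m (entry T) k)].
have kaE T k : has_rowsums m L beta (entry T) -> ka T k = colsum m (entry T) k :> nat.
  by move=> rT; rewrite ffunE inordK // ltnS colsum_le.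
rewrite [RHS](partition_big ka (alternant_content nu w)) /=; last first.
  move=> T /andP[/andP[rT _] /forallP wT]; apply/forallP => k.
  by rewrite kaE //; have := wT k; rewrite add0n.
apply: eq_bigr => kap /forallP Hk; rewrite cfdotZr rmorph_sign wordchar_dot //.
rewrite -sum1_card natr_sum mulr_sumr; apply: eq_big => [T|T _]; last by rewrite mulr1.
rewrite inE /margins /tabP; have -> : [forall i, \sum_k T i k == beta i] =
    has_rowsums m L beta (entry T).
  by apply: eq_forallb => i; rewrite rowsum_entry.
case rT: (has_rowsums m L beta (entry T)) => //=; rewrite spread_interlacing //=.
apply/forallP/andP => [cT | [_ /eqP <-] k]; last by rewrite -colsum_entry kaE.
have eT : ka T = kap by apply/ffunP => k; apply/val_inj; rewrite /= kaE // colsum_entry; apply/eqP.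
split; last exact/eqP.
by apply/forallP => k; rewrite add0n -kaE // eT; apply: Hk.
Qed.

End Row.

Lemma kostka_dominance m beta nu (T : 'M['I_n.+1]_(m, L)) :
  T \in kostka_mx m beta nu -> forall i k, i < k -> entry T i k = 0.
Proof.
rewrite inE => /and3P[_ dT _] i k lt_ik; case: (ltnP k L) => lt_k; last first.
  by rewrite /entry; case: insubP => // k' _ _; rewrite insubF //; lia.
case: (ltnP i m) => lt_i; last by rewrite /entry insubF //; lia.
exact: (interlacing0 dT lt_k lt_i lt_ik).
Qed.

Definition diag_tab (nu : nat -> nat) : 'M['I_n.+1]_(L, L) :=
  matrix_of L L n (fun i k => if i == k then nu i else 0).

Lemma diag_tab_entry nu : (forall k, k < L -> nu k <= n) -> forall i k, i < L -> k < L ->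
  entry (diag_tab nu) i k = if i == k then nu i else 0.
Proof. by move=> le_nu i k lt_i lt_k; rewrite entry_matrix_of //; case: ifP => // _; apply: le_nu. Qed.

Lemma sum_delta (nu : nat -> nat) i N : \sum_(0 <= k < N) (if i == k then nu i else 0)
   = if i < N then nu i else 0.
Proof.
elim: N => [|N IH]; first by rewrite big_geq.
by rewrite big_nat_recr //= IH ltnS; case: ltngtP => //; rewrite addn0.
Qed.

Lemma diag_interlacing nu : decreasing nu ->
  interlacing L L (fun=> 0) (fun i k => if i == k then nu i else 0).
Proof.
move=> nu_dec; apply/interlacingP => i c lt_i lt_c; rewrite /pchain !add0n !sum_delta ltnS.
by case: ltnP => // _; apply: nu_dec.
Qed.

Lemma diag_dominant nu : decreasing nu ->
  dominant L L (fun=> 0) (fun i k => if i == k then nu i else 0).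
Proof.
move=> nu_dec; rewrite /dominant (@eq_interlacing _ _ _ _ (fun i k => if i == k then nu i else 0)).
  exact: diag_interlacing.
by move=> i k _ _; rewrite eq_sym; case: eqP => // ->.
Qed.

(** Expanding the left factor gives an alternating sum of Kostka numbers, which cancels to the
    dominant semistandard fillings of shape [tau] and content [nu]. Interlacing by rows and by
    columns forces such a matrix to be diagonal. *)
Lemma dot_schar (nu tau : nat -> nat) : decreasing nu -> decreasing tau ->
    \sum_(k < L) nu k = n -> \sum_(k < L) tau k = n ->
  ('[schar nu, schar tau] = [forall k : 'I_L, nu k == tau k]%:R)%R.
Proof.
move=> nu_dec tau_dec sum_nu sum_tau.
have le_tau k : k < L -> tau k <= n by exact: beta_le sum_tau k.
pose D := [set T : 'M['I_n.+1]_(L, L) | [&& tabP (fun=> 0) tau T, dominant L L (fun=> 0) (entry T)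
                      & [forall k : 'I_L, 0 + colsum L (entry T) k == nu k]]].
transitivity (#|D|%:R : algC)%R; last first.
  have diagP (T : 'M['I_n.+1]_(L, L)) : T \in D -> T = diag_tab tau /\ forall k : 'I_L, nu k = tau k.
    rewrite inE => /and3P[/andP[/forallP rT iT] dT /forallP cT].
    have off i k : i < L -> k < L -> i != k -> entry T i k = 0.
      move=> lt_i lt_k; rewrite neq_ltn => /orP[] lt_ik.
        exact: (interlacing0 dT lt_k lt_i lt_ik).
      exact: (interlacing0 iT lt_i lt_k lt_ik).
    have row (i : 'I_L) : entry T i i = tau i.
      rewrite -(eqP (rT i)) rowsum_entry (bigD1 i) //= big1 ?addn0 ?entryE // => k nk.
      by rewrite -entryE off // eq_sym.
    have col (i : 'I_L) : entry T i i = nu i.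
      rewrite -(eqP (cT i)) add0n colsum_entry (bigD1 i) //= big1 ?addn0 ?entryE // => k nk.
      by rewrite -entryE off.
    split; last by move=> k; rewrite -row -col.
    apply: entry_inj => i k lt_i lt_k; rewrite diag_tab_entry //.
    by case: eqVneq => [<-|ne]; [rewrite (row (Ordinal lt_i)) | rewrite off].
  case: forallP => [eq_nt|ne_nt]; last first.
    rewrite (_ : D = set0) ?cards0 //; apply/setP => T; rewrite [RHS]inE.
    by apply/negP => /diagP[_ e]; apply: ne_nt => k; apply/eqP.
  rewrite (_ : D = [set diag_tab tau]) ?cards1 //; apply/setP => T; rewrite [RHS]inE.
  apply/idP/eqP => [/diagP[]//|->]; rewrite inE /tabP.
  have eI := eq_interlacing (fun=> 0) (diag_tab_entry le_tau).
  have eD : dominant L L (fun=> 0) (entry (diag_tab tau)).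
    rewrite /dominant (@eq_interlacing _ _ _ _ (fun k i => if i == k then tau i else 0)).
      exact: diag_dominant.
    by move=> i k lt_i lt_k; rewrite diag_tab_entry.
  rewrite eI diag_interlacing // eD andbT /=; apply/andP; split; apply/forallP => i.
    rewrite /rowsum big_nat (eq_bigr (fun k => if val i == k then tau i else 0)).
      by rewrite -big_nat sum_delta ltn_ord.
    by move=> k /andP[_ lt_k]; rewrite diag_tab_entry.
  rewrite add0n (eqP (eq_nt i)) /colsum big_nat (eq_bigr (fun k => if val i == k then tau i else 0)).
    by rewrite -big_nat sum_delta ltn_ord.
  by move=> k /andP[_ lt_k]; rewrite diag_tab_entry // eq_sym; case: eqP => // ->.
have := signed_sum_dominant (m := L) (l := L) (b := n) (fun=> 0) (mu := fun=> 0)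
  (nu := nu) (R := tau) le_tau (fun _ _ => leqnn _) nu_dec algC.
rewrite -/D => <-; rewrite cfdot_suml; apply: eq_bigr => w _; rewrite cfdot_suml.
pose ka (T : 'M['I_n.+1]_(L, L)) : {ffun 'I_L -> 'I_n.+1} :=
  [ffun k : 'I_L => inord (colsum L (entry T) k)].
have kaE T k : has_rowsums L L tau (entry T) -> ka T k = colsum L (entry T) k :> nat.
  by move=> rT; rewrite ffunE inordK // ltnS (colsum_le sum_tau).
rewrite [RHS](partition_big ka (alternant_content nu w)) /=; last first.
  move=> T /andP[/andP[rT _] /forallP wT]; apply/forallP => k.
  by rewrite kaE //; have := wT k; rewrite add0n.
apply: eq_bigr => kap Hk; rewrite cfdotZl.
pose kn k := if insub k is Some k' then kap k' : nat else 0.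
have knE (k : 'I_L) : kn k = kap k by rewrite /kn valK.
rewrite (@eq_wordchar _ _ _ (fun k : 'I_L => kn k)) => [|k]; last by rewrite knE.
rewrite wordchar_schar //; last by rewrite -[RHS](sum_alternant sum_nu Hk); apply: eq_bigr => k _; rewrite knE.
(* Transposition turns the Kostka matrices of shape [tau] into the fillings to which the signed sum
   refers. *)
rewrite -sum1_card natr_sum mulr_sumr (reindex_inj (@trmx_inj _ _ _)) /=.
have trE (T : 'M['I_n.+1]_(L, L)) i k : entry T^T i k = entry T k i.
  by rewrite /entry; do 2 case: insubP => //=; rewrite ?mxE // => *; rewrite mxE.
apply: eq_big => [T|T _]; last by rewrite mulr1.
rewrite inE /tabP.
have -> : has_rowsums L L kn (entry T^T) = [forall k : 'I_L, colsum L (entry T) k == kap k].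
  apply: eq_forallb => k; rewrite -knE; congr (_ == _).
  by apply: eq_bigr => i _; rewrite trE.
have -> : [forall k : 'I_L, colsum L (entry T^T) k == tau k] = has_rowsums L L tau (entry T).
  by apply: eq_forallb => k; congr (_ == _); apply: eq_bigr => i _; rewrite trE.
have -> : dominant L L (fun=> 0) (entry T^T) = interlacing L L (fun=> 0) (entry T).
  by apply: eq_interlacing => i k _ _; rewrite trE.
case rT: (has_rowsums L L tau (entry T)); last by rewrite !andbF.
rewrite andbC andbT /=; case: interlacing => //=.
apply/forallP/andP => [cT | [_ /eqP <-] k]; last by rewrite kaE.
have eT : ka T = kap by apply/ffunP => k; apply/val_inj; rewrite /= kaE //; apply/eqP.
split; last exact/eqP.
by apply/forallP => k; rewrite add0n -kaE // eT; apply: (forallP Hk).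
Qed.

(** A letter [i] occurs only in rows [k <= i], so the two statistics differ by a sum of nonnegative
    terms that vanishes only for a diagonal matrix. This yields the unitriangularity of Kostka
    numbers from a single integer. *)
Lemma kostka_measure m beta nu (T : 'M['I_n.+1]_(m, L)) : T \in kostka_mx m beta nu ->
  \sum_(i < m) i * beta i = \sum_(k < L) k * nu k + \sum_(i < m) \sum_(k < L) (i - k) * T i k.
Proof.
move=> TK; have lowT := kostka_dominance TK; move: TK.
rewrite inE => /and3P[/forallP rT _ /forallP cT].
rewrite (eq_bigr (fun i : 'I_m => \sum_(k < L) i * T i k)); last first.
  by move=> i _; rewrite -(eqP (rT i)) rowsum_entry big_distrr.
rewrite [X in X + _](eq_bigr (fun k : 'I_L => \sum_(i < m) k * T i k)); last first.
  by move=> i _; rewrite -(eqP (cT i)) colsum_entry big_distrr.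
rewrite [X in X + _]exchange_big -big_split /=; apply: eq_bigr => i _.
rewrite -big_split /=; apply: eq_bigr => k _; rewrite -mulnDl.
case: (leqP k i) => [le_ki|lt_ik]; first by rewrite subnKC.
by rewrite -entryE (lowT i k) ?muln0.
Qed.

Lemma diag_in_kostka nu : decreasing nu -> \sum_(k < L) nu k = n ->
  diag_tab nu \in kostka_mx L nu nu.
Proof.
move=> nu_dec sum_nu; have le_nu := beta_le sum_nu.
rewrite inE; apply/and3P; split.
- apply/forallP => i; rewrite /rowsum big_nat (eq_bigr (fun k => if val i == k then nu i else 0)).
    by rewrite -big_nat sum_delta ltn_ord.
  by move=> k /andP[_ lt_k]; rewrite diag_tab_entry.
- rewrite /dominant (@eq_interlacing _ _ _ _ (fun k i => if i == k then nu i else 0)).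
    exact: diag_dominant.
  by move=> i k lt_i lt_k; rewrite diag_tab_entry.
apply/forallP => i; rewrite /colsum big_nat (eq_bigr (fun k => if val i == k then nu i else 0)).
  by rewrite -big_nat sum_delta ltn_ord.
by move=> k /andP[_ lt_k]; rewrite diag_tab_entry // eq_sym; case: eqP => // ->.
Qed.

Lemma kostka_diag (beta nu : nat -> nat) (T : 'M['I_n.+1]_(L, L)) : \sum_(k < L) beta k = n ->
    T \in kostka_mx L beta nu -> \sum_(i < L) i * beta i <= \sum_(k < L) k * nu k ->
  T = diag_tab beta /\ forall k : 'I_L, nu k = beta k.
Proof.
move=> sum_b TK; rewrite (kostka_measure TK) -{2}[\sum_(k < L) _]addn0 leq_add2l leqn0.
rewrite sum_nat_eq0 => /forallP H.
have off (i k : 'I_L) : i != k -> T i k = 0 :> nat.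
  rewrite neq_ltn => /orP[lt_ik|lt_ki]; first by rewrite -entryE (kostka_dominance TK).
  have := H i; rewrite /= sum_nat_eq0 => /forallP/(_ k) /=.
  by rewrite muln_eq0 subn_eq0 leqNgt lt_ki => /eqP.
move: TK; rewrite inE => /and3P[/forallP rT _ /forallP cT].
have row (i : 'I_L) : T i i = beta i :> nat.
  rewrite -(eqP (rT i)) rowsum_entry (bigD1 i) //= big1 ?addn0 // => k nk.
  by rewrite off // eq_sym.
have col (i : 'I_L) : T i i = nu i :> nat.
  by rewrite -(eqP (cT i)) colsum_entry (bigD1 i) //= big1 ?addn0 // => k nk; rewrite off.
split; last by move=> k; rewrite -row -col.
apply: entry_inj => i k lt_i lt_k; rewrite (diag_tab_entry (beta_le sum_b)) //.
rewrite (entryE T (Ordinal lt_i) (Ordinal lt_k)).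
case: eqP => [e|/eqP ne]; last by apply: off.
by rewrite (_ : Ordinal lt_k = Ordinal lt_i) ?row //; apply/val_inj.
Qed.

Definition partitions : {set {ffun 'I_L -> 'I_n.+1}} :=
  [set p : {ffun 'I_L -> 'I_n.+1} | [forall i : 'I_L, forall j : 'I_L, (i <= j) ==> (p j <= p i)] && (\sum_i p i == n)].

Definition fn (p : {ffun 'I_L -> 'I_n.+1}) (k : nat) : nat :=
  if insub k is Some k' then p k' else 0.

Lemma fnE p (k : 'I_L) : fn p k = p k. Proof. by rewrite /fn valK. Qed.

Lemma fn_dec p : p \in partitions -> decreasing (fn p).
Proof.
rewrite inE => /andP[/forallP H _] k lt_k.
have /forallP/(_ (Ordinal lt_k)) := H (Ordinal (ltnW lt_k)).
by rewrite /= leqnSn /= -!fnE.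
Qed.

Lemma sum_fn p : p \in partitions -> \sum_(k < L) fn p k = n.
Proof.
rewrite inE => /andP[_ /eqP H]; apply: etrans H.
by apply: eq_bigr => k _; rewrite fnE.
Qed.

Lemma fn_inj p q : (forall k : 'I_L, fn p k = fn q k) -> p = q.
Proof. by move=> e; apply/ffunP => k; apply/val_inj; have := e k; rewrite !fnE. Qed.

Lemma schar_dot p q : p \in partitions -> q \in partitions ->
  ('[schar (fn p), schar (fn q)] = (p == q)%:R)%R.
Proof.
move=> Pp Pq; rewrite dot_schar ?sum_fn //; try exact: fn_dec.
congr (nat_of_bool _)%:R%R; apply/forallP/eqP => [H|-> //].
by apply: fn_inj => k; apply/eqP.
Qed.

Lemma schar_vchar nu : schar nu \in 'Z[irr [set: 'S_n]]%g.
Proof.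
apply: rpred_sum => w _; apply: rpred_sum => ka _.
by rewrite scale_zchar ?rpredX ?rpredN ?rpred1 // char_vchar ?wordchar_char.
Qed.

(** A virtual character of norm 1 is irreducible up to sign. The sign is determined by the positive
    Kostka number whose shape and content are equal. *)
Lemma schar_irr p : p \in partitions -> exists i, (schar (fn p) = 'chi_i)%R.
Proof.
move=> Pp; have nrm := schar_dot Pp Pp; rewrite eqxx in nrm.
have [[|] [i di]] := vchar_norm1P (schar_vchar (fn p)) nrm; last first.
  by exists i; rewrite di scale1r.
have K := wordchar_schar (sum_fn Pp) (fn_dec Pp).
have K0 : (0 < #|kostka_mx L (fn p) (fn p)|)%N.
  by apply/card_gt0P; exists (diag_tab (fn p)); rewrite diag_in_kostka ?sum_fn //; apply: fn_dec.
have : (0 <= '[wordchar n (fun k : 'I_L => fn p k), 'chi_i])%R.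
  by rewrite natr_ge0 // Cnat_cfdot_char_irr ?wordchar_char.
move: K; rewrite di expr1 scaleN1r cfdotNr => K ge0; exfalso.
by have := ge0; rewrite -oppr_le0 K lern0 -leqn0 leqNgt K0.
Qed.

Hypotheses (n_gt0 : 0 < n) (le_nL : n <= L).

Definition sorted_parts (A : finType) (c : A -> nat) :=
  sort geq [seq v <- [seq c a | a <- enum A] | v != 0].

Lemma map_nth_pad (s : seq nat) : size s <= L ->
  [seq nth 0 s (k : 'I_L) | k <- enum 'I_L] = s ++ nseq (L - size s) 0.
Proof.
move=> le_s; rewrite (map_comp (nth 0 s) val) val_enum_ord.
apply: (@eq_from_nth _ 0); first by rewrite size_map size_iota size_cat size_nseq subnKC.
move=> i; rewrite size_map size_iota => lt_i; rewrite (nth_map 0) ?size_iota // nth_iota //.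
by rewrite nth_cat nth_nseq; case: ltnP => // le_i; rewrite nth_default // if_same.
Qed.

(** Reordering the content and padding it with zeros do not change the character. There are at most
    [n] nonzero parts, so they fit into [L] places. *)
Lemma sorted_parts_partition (A : finType) (c : A -> nat) : \sum_a c a = n ->
  exists2 p, p \in partitions & wordchar n c = wordchar n (fun k : 'I_L => p k : nat).
Proof.
move=> sum_c; set s := sorted_parts c.
have sum_s : sumn s = n.
  rewrite sumnE /s (perm_big _ (permEl (perm_sort _ _))) /= big_filter big_map big_enum_cond /=.
  by rewrite -[RHS]sum_c big_mkcond; apply: eq_bigr => a _; case: eqP => // ->.
have pos_s : {in s, forall v, 0 < v}.
  by move=> v; rewrite mem_sort mem_filter lt0n => /andP[].
have srt_s : sorted geq s by apply: sort_sorted => x y; apply: leq_total.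
have le_s v : v \in s -> v <= n.
  by rewrite -sum_s => vs; rewrite (perm_sumn (perm_to_rem vs)) /= leq_addr.
have sz_s : size s <= L.
  apply: leq_trans le_nL; rewrite -[X in _ <= X]sum_s sumnE -sum1_size big_seq [X in _ <= X]big_seq.
  by apply: leq_sum => v /pos_s.
have nthle i : nth 0 s i <= n.
  by case: (ltnP i (size s)) => [/(mem_nth 0)/le_s|/(nth_default 0)->].
pose p : {ffun 'I_L -> 'I_n.+1} := [ffun k : 'I_L => inord (nth 0 s k)].
have pE (k : 'I_L) : p k = nth 0 s k :> nat by rewrite ffunE inordK // ltnS.
have pads : [seq p k : nat | k <- enum 'I_L] = s ++ nseq (L - size s) 0.
  by rewrite -map_nth_pad //; apply: eq_map => k.
exists p.
  rewrite inE; apply/andP; split; last first.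
    have : sumn [seq p k : nat | k <- enum 'I_L] = n by rewrite pads sumn_cat sumn_nseq mul0n addn0.
    by rewrite sumnE big_map big_enum /= => ->.
  apply/forallP => i; apply/forallP => j; apply/implyP => le_ij; rewrite !pE.
  case: (ltnP j (size s)) => [lt_j|/(nth_default 0)->//].
  have := sorted_leq_nth (rev_trans leq_trans) leqnn 0 srt_s; apply=> //.
  by rewrite inE (leq_ltn_trans le_ij).
have [a0 _] : exists a : A, true.
  case: (pickP A) => [a _|noA]; first by exists a.
  by move: n_gt0; rewrite -sum_c big_pred0 // => a; have := noA a.
have k0 : 'I_L by exists 0; apply: leq_trans le_nL.
apply: (@wordchar_perm n _ _ a0 k0); rewrite pads filter_cat filter_nseq /= cats0.
rewrite perm_sym (_ : filter _ s = s).
  by rewrite /s /sorted_parts perm_sort perm_refl.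
by apply/all_filterP/allP => v /pos_s; rewrite lt0n.
Qed.

(** The Jacobi-Trudi sums lie in the span of the word characters of partitions. Both families have
    the same length and the former is orthonormal, so the spans agree, and the coefficients are
    scalar products. *)
Lemma wordchar_young m (beta : nat -> nat) : \sum_(i < m) beta i = n ->
  (wordchar n (fun i : 'I_m => beta i) =
   \sum_(p in partitions) #|kostka_mx m beta (fn p)|%:R *: schar (fn p))%R.
Proof.
move=> sum_b; set phi := wordchar n _.
pose X := [seq schar (fn p) | p <- enum partitions].
pose H := [seq wordchar n (fun k : 'I_L => p k : nat) | p : {ffun 'I_L -> 'I_n.+1} <- enum partitions].
have sc_inj : {in enum partitions &, injective (fun p => schar (fn p))}.
  move=> p q; rewrite !mem_enum => Pp Pq e; apply/eqP.
  have := schar_dot Pp Pq; rewrite -e schar_dot // eqxx.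
  by case: (p == q) => // /eqP; rewrite oner_eq0.
have onX : orthonormal X.
  apply/orthonormalP; split; first by rewrite map_inj_in_uniq ?enum_uniq.
  move=> _ _ /mapP[p Pp ->] /mapP[q Pq ->].
  have Pp' : p \in partitions by rewrite -mem_enum.
  have Pq' : q \in partitions by rewrite -mem_enum.
  rewrite (schar_dot Pp' Pq'); congr (nat_of_bool _)%:R%R.
  by apply/eqP/eqP => [->|/(sc_inj _ _ Pp Pq)].
have memH (A : finType) (c : A -> nat) : \sum_a c a = n -> wordchar n c \in <<H>>%VS.
  move=> /sorted_parts_partition[p Pp ->]; apply: memv_span; apply/mapP; exists p => //.
  by rewrite mem_enum.
have eXH : (<<X>> = <<H>>)%VS.
  apply/eqP; rewrite eqEdim; apply/andP; split; last first.
    rewrite (eqP (orthonormal_free onX)) (leq_trans (dim_span _)) //.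
    by rewrite !size_map.
  apply/span_subvP => _ /mapP[p Pp ->]; rewrite mem_enum in Pp.
  apply: rpred_sum => w _; apply: rpred_sum => ka Hka; apply: rpredZ; apply: memH.
  exact: sum_alternant (sum_fn Pp) Hka.
have phiX : phi \in <<X>>%VS by rewrite eXH memH.
have [z -> {1}->] := orthonormal_span onX phiX.
rewrite big_map big_enum /=; apply: eq_bigr => p Pp.
by rewrite wordchar_schar //; apply: fn_dec.
Qed.

End Schur.

(** * Specht characters *)

Section SpechtCharacters.
Local Open Scope ring_scope.

Section RegularModule.
Variable gT : finGroupType.
Local Notation G := [set: gT]%G.
Local Notation aG := (regular_repr algC G).
Local Notation nG := #|pred_of_set (gval G)|.
Local Notation e x := (delta_mx (0 : 'I_1) (gring_index G x) : 'rV[algC]_nG).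

Lemma gring_row_regular (x : gT) : gring_row (aG x) = e x.
Proof. by rewrite /gring_row /= rowK gring_indexK ?inE // mul1g. Qed.

Lemma regular_act (x y : gT) : e x *m aG y = e (x * y)%g.
Proof. by rewrite -rowE rowK gring_indexK ?inE. Qed.

Definition left_mx (g : gT) : 'M[algC]_nG := \matrix_i e (g * enum_val i)%g.

Lemma left_act (x g : gT) : e x *m left_mx g = e (g * x)%g.
Proof. by rewrite -rowE rowK gring_indexK ?inE. Qed.

Lemma eq_on_basis m (A B : 'M[algC]_(nG, m)) : (forall x : gT, e x *m A = e x *m B) -> A = B.
Proof.
by move=> eAB; apply/row_matrixP => i; have := eAB (enum_val i); rewrite gring_valK -!rowE.
Qed.

Lemma mxtrace_basis (A : 'M[algC]_nG) : \tr A = \sum_(x : gT) (e x *m A) 0 (gring_index G x).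
Proof.
rewrite /mxtrace (reindex (@gring_index gT G)) /=; last first.
  by exists (fun i => enum_val i) => i _; rewrite ?gring_valK ?gring_indexK ?inE.
by apply: eq_bigr => x _; rewrite -rowE mxE.
Qed.

Lemma basis_coef (x y : gT) : e x 0 (gring_index G y) = (x == y)%:R.
Proof.
rewrite mxE eqxx /= eq_sym (can_in_eq (@gring_indexK _ G)) ?inE // eq_sym.
Qed.

Section Idempotent.
Variables (P : 'M[algC]_nG) (Pmod : mxmodule aG P).
Hypothesis P_idem : P *m P = P.

(** A rank factorisation [P = C *m B] of an idempotent satisfies [B *m C = 1]. The action on the
    image is then [B *m aG x *m C], and the trace is cyclic. *)
Lemma mxtrace_idempotent x : \tr (submod_repr Pmod x) = \tr (aG x *m P).
Proof.
pose B := row_base P; pose C := col_base P.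
have PE : P = C *m B by rewrite mulmx_base.
have BC : B *m C = 1%:M.
  apply: (row_full_inj (col_base_full P)); apply: (row_free_inj (row_base_free P)).
  by rewrite -/B -/C mulmx1 -mulmxA -mulmxA mulmxA -PE P_idem.
have := val_submodJ Pmod 1%:M (in_setT x); rewrite mul1mx /val_submod /= mul1mx -/B => E.
have -> : submod_repr Pmod x = B *m aG x *m C.
  by rewrite -E -mulmxA BC mulmx1.
by rewrite -mulmxA mxtrace_mulC -mulmxA -PE.
Qed.
End Idempotent.

Section YoungModule.
Variables (R C : {group gT}) (sg : gT -> bool).
Hypothesis sgM : {morph sg : x y / (x * y)%g >-> x (+) y}.

Definition young_vec : 'rV[algC]_nG :=
  \sum_(g in R) \sum_(h in C) (-1) ^+ sg h *: e (g * h)%g.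

Definition young_char : 'CF(G) := cfRepr (submod_repr (cyclic_mx_module aG young_vec)).

(** Left multiplication by the normalised sum over [R]: a projection that commutes with the right
    regular action and whose image is the permutation module on the cosets of [R]. *)
Definition avg_mx : 'M[algC]_nG := #|R|%:R^-1 *: \sum_(g in R) left_mx g.

Lemma avg_act x : e x *m avg_mx = #|R|%:R^-1 *: \sum_(g in R) e (g * x)%g.
Proof.
rewrite /avg_mx -scalemxAr mulmx_sumr; congr (_ *: _); apply: eq_bigr => g _.
by rewrite left_act.
Qed.

Let R0 : #|R|%:R != 0 :> algC. Proof. by rewrite pnatr_eq0 -lt0n cardG_gt0. Qed.

Lemma avg_avg (v : gT -> 'rV[algC]_nG) : (forall g x, g \in R -> v (g * x)%g = v x) ->
  forall x, #|R|%:R^-1 *: \sum_(g in R) v (g * x)%g = v x.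
Proof.
move=> vR x; rewrite (eq_bigr (fun=> v x)); last by move=> g Rg; rewrite vR.
by rewrite sumr_const -scaler_nat scalerA mulVf ?scale1r.
Qed.

Lemma avg_idem : avg_mx *m avg_mx = avg_mx.
Proof.
apply: eq_on_basis => x; rewrite mulmxA !avg_act -scalemxAl mulmx_suml.
rewrite (eq_bigr (fun g => e (g * x)%g *m avg_mx)) //.
under eq_bigr => g _ do rewrite avg_act.
pose v x : 'rV[algC]_nG := #|R|%:R^-1 *: \sum_(g in R) e (g * x)%g.
rewrite -[RHS]/(v x) -[RHS]avg_avg // => g y Rg; congr (_ *: _).
rewrite [RHS](reindex_acts 'R%act _ Rg) ?astabsR ?mulGid //=.
by apply: eq_bigr => z _; rewrite /= mulgA.
Qed.

Lemma avg_comm x : avg_mx *m aG x = aG x *m avg_mx.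
Proof.
apply: eq_on_basis => y; rewrite !mulmxA avg_act regular_act avg_act -scalemxAl mulmx_suml.
by congr (_ *: _); apply: eq_bigr => g _; rewrite regular_act mulgA.
Qed.

Lemma avg_module : mxmodule aG avg_mx.
Proof. by apply/mxmoduleP => x _; rewrite avg_comm submxMl. Qed.

Lemma young_sub_avg : (young_vec <= avg_mx)%MS.
Proof.
suff -> : young_vec = young_vec *m avg_mx by apply: submxMl.
rewrite {2}/young_vec mulmx_suml.
pose v (g : gT) : 'rV[algC]_nG := \sum_(h in C) (-1) ^+ sg h *: e (g * h)%g.
transitivity (\sum_(g in R) #|R|%:R^-1 *: young_vec).
  by rewrite sumr_const -scaler_nat scalerA mulfV ?scale1r.
apply: eq_bigr => g Rg; rewrite mulmx_suml.
transitivity (\sum_(h in C) (-1) ^+ sg h *: (#|R|%:R^-1 *: \sum_(g' in R) e (g' * h)%g)).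
  rewrite /young_vec exchange_big scaler_sumr; apply: eq_bigr => h _.
  by rewrite -scaler_sumr !scalerA mulrC.
apply: eq_bigr => h _; rewrite -scalemxAl avg_act; congr (_ *: (_ *: _)).
rewrite (reindex_acts 'R%act _ Rg) ?astabsR ?mulGid //=.
by apply: eq_bigr => z _; rewrite /= mulgA.
Qed.

Lemma avg_char : cfRepr (submod_repr avg_module) = 'Ind[G, R] 1.
Proof.
apply/cfun_inP => s _; rewrite cfunE in_setT mulr1n mxtrace_idempotent ?avg_idem //.
rewrite cfIndE ?subsetT // mxtrace_basis.
under eq_bigr => x _ do rewrite mulmxA regular_act avg_act mxE summxE.
rewrite -mulr_sumr; congr (_ * _).
rewrite (reindex_inj invg_inj) /=; apply: eq_big => [x|x _]; first by rewrite inE.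
rewrite cfun1E -(groupV R) -conjVg.
under eq_bigr => g _ do rewrite basis_coef.
rewrite -natr_sum -big_mkcondr sum1_card /=; congr (_%:R).
have E g : (g * (x^-1 * s) == x^-1)%g = (g == (s^-1 ^ x))%g.
  by rewrite conjgE -[RHS](inj_eq (mulIg (x^-1 * s)%g)) mulgA !mulgA mulgK mulgKV.
have [Rs|nRs] := boolP (_ \in R).
  apply: etrans (card1 (s^-1 ^ x)%g); apply: eq_card => g.
  by rewrite !unfold_in /= E andb_idl // => /eqP->.
apply: eq_card0 => g; rewrite unfold_in /= E; apply/negP => /andP[Rg /eqP eg].
by rewrite -eg Rg in nRs.
Qed.

(** The Young symmetrizer absorbs averaging over [R], so its module lies in the permutation module;
    Maschke's theorem supplies the complement [psi]. *)
Lemma young_char_le : exists2 psi, psi \is a character & 'Ind[G, R] 1 = young_char + psi.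
Proof.
have modV := cyclic_mx_module aG young_vec.
have sVW : (cyclic_mx aG young_vec <= avg_mx)%MS by rewrite cyclic_mx_sub ?avg_module ?young_sub_avg.
have red : mx_completely_reducible aG 1%:M.
  by apply: mx_Maschke_pchar; apply: algC'G_pchar.
have [U modU defW dxW] := mx_reducibleS avg_module (submx1 _) red modV sVW.
exists (cfRepr (submod_repr modU)); first exact: cfRepr_char.
rewrite -avg_char; apply/cfun_inP => x Gx; rewrite !cfunE Gx !mulr1n.
by rewrite (mxtrace_dadd_mod modV modU avg_module defW dxW).
Qed.

Lemma young_vec_neq0 : R :&: C = 1%g -> young_vec != 0.
Proof.
move=> tiRC; apply/eqP => /matrixP/(_ 0 (gring_index G 1%g)).
rewrite mxE summxE (bigD1 1%g) //= summxE (bigD1 1%g) //= mxE mul1g basis_coef eqxx mulr1.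
have sg1 : sg 1%g = false by have := sgM 1%g 1%g; rewrite mulg1; case: (sg 1%g).
rewrite sg1 expr0 !big1 ?addr0.
- by move/eqP; rewrite oner_eq0.
- move=> g /andP[Rg ng]; rewrite summxE big1 // => h Ch; rewrite mxE basis_coef.
  case: eqP => [gh|]; last by rewrite mulr0.
  have : g \in R :&: C by rewrite inE Rg -groupV (mulg1_eq gh).
  by rewrite tiRC => /set1gP eg; rewrite eg eqxx in ng.
- move=> h /andP[Ch nh]; rewrite mxE mul1g basis_coef (negbTE nh) mulr0 //.
Qed.

Lemma young_char_neq0 : R :&: C = 1%g -> young_char != 0.
Proof.
move=> /young_vec_neq0; rewrite -(cyclic_mx_eq0 aG) -mxrank_eq0 -(pnatr_eq0 algC).
apply: contraNneq => z; rewrite -(cfRepr1 (submod_repr (cyclic_mx_module aG young_vec))).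
by rewrite -/young_char z cfunE.
Qed.

Section Constituent.
Variable i : Iirr G.
Local Notation rho := 'Chi_i.
Definition row_op := \sum_(g in R) rho g.
Definition col_op := \sum_(h in C) (-1) ^+ sg h *: rho h.

(** Up to a scalar [Z] is the central idempotent of ['chi_i]. The coefficients of [young_vec *m Z]
    are traces of [rho y^-1] times the product of the two operators. If that product is 0, then [Z]
    annihilates the Young module, on which its trace is the group order times the multiplicity of
    ['chi_i]. *)
Lemma young_constt_op : '[young_char, 'chi_i] != 0 -> row_op *m col_op != 0.
Proof.
apply: contraNneq => ab0; rewrite cfdotE.
pose Z := \sum_(s : gT) 'chi_i s^-1%g *: aG s.
have Zcomm x : Z *m aG x = aG x *m Z.
  apply: eq_on_basis => y; rewrite !mulmxA regular_act /Z !mulmx_sumr mulmx_suml.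
  rewrite [RHS](reindex_inj (conjg_inj x)) /=; apply: eq_bigr => s _.
  rewrite -!scalemxAr -scalemxAl !regular_act -conjVg cfunJ ?inE //; congr (_ *: e _).
  by rewrite conjgE -!mulgA mulKVg.
have uZ : young_vec *m Z = 0.
  pose c y := \sum_(g in R) \sum_(h in C) (-1) ^+ sg h * 'chi_i (y^-1 * g * h)%g.
  have -> : young_vec *m Z = \sum_(y : gT) c y *: e y.
    under [RHS]eq_bigr => y _ do rewrite /c scaler_suml.
    rewrite exchange_big /young_vec mulmx_suml; apply: eq_bigr => g _.
    under [RHS]eq_bigr => y _ do rewrite scaler_suml.
    rewrite exchange_big mulmx_suml; apply: eq_bigr => h _.
    rewrite -scalemxAl mulmx_sumr (reindex_inj (mulgI (g * h)^-1%g)) /= scaler_sumr.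
    apply: eq_bigr => y _; rewrite -scalemxAr regular_act mulKVg scalerA.
    by rewrite invMg invgK mulgA.
  rewrite big1 // => y _; rewrite (_ : c y = \tr (rho y^-1%g *m (row_op *m col_op))).
    by rewrite ab0 mulmx0 mxtrace0 scale0r.
  rewrite /row_op mulmx_suml mulmx_sumr raddf_sum; apply: eq_bigr => g _ /=.
  rewrite mulmx_sumr mulmx_sumr raddf_sum; apply: eq_bigr => h _ /=.
  rewrite -!scalemxAr linearZ /= -irrRepr cfunE in_setT mulr1n.
  by rewrite !repr_mxM ?inE // !mulmxA.
have VZ : cyclic_mx aG young_vec *m Z = 0.
  apply/eqP; rewrite -sub_kermx; apply: cyclic_mx_sub; last by rewrite sub_kermx uZ.
  apply/mxmoduleP => x _; rewrite sub_kermx -mulmxA -Zcomm mulmxA.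
  by rewrite (eqP (_ : kermx Z *m Z == 0)) ?mul0mx // -sub_kermx.
pose V := cyclic_mx aG young_vec; pose rV := submod_repr (cyclic_mx_module aG young_vec).
have S0 : \sum_(s : gT) 'chi_i s^-1%g *: rV s = 0.
  apply: (can_inj (@val_submodK _ _ V _)); rewrite linear0 linear_sum /=.
  transitivity (val_submod (U := V) 1%:M *m Z); last first.
    have /submxP[D ->] : (val_submod (U := V) 1%:M <= V)%MS by rewrite val_submodP.
    by rewrite -mulmxA VZ mulmx0.
  rewrite /Z mulmx_sumr; apply: eq_bigr => s _.
  by rewrite linearZ /= -scalemxAr -[rV s]mul1mx val_submodJ ?inE.
rewrite (_ : \sum_(x in _) _ = \tr (\sum_(s : gT) 'chi_i s^-1%g *: rV s)).
  by rewrite S0 mxtrace0 mulr0.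
rewrite raddf_sum; apply: eq_big => [s|s _] /=; first by rewrite inE.
by rewrite linearZ /= -irr_inv cfunE in_setT mulr1n mulrC.
Qed.
End Constituent.
End YoungModule.

(** Let [a1] and [b2] be the row operator of [R1] and the column operator of [C2]. By irreducibility
    a nonzero row of [a1] generates the whole module, so [a1 *m 'Chi_i x *m b2] is nonzero for some
    [x]. An odd [t] would be absorbed by [a1] while [t ^ x] changes the sign of [b2], which makes
    the product 0. *)
Lemma young_common_constt (R1 C1 R2 C2 : {group gT}) (sg : gT -> bool) i :
    {morph sg : x y / (x * y)%g >-> x (+) y} ->
    '[young_char R1 C1 sg, 'chi_i] != 0 -> '[young_char R2 C2 sg, 'chi_i] != 0 ->
  exists x : gT, forall t, t \in R1 -> (t ^ x)%g \in C2 -> ~~ sg t.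
Proof.
move=> sgM c1 c2; have := young_constt_op c1; have := young_constt_op c2.
set a1 := row_op R1 i; set b2 := col_op C2 sg i => ab2 ab1.
have a1_neq0 : a1 != 0 by apply: contraNneq ab1 => ->; rewrite mul0mx.
have b2_neq0 : b2 != 0 by apply: contraNneq ab2 => ->; rewrite mulmx0.
have [x nz] : exists x, a1 *m 'Chi_i x *m b2 != 0.
  apply/existsP; apply: contraNT b2_neq0 => /existsPn none.
  have {}none x : a1 *m 'Chi_i x *m b2 = 0 by apply/eqP; rewrite -[_ == _]negbK none.
  have [k nzk] : exists k, row k a1 != 0.
    apply/existsP; apply: contraNT a1_neq0 => /existsPn nr; apply/eqP/row_matrixP => k.
    by rewrite row0; apply/eqP; rewrite -[_ == _]negbK nr.
  have simp : mxsimple 'Chi_i 1%:M by exact: socle_irr.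
  have cyc := mxsimple_cyclic simp nzk (submx1 _).
  apply/eqP/row_matrixP => j; rewrite row0 -[b2]mul1mx row_mul.
  have : (row j 1%:M <= cyclic_mx 'Chi_i (row k a1))%MS by rewrite -cyc row_sub.
  case/cyclic_mxP => A /envelop_mxP[c ->] ->.
  rewrite -mulmxA mulmx_suml mulmx_sumr big1 // => y _.
  by rewrite -scalemxAl -scalemxAr mulmxA -!row_mul none row0 scaler0.
exists x => t Rt Ct; apply: contra nz => sgt.
have e1 : a1 *m 'Chi_i t = a1.
  rewrite /a1 /row_op mulmx_suml [RHS](reindex_acts 'R%act _ Rt) /=; last first.
    by apply/actsP => ? ? ?; rewrite /= groupMr.
  by apply: eq_bigr => g _; rewrite repr_mxM ?inE.
have sg1 : sg 1%g = false by have := sgM 1%g 1%g; rewrite mulg1; case: (sg 1%g).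
have sgV y : sg y^-1%g = sg y.
  by have := sgM y y^-1%g; rewrite mulgV sg1; case: (sg y); case: (sg _).
have sgJ : sg (t ^ x)%g by rewrite conjgE !sgM sgV sgt addbA addbC addbA addbb.
have e2 : 'Chi_i (t ^ x)%g *m b2 = - b2.
  rewrite /b2 /col_op mulmx_sumr -sumrN [RHS](reindex_inj (mulgI (t ^ x)%g)).
  apply: eq_big => [h|h Ch]; first by rewrite groupMl.
  have rM := repr_mxM 'Chi_i (in_setT (t ^ x)%g) (in_setT h).
  by rewrite sgM sgJ signr_addb expr1 mulN1r scaleNr opprK -scalemxAr rM.
have E : a1 *m 'Chi_i x *m b2 = - (a1 *m 'Chi_i x *m b2).
  have tx : (t * x = x * t ^ x)%g by rewrite conjgE mulgA mulgV mul1g.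
  rewrite -{1}e1 -[a1 *m _ *m _]mulmxA -(repr_mxM 'Chi_i (in_setT t) (in_setT x)) tx.
  by rewrite (repr_mxM 'Chi_i (in_setT x) (in_setT _)) mulmxA -[_ *m b2]mulmxA e2 mulmxN.
move: (a1 *m _ *m b2) E => M E; apply/eqP/matrixP => k l.
by have /matrixP/(_ k l) := E; rewrite !mxE => /eqP; rewrite -addr_eq0 -mulr2n mulrn_eq0 => /eqP.
Qed.

End RegularModule.

(** * Specht characters are Jacobi-Trudi characters *)

Lemma leq_sumn_uniq (s : seq nat) : uniq s -> (sumn (iota 0 (size s)) <= sumn s)%N.
Proof.
move=> us; have ps : perm_eq (sort leq s) s by rewrite perm_sort.
rewrite -(perm_sumn ps) -(perm_size ps).
have : sorted ltn (sort leq s) by rewrite ltn_sorted_uniq_leq sort_uniq us sort_sorted //; apply: leq_total.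
move: (sort leq s) => t srt.
rewrite -[X in (_ <= sumn X)%N](mkseq_nth 0%N t) /mkseq !sumnE big_map.
rewrite big_seq [X in (_ <= X)%N]big_seq; apply: leq_sum => i; rewrite mem_iota add0n /= => lt_i.
elim: i lt_i => // i IH lt_i; apply: leq_ltn_trans (IH (ltnW lt_i)) _.
by apply: (sorted_ltn_nth ltn_trans) => //; rewrite inE // ltnW.
Qed.

Lemma perm_iota_down_closed (s : seq nat) : uniq s ->
  (forall r r' : nat, r \in s -> (r' < r)%N -> r' \in s) -> perm_eq s (iota 0 (size s)).
Proof.
move=> us down; apply: uniq_perm => //; first exact: iota_uniq.
have sub : {subset s <= iota 0 (size s)}.
  move=> r rs; rewrite mem_iota add0n /=.
  rewrite -(size_iota 0 r.+1); apply: uniq_leq_size; first exact: iota_uniq.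
  by move=> x; rewrite mem_iota add0n /= ltnS leq_eqVlt => /predU1P[->//|/(down _ _ rs)].
by case: (uniq_min_size us sub _) => //; rewrite size_iota.
Qed.

Lemma nth_filter_pos (l : seq nat) k : sorted geq l ->
  nth 0%N [seq v <- l | v != 0%N] k = nth 0%N l k.
Proof.
elim: l k => // v l IH k /= srt.
have srt' : sorted geq l by apply: path_sorted srt.
case: (posnP v) => [v0|v_gt0] /=; last first.
  by case: k => //= k; apply: IH.
have z x : x \in l -> x = 0%N.
  have := order_path_min (rev_trans leq_trans) srt; move/allP/(_ x) => H /H.
  by rewrite v0 /= leqn0 => /eqP.
rewrite v0 (_ : [seq _ <- l | _] = [::]); last first.
  by apply/eqP; rewrite -[_ == _]negbK -has_filter; apply/hasPn => x /z ->.
rewrite nth_nil; case: k => //= k; case: (ltnP k (size l)) => lt_k; last by rewrite nth_default.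
by rewrite (z (nth 0%N l k)) ?mem_nth.
Qed.

Section Specht.
Local Open Scope nat_scope.
Variable n : nat.

Lemma nat_stab_group (f : 'I_n -> nat) : group_set [set s : 'S_n | [forall i, f (s i) == f i]].
Proof.
apply/group_setP; split=> [|x y]; rewrite !inE; first by apply/forallP => i; rewrite perm1.
move=> /forallP fx /forallP fy; apply/forallP => i; rewrite permM.
by rewrite (eqP (fy _)).
Qed.
Canonical row_grp nu := Group (nat_stab_group (fun i : 'I_n => reshape_index nu i)).
Canonical col_grp nu := Group (nat_stab_group (fun i : 'I_n => reshape_offset nu i)).

Lemma specht_young nu : specht_char n nu = young_char (row_grp nu) (col_grp nu) (@odd_perm 'I_n).
Proof.
have E : young_symmetrizer n nu = young_vec (row_grp nu) (col_grp nu) (@odd_perm 'I_n).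
  rewrite /young_symmetrizer linear_sum; apply: eq_bigr => g _.
  rewrite linear_sum; apply: eq_bigr => h _; rewrite linearZ /=; congr (_ *: _)%R.
  exact: gring_row_regular.
rewrite /specht_char /specht_repr /young_char; move: (young_vec _ _ _) E => v; rewrite /Sn_regular.
by move=> <-.
Qed.

Variable nu : seq nat.
Hypotheses (nu_part : is_part nu) (sum_nu : sumn nu = n).

Lemma tau_lt (i : 'I_n) : i < sumn nu. Proof. by rewrite sum_nu. Qed.

Lemma map_reshape_index : [seq reshape_index nu i | i <- iota 0 n] =
  flatten [seq nseq (nth 0 nu r) r | r <- iota 0 (size nu)].
Proof.
set ss := [seq nseq _ _ | _ <- _].
have sh : shape ss = nu.
  rewrite /shape /ss -map_comp -[RHS](mkseq_nth 0) /mkseq; apply: eq_map => r /=.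
  by rewrite size_nseq.
apply: (@eq_from_nth _ 0); first by rewrite size_map size_iota size_flatten sh sum_nu.
move=> i; rewrite size_map size_iota => lt_i; rewrite (nth_map 0) ?size_iota // nth_iota // add0n.
have lt_i' : i < sumn nu by rewrite sum_nu.
rewrite nth_flatten sh (nth_map 0) ?size_iota ?reshape_indexP // nth_iota ?reshape_indexP // add0n.
by rewrite nth_nseq reshape_offsetP.
Qed.

Lemma count_reshape_index k : \sum_(x < n | reshape_index nu x == k) 1 = nth 0 nu k.
Proof.
transitivity (count_mem k [seq reshape_index nu i | i <- iota 0 n]).
  rewrite count_map -sum1_count /= -[n in iota 0 n]subn0 -/(index_iota 0 n) big_mkord.
  by apply: eq_bigl => i.
rewrite map_reshape_index count_flatten -map_comp sumnE big_map.
rewrite (eq_bigr (fun r => if k == r then nth 0 nu k else 0)); last first.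
  by move=> r _ /=; rewrite count_nseq /= eq_sym; case: eqP => [->|]; rewrite ?mul1n ?mul0n.
rewrite -[size nu]subn0 -/(index_iota 0 _) (sum_delta (nth 0 nu)).
by case: ltnP => // le_k; rewrite nth_default.
Qed.

Lemma measure_reshape L : size nu <= L ->
  \sum_(x < n) reshape_index nu x = \sum_(k < L) k * nth 0 nu k.
Proof.
move=> le_L; have lt_idx (x : 'I_n) : reshape_index nu x < L.
  by apply: leq_trans le_L; apply: reshape_indexP; apply: tau_lt.
rewrite (partition_big (fun x : 'I_n => Ordinal (lt_idx x)) xpredT) //=; apply: eq_bigr => k _.
rewrite -count_reshape_index big_distrr /=; apply: eq_big => [x|x /eqP <-]; last by rewrite muln1.
by rewrite -val_eqE.
Qed.

Lemma reshape_inj (x y : 'I_n) : reshape_index nu x = reshape_index nu y ->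
  reshape_offset nu x = reshape_offset nu y -> x = y.
Proof.
by move=> ei eo; apply/val_inj; rewrite /= -(reshape_indexK nu x) ei eo reshape_indexK.
Qed.

Lemma row_col_trivial : row_grp nu :&: col_grp nu = 1%g.
Proof.
apply/trivgP/subsetP => s; rewrite !inE => /andP[/forallP rs /forallP cs].
by apply/eqP/permP => i; rewrite perm1; apply: reshape_inj; apply/eqP.
Qed.

Lemma row_Ind L : size nu <= L -> 0 < n ->
  (wordchar n (fun k : 'I_L => nth 0 nu k) = 'Ind[[set: 'S_n], row_grp nu] 1)%R.
Proof.
move=> le_L n_gt0; have lt_idx (x : 'I_n) : reshape_index nu x < L.
  by apply: leq_trans le_L; apply: reshape_indexP; apply: tau_lt.
pose f : {ffun 'I_n -> 'I_L} := [ffun x => Ordinal (lt_idx x)].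
have cf : has_content (fun k : 'I_L => nth 0 nu k) f.
  apply/has_contentP => k; rewrite -count_reshape_index /occ; apply: eq_bigl => x.
  by rewrite ffunE -val_eqE.
have eS : word_stab f = row_grp nu :> {set 'S_n}.
  by apply/setP => s; rewrite !inE; apply: eq_forallb => x; rewrite !ffunE -val_eqE.
have eC : #|word_stab f| = #|row_grp nu| by rewrite eS.
rewrite (wordchar_Ind cf); apply/cfun_inP => s _; rewrite !cfIndE ?subsetT // eC.
congr (_ * _)%R; apply: eq_bigr => y _; rewrite !cfun1E.
by have /setP/(_ (s ^ y)%g) := eS => /= ->.
Qed.

(** Two points in one column of [nu] and in one row of the translated [tau] would give an odd
    transposition excluded by [young_common_constt]. So a column of [nu] of height [h] meets [h]
    distinct rows of [tau], whose indices add up to at least [0 + ... + (h-1)], the sum of the row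
    indices along the column. *)
Lemma specht_measure tau i : is_part tau -> sumn tau = n ->
    ('[specht_char n tau, 'chi_i] != 0)%R -> ('[specht_char n nu, 'chi_i] != 0)%R ->
  \sum_(x < n) reshape_index nu x <= \sum_(x < n) reshape_index tau x.
Proof.
move=> tau_part sum_tau; rewrite !specht_young => c1 c2.
have [x xP] := young_common_constt (@odd_permM _) c1 c2.
rewrite [X in _ <= X](reindex_inj (@perm_inj _ (x^-1)%g)) /=.
have lt_off (b : 'I_n) : reshape_offset nu b < n.
  by rewrite /reshape_offset (leq_ltn_trans (leq_subr _ _)).
(* Both sums are split along the columns of [nu]. *)
rewrite (partition_big (fun b : 'I_n => Ordinal (lt_off b)) xpredT) //=.
rewrite [X in _ <= X](partition_big (fun b : 'I_n => Ordinal (lt_off b)) xpredT) //=.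
apply: leq_sum => j _; pose P := [pred b : 'I_n | Ordinal (lt_off b) == j].
pose sA := [seq reshape_index tau (x^-1 b)%g | b : 'I_n <- enum P].
pose sB := [seq reshape_index nu b | b : 'I_n <- enum P].
have -> : \sum_(b | Ordinal (lt_off b) == j) reshape_index nu b = sumn sB.
  by rewrite sumnE big_map big_enum.
have -> : \sum_(b | Ordinal (lt_off b) == j) reshape_index tau (x^-1 b)%g = sumn sA.
  by rewrite sumnE big_map big_enum.
have offP b : (b \in enum P) = (reshape_offset nu b == j) by rewrite mem_enum inE -val_eqE.
have uB : uniq sB.
  rewrite map_inj_in_uniq ?enum_uniq // => b b'; rewrite !offP => /eqP eb /eqP eb' ei.
  by apply: reshape_inj => //; rewrite eb eb'.
have pB : perm_eq sB (iota 0 (size sB)).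
  apply: perm_iota_down_closed => // r r' /mapP[b]; rewrite offP => /eqP eb -> lt_r.
  have le_r : nth 0 nu (reshape_index nu b) <= nth 0 nu r'.
    have := sorted_leq_nth (rev_trans leq_trans) leqnn 0 (proj1 (andP nu_part)); apply; last exact: ltnW.
      by rewrite inE (ltn_trans lt_r) // reshape_indexP // tau_lt.
    by rewrite inE reshape_indexP // tau_lt.
  have lt_j : j < nth 0 nu r'.
    by apply: leq_trans le_r; rewrite -eb reshape_offsetP // tau_lt.
  have := flatten_indexP lt_j; rewrite sum_nu => lt_b'.
  apply/mapP; exists (Ordinal lt_b'); first by rewrite offP /= flatten_indexKr.
  by rewrite /= flatten_indexKl.
have szAB : size sA = size sB by rewrite !size_map.
rewrite (perm_sumn pB) -szAB; apply: leq_sumn_uniq.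
rewrite map_inj_in_uniq ?enum_uniq // => b b'; rewrite !offP => /eqP eb /eqP eb' ei.
apply/eqP; apply/negPn/negP => ne.
have ne' : (x^-1 b)%g != (x^-1 b')%g by rewrite (inj_eq perm_inj).
have := xP (tperm (x^-1 b)%g (x^-1 b')%g).
rewrite tpermJ !permKV odd_tperm ne' => H; suff : false by []; apply: H; rewrite inE;
  by apply/forallP => k; case: tpermP => // ->; rewrite ?ei ?eb ?eb'.
Qed.
End Specht.

Section SpechtSchur.
Local Open Scope nat_scope.
Variables (n L : nat).
Hypotheses (n_gt0 : 0 < n) (le_nL : n <= L).

Lemma eq_schar nu tau : (forall k, k < L -> nu k = tau k) -> schar n L nu = schar n L tau.
Proof.
move=> e; apply: eq_bigr => w _; apply: eq_bigl => ka; apply: eq_forallb => k.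
by rewrite e.
Qed.

Lemma size_part nu : is_part nu -> size nu <= sumn nu.
Proof.
case/andP=> _ nz; rewrite sumnE -sum1_size big_seq [X in _ <= X]big_seq.
by apply: leq_sum => v vn; rewrite lt0n; apply: contraNneq nz => <-.
Qed.

Lemma part_ffun nu : is_part nu -> sumn nu = n ->
  exists2 p : {ffun 'I_L -> 'I_n.+1}, p \in partitions n L & forall k, k < L -> fn p k = nth 0 nu k.
Proof.
move=> nu_part sum_nu; have sz : size nu <= L.
  by apply: leq_trans le_nL; rewrite -[X in _ <= X]sum_nu size_part.
have nthle k : nth 0 nu k <= n.
  case: (ltnP k (size nu)) => [/(mem_nth 0) vn|/(nth_default 0)->//].
  by rewrite -sum_nu (perm_sumn (perm_to_rem vn)) /= leq_addr.
pose p : {ffun 'I_L -> 'I_n.+1} := [ffun k : 'I_L => inord (nth 0 nu k)].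
have pE (k : 'I_L) : p k = nth 0 nu k :> nat by rewrite ffunE inordK // ltnS.
exists p; last by move=> k lt_k; rewrite (fnE p (Ordinal lt_k)) pE.
rewrite inE; apply/andP; split.
  apply/forallP => i; apply/forallP => j; apply/implyP => le_ij; rewrite !pE.
  case: (ltnP j (size nu)) => [lt_j|/(nth_default 0)->//].
  have := sorted_leq_nth (rev_trans leq_trans) leqnn 0 (proj1 (andP nu_part)); apply=> //.
  by rewrite inE (leq_ltn_trans le_ij).
rewrite (eq_bigr (fun k : 'I_L => nth 0 nu k)) // -[X in _ == X]sum_nu.
have : sumn [seq nth 0 nu (k : 'I_L) | k <- enum 'I_L] = sumn nu.
  by rewrite map_nth_pad // sumn_cat sumn_nseq mul0n addn0.
by rewrite sumnE big_map big_enum /= => ->.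
Qed.

Definition part_of_ffun (p : {ffun 'I_L -> 'I_n.+1}) : seq nat :=
  [seq v <- [seq fn p k | k <- iota 0 L] | v != 0].

Section PartOf.
Variable p : {ffun 'I_L -> 'I_n.+1}.
Hypothesis Pp : p \in partitions n L.

Let srt : sorted geq [seq fn p k | k <- iota 0 L].
Proof.
apply/(sortedP 0) => i; rewrite size_map size_iota => lt_i.
by rewrite !(nth_map 0) ?size_iota ?(ltnW lt_i) // !nth_iota ?(ltnW lt_i) // !add0n; apply: fn_dec.
Qed.

Lemma part_of_ffun_part : is_part (part_of_ffun p).
Proof.
apply/andP; split; last by rewrite mem_filter.
by apply: sorted_filter srt; apply: rev_trans leq_trans.
Qed.

Lemma nth_part_of_ffun k : nth 0 (part_of_ffun p) k = fn p k.
Proof.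
rewrite nth_filter_pos //; case: (ltnP k L) => lt_k.
  by rewrite (nth_map 0) ?size_iota // nth_iota.
by rewrite nth_default ?size_map ?size_iota // /fn insubF // ltnNge lt_k.
Qed.

Lemma sumn_part_of_ffun : sumn (part_of_ffun p) = n.
Proof.
rewrite -[RHS](sum_fn Pp) sumnE big_filter big_map big_mkcond /=.
rewrite -[L in iota 0 L]subn0 -/(index_iota 0 L) big_mkord.
by apply: eq_bigr => k _; case: eqP.
Qed.
End PartOf.

(** Induction on [\sum_k k * nu_k]. A constituent of the Specht character lies in the permutation
    module, so it is some [schar q] with nonzero Kostka number. Either [q] is [nu], or [q] has a
    smaller statistic; then it is a Specht character by induction and [specht_measure] gives the
    contrary inequality. The multiplicity is at most the Kostka number 1. *)
Lemma specht_schar nu : is_part nu -> sumn nu = n ->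
  specht_char n nu = schar n L (nth 0 nu).
Proof.
have [N le_N] := ubnP (\sum_(k < L) k * nth 0 nu k).
elim: N nu le_N => // N IH nu le_N nu_part sum_nu.
have sz_nu : size nu <= L by apply: leq_trans le_nL; rewrite -[X in _ <= X]sum_nu size_part.
have [p Pp eqp] := part_ffun nu_part sum_nu.
have sum_nu' : \sum_(k < L) nth 0 nu k = n.
  by rewrite -[RHS](sum_fn Pp); apply: eq_bigr => k _; rewrite eqp.
have es : schar n L (nth 0 nu) = schar n L (fn p) by apply: eq_schar => k /eqp.
have [i0 di0] := schar_irr Pp.
have [psi Npsi defI] := young_char_le (row_grp n nu) (col_grp n nu) (@odd_perm 'I_n).
rewrite -specht_young -(row_Ind sum_nu sz_nu n_gt0) in defI.
have NV : specht_char n nu \is a character by rewrite cfRepr_char.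
have dotI i : ('[wordchar n (fun k : 'I_L => nth 0%N nu k), 'chi_i] =
    '[specht_char n nu, 'chi_i] + '[psi, 'chi_i])%R by rewrite defI cfdotDl.
have le_dot i : ('[specht_char n nu, 'chi_i] <=
    '[wordchar n (fun k : 'I_L => nth 0%N nu k), 'chi_i])%R.
  by rewrite dotI lerDl natr_ge0 ?Cnat_cfdot_char_irr.
have constt i : ('[specht_char n nu, 'chi_i] != 0)%R -> i = i0.
  move=> nzi; have : ('[wordchar n (fun k : 'I_L => nth 0%N nu k), 'chi_i] != 0)%R.
    apply: contraNneq nzi => z; have := le_dot i; rewrite z => le0.
    by rewrite eq_le le0 natr_ge0 ?Cnat_cfdot_char_irr.
  rewrite (wordchar_young n_gt0 le_nL sum_nu') cfdot_suml => nzs.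
  have [q /andP[Pq]] : exists q, (q \in partitions n L) &&
      ('[#|kostka_mx n L L (nth 0%N nu) (fn q)|%:R *: schar n L (fn q), 'chi_i] != 0)%R.
    apply/existsP; apply: contraNT nzs => /existsPn none; rewrite big1 // => q Pq.
    by have := none q; rewrite Pq negbK => /eqP.
  rewrite cfdotZl mulf_eq0 negb_or pnatr_eq0 -lt0n => /andP[/card_gt0P[T KT]].
  have [j dj] := schar_irr Pq; rewrite dj cfdot_irr pnatr_eq0 eqb0 negbK => /eqP eji.
  have measT := kostka_measure KT.
  have [le_meas|lt_meas] := leqP (\sum_(k < L) k * nth 0 nu k) (\sum_(k < L) k * fn q k).
    have [_ eq_nu] := kostka_diag sum_nu' KT le_meas.
    apply/irr_inj; rewrite -di0 -es -eji -dj; apply: eq_schar => k lt_k.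
    by rewrite (eq_nu (Ordinal lt_k)).
  pose tau := part_of_ffun q.
  have etau : schar n L (nth 0 tau) = schar n L (fn q).
    by apply: eq_schar => k _; apply: nth_part_of_ffun.
  have Etau : specht_char n tau = ('chi_i)%R.
    rewrite (IH tau) ?sumn_part_of_ffun ?part_of_ffun_part //.
      by rewrite etau dj eji.
    rewrite (eq_bigr (fun k : 'I_L => k * fn q k)); last by move=> k _; rewrite nth_part_of_ffun.
    by rewrite -ltnS (leq_trans _ le_N).
  have := @specht_measure n nu nu_part sum_nu tau i (part_of_ffun_part Pq) (sumn_part_of_ffun Pq).
  rewrite Etau cfnorm_irr oner_neq0 => /(_ isT nzi).
  have sz_tau : size tau <= L.
    by apply: leq_trans le_nL; rewrite -[X in _ <= X](sumn_part_of_ffun Pq) size_part ?part_of_ffun_part.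
  rewrite (measure_reshape sum_nu sz_nu) (measure_reshape (sumn_part_of_ffun Pq) sz_tau).
  rewrite [X in _ <= X](eq_bigr (fun k : 'I_L => k * fn q k)); last first.
    by move=> k _; rewrite nth_part_of_ffun.
  by rewrite leqNgt lt_meas.
have V0 : specht_char n nu != 0%R.
  rewrite specht_young; apply: young_char_neq0; first exact: odd_permM.
  exact: row_col_trivial.
have [i] := neq0_has_constt V0; rewrite irr_consttE => nzi.
have ei := constt i nzi; subst i.
have dot1 : ('[specht_char n nu, 'chi_i0] = 1)%R.
  have := le_dot i0; rewrite -di0 -es wordchar_schar //; last first.
    by move=> k lt_k; rewrite -!eqp // ?(ltnW lt_k) //; apply: fn_dec.
  rewrite (_ : #|_| = 1); last first.
    apply/eqP/cards1P; exists (diag_tab n L (nth 0 nu)); apply/setP => T; rewrite inE.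
    apply/idP/eqP => [KT|->]; first by have [] := kostka_diag sum_nu' KT (leqnn _).
    by apply: diag_in_kostka => // k lt_k; rewrite -!eqp // ?(ltnW lt_k) //; apply: fn_dec.
  rewrite es di0; have /natrP[c] := Cnat_cfdot_char_irr i0 NV.
  by move: nzi => /[swap] ->; rewrite pnatr_eq0 lern1; case: c => [|[|c]].
rewrite [LHS]cfun_sum_cfdot (bigD1 i0) //= big1 ?addr0 ?dot1 ?scale1r ?es ?di0 // => i ni.
have [->|/constt e] := eqVneq ('[specht_char n nu, 'chi_i])%R 0%R; first by rewrite scale0r.
by rewrite e eqxx in ni.
Qed.
End SpechtSchur.
End SpechtCharacters.

(** * Symmetric functions vanishing at roots of unity *)

Section SymmetricFunctions.
Local Open Scope ring_scope.

Section TriangularZeros.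
Variable K : idomainType.

Lemma poly_infinite_roots (q : {poly K}) (r : nat -> K) :
  injective r -> (forall i, root q (r i)) -> q = 0.
Proof.
move=> r_inj rq; apply/eqP; apply: contraT => nz_q.
have := @max_poly_roots _ q [seq r i | i <- iota 0 (size q)] nz_q.
rewrite size_map size_iota ltnn map_inj_uniq ?iota_uniq // => H.
by apply: H => //; apply/allP => _ /mapP[i _ ->].
Qed.

Lemma meval_muni d (t : {mpoly K[d.+1]}) (v : nat -> K) :
  t.@[fun i : 'I_d.+1 => v i] =
  (map_poly (meval (fun i : 'I_d => v i)) (muni t)).[v d].
Proof.
rewrite muniE raddf_sum horner_sum mevalE; apply: eq_bigr => m _ /=.
rewrite map_polyZ /= map_polyXn hornerZ hornerXn mevalZ mevalX big_ord_recr /= mulrA.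
by congr (_ * _ * _); apply: eq_bigr => i _; rewrite mnmE.
Qed.

Lemma muni_eq0 d (t : {mpoly K[d.+1]}) : muni t = 0 -> t = 0.
Proof.
move=> /(congr1 (fun q => q : {poly _})) mt; apply/mpolyP => m; rewrite mcoeff0.
pose m' := [multinom m (widen_ord (leqnSn d) i) | i < d].
have := congr1 (fun q : {poly {mpoly K[d]}} => (q`_(m ord_max))@_m') mt.
rewrite coef0 mcoeff0 muniE coef_sum raddf_sum /=.
rewrite (eq_bigr (fun m1 => t@_m1 * (m1 == m)%:R)); last first.
  move=> m1 _; rewrite coefZ coefXn mulr_natr mcoeffMn mcoeffZ mcoeffX -mulrnAr -mulr_natr -natrM mulnb.
  congr (_ * (nat_of_bool _)%:R); apply/andP/eqP => [[/eqP em1 /eqP em2]|->]; last by rewrite !eqxx.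
  apply/mnmP => i; case: (unliftP ord_max i) => [j ->|->//].
  have /mnmP/(_ j) := em1; rewrite !mnmE.
  by rewrite (_ : widen_ord _ _ = lift ord_max j) //; apply/val_inj; rewrite /= /bump leqNgt ltn_ord.
move=> H; rewrite {1}(mpolyE t) raddf_sum /= -[RHS]H; apply: eq_bigr => m1 _.
by rewrite mcoeffZ mcoeffX.
Qed.

(** Induction on the number of variables. With the first coordinates fixed, the last index still
    produces infinitely many values of the last variable, so each coefficient of [t] in that
    variable vanishes on the family in one dimension less. *)
Lemma mpoly_triangular_zeros (v : (nat -> nat) -> nat -> K) :
    (forall m m' k, (forall j, (j <= k)%N -> m j = m' j) -> v m k = v m' k) ->
    (forall m m' k, (forall j, (j < k)%N -> m j = m' j) -> v m k = v m' k -> m k = m' k) ->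
  forall d (t : {mpoly K[d]}), (forall m, t.@[fun i : 'I_d => v m i] = 0) -> t = 0.
Proof.
move=> loc inj; elim=> [|d IH] t vt.
  have := vt (fun=> 0%N); rewrite mevalE.
  under eq_bigr => m _ do rewrite big_ord0 mulr1.
  move=> H; apply/mpolyP => m; rewrite mcoeff0 -[RHS]H [in LHS](mpolyE t) raddf_sum /=.
  apply: eq_bigr => m1 _; rewrite mcoeffZ mcoeffX (_ : m1 = m) ?eqxx ?mulr1 //.
  by apply/mnmP => -[].
apply: muni_eq0; apply/polyP => j; rewrite coef0; apply: IH => m.
pose q := map_poly (meval (fun i : 'I_d => v m i)) (muni t).
have -> : ((muni t)`_j).@[fun i : 'I_d => v m i] = q`_j by rewrite coef_map.
rewrite (_ : q = 0) ?coef0 //.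
pose mi i k := if k == d then i else m k.
apply: (@poly_infinite_roots _ (fun i => v (mi i) d)).
  move=> i i' /inj; rewrite /mi eqxx; apply=> k lt_k.
  by rewrite ltn_eqF.
move=> i; rewrite /root; have := vt (mi i); rewrite meval_muni /q => E.
rewrite -[X in _ == X]E; apply/eqP; congr (_.[_]).
apply: eq_map_poly => p; apply: meval_eq => k; apply: loc => j' le_j'.
by rewrite /mi ltn_eqF // (leq_ltn_trans le_j').
Qed.
End TriangularZeros.

Section KillLast.
Variable n : nat.

Definition mext (m : 'X_{1..n}) : 'X_{1..n.+1} :=
  [multinom if unlift ord_max i is Some j then m j else 0%N | i < n.+1].

Lemma kill_lastX (m : 'X_{1..n.+1}) : kill_last 'X_[m] =
  if m ord_max == 0%N then 'X_[[multinom m (lift ord_max i) | i < n]] else 0.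
Proof.
rewrite /kill_last comp_mpolyX (bigD1 ord_max) //= tnth_mktuple unlift_none.
case: eqVneq => [->|nz]; last by rewrite expr0n (negbTE nz) mul0r.
rewrite expr0 mul1r mpolyXE_id.
rewrite (reindex_omap (lift ord_max) (unlift ord_max)) /=; last first.
  by move=> i ni; case: unliftP ni => [j ->|->]; rewrite ?eqxx.
apply: eq_big => [i|i _]; first by rewrite eq_sym neq_lift liftK eqxx.
by rewrite tnth_mktuple liftK mnmE.
Qed.

Lemma mcoeff_kill_last (p : {mpoly rat[n.+1]}) (m : 'X_{1..n}) :
  (kill_last p)@_m = p@_(mext m).
Proof.
rewrite /kill_last comp_mpolyEX raddf_sum [in RHS](mpolyE p) raddf_sum /=.
apply: eq_bigr => m1 _; rewrite !mcoeffZ -/(kill_last _) kill_lastX mcoeffX; congr (_ * _).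
case: eqP => [m10|nz]; last first.
  rewrite mcoeff0; case: eqP => // e; case: nz; rewrite e mnmE unlift_none //.
rewrite mcoeffX; congr (nat_of_bool _)%:R; apply/eqP/eqP => [<-|->].
  apply/mnmP => i; rewrite !mnmE; case: unliftP => [j ->|->//].
  by rewrite mnmE.
by apply/mnmP => i; rewrite !mnmE liftK.
Qed.
End KillLast.

(** A monomial of degree below [d] misses one of any [d] or more variables. By symmetry the missing
    variable may be the last one, and then [kill_last] keeps the coefficient. *)
Lemma symfam_eq0 (E : symfam) d : (forall n, E n \is symmetric) ->
    (forall n, kill_last (E n.+1) = E n) -> (forall n, (msize (E n) <= d)%N) ->
  E d = 0 -> forall n, E n = 0.
Proof.
move=> symE killE szE Ed0 n; have [le_nd|/ltnW le_dn] := leqP n d.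
  rewrite -(subKn le_nd); elim: (d - n)%N (leq_subr n d) => [|k IH] le_k; first by rewrite subn0.
  have e : (d - k = (d - k.+1).+1)%N by lia.
  have := IH (ltnW le_k); rewrite e => Ek; rewrite -killE Ek.
  by rewrite /kill_last comp_mpoly0.
elim: n le_dn => [|n IH] le_d; first by move: Ed0; rewrite (eqP (_ : d == 0%N)) // -leqn0.
move: le_d; rewrite leq_eqVlt => /predU1P[<-//|]; rewrite ltnS => le_d.
have {}IH := IH le_d; apply/mpolyP => m; rewrite mcoeff0.
have [le_m|lt_m] := leqP d (mdeg m).
  by apply: memN_msupp_eq0; apply: msize_mdeg_ge; apply: leq_trans (szE _) le_m.
have [i mi0] : exists i, m i = 0%N.
  suff /existsP[i /eqP] : [exists i, m i == 0%N] by exists i.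
  apply: contraLR lt_m => /existsPn none; rewrite -leqNgt.
  apply: leq_trans le_d _; rewrite mdegE.
  apply: (@leq_trans (\sum_(i < n.+1) 1)); first by rewrite sum1_card card_ord.
  by apply: leq_sum => i _; rewrite lt0n; apply: none.
rewrite -(msym_coeff m (tperm i ord_max) (symE _)).
set m1 := [multinom _ | _ < _].
have m1E : m1 = mext [multinom m1 (lift ord_max j) | j < n].
  apply/mnmP => j; rewrite [RHS]mnmE; case: unliftP => [k ->|->]; first by rewrite [RHS]mnmE.
  by rewrite mnmE tpermR.
by rewrite m1E -mcoeff_kill_last killE IH mcoeff0.
Qed.

Lemma kill_last_mesym n k : kill_last (mesym n.+1 rat k) = mesym n rat k.
Proof.
case: k => [|k]; first by rewrite !mesym0E /kill_last comp_mpoly1.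
have kw (p : {mpoly rat[n]}) : kill_last (mwiden p) = p.
  apply/mpolyP => m; rewrite mcoeff_kill_last -[RHS]mwiden_mnmwiden; congr (_@__).
  apply/mnmP => i; rewrite mnmE; case: unliftP => [j ->|->]; last by rewrite mnmwiden_ordmax.
  by rewrite (_ : lift ord_max j = widen_ord (leqnSn n) j) ?mnmwiden_widen //;
    apply/val_inj; rewrite /= /bump leqNgt ltn_ord.
rewrite mesymSS /kill_last rmorphD rmorphM /= -!/(kill_last _) !kw.
by rewrite kill_lastX mnm1E eqxx mulr0 addr0.
Qed.

Lemma msizeM_leq n (p q : {mpoly rat[n]}) a b :
  (msize p <= a.+1)%N -> (msize q <= b.+1)%N -> (msize (p * q) <= (a + b).+1)%N.
Proof.
move=> sp sq; have [->|nzp] := eqVneq p 0; first by rewrite mul0r msize0.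
have [->|nzq] := eqVneq q 0; first by rewrite mulr0 msize0.
rewrite msizeM //; have aux x y : (x <= y.+1)%N -> (x.-1 <= y)%N by lia.
by apply: aux; apply: leq_trans (leq_add sp sq) _; rewrite addSn addnS.
Qed.

Lemma msize_prod_leq n (I : Type) (r : seq I) (F : I -> {mpoly rat[n]}) (w : I -> nat) :
  (forall i, (msize (F i) <= (w i).+1)%N) ->
  (msize (\prod_(i <- r) F i) <= (\sum_(i <- r) w i).+1)%N.
Proof.
move=> sF; elim: r => [|i r IH]; first by rewrite !big_nil msize1.
by rewrite !big_cons; apply: msizeM_leq.
Qed.

Lemma msizeX_leq n (p : {mpoly rat[n]}) a k :
  (msize p <= a.+1)%N -> (msize (p ^+ k) <= (k * a).+1)%N.
Proof.
move=> sp; elim: k => [|k IH]; first by rewrite expr0 msize1.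
by rewrite exprS mulSn; apply: msizeM_leq.
Qed.

Lemma msize_mesym n k : (msize (mesym n rat k) <= k.+1)%N.
Proof.
rewrite mesymE (leq_trans (msize_sum _ _ _)) //; apply/bigmax_leqP => h /eqP eh.
by rewrite msizeX mdeg_mesym1 eh.
Qed.

(** The fundamental theorem in [D] variables yields [t] together with a bound on its weight. This
    bounds the degree of the composites for every [n], so that the agreement in [D] variables
    propagates through [symfam_eq0]. *)
Lemma symfun_elementary (f : symfam) : is_symfun f ->
  exists d (t : {mpoly rat[d.+1]}), forall n, f n = t \mPo [tuple mesym n rat i.+1 | i < d.+1].
Proof.
case=> symf killf [d szf]; pose D := d.+1.
have [t [tS wt]] := sym_fundamental (symf D).
exists d, t; pose g n : {mpoly rat[n]} := t \mPo [tuple mesym n rat i.+1 | i < D].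
pose E : symfam := fun n => f n - g n.
suff E0 n : E n = 0 by move=> n; apply/eqP; rewrite -subr_eq0; apply/eqP/E0.
have symg k : g k \is symmetric.
  rewrite /g comp_mpolyEX rpred_sum // => m _; rewrite rpredZ // comp_mpolyX rpred_prod // => i _.
  by rewrite tnth_mktuple rpredX // mesym_sym.
apply: (@symfam_eq0 E D) => [k|k|k|].
- by apply: rpredB; [apply: symf | apply: symg].
- rewrite /E /kill_last raddfB /= -!/(kill_last _) killf; congr (_ - _).
  rewrite /g comp_mpolyEX [in RHS]comp_mpolyEX /kill_last raddf_sum; apply: eq_bigr => m _ /=.
  rewrite comp_mpolyZ !comp_mpolyX rmorph_prod; congr (_ *: _); apply: eq_bigr => i _ /=.
  by rewrite rmorphXn /= !tnth_mktuple -/(kill_last _) kill_last_mesym.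
- rewrite (leq_trans (mmeasureD_le _ _ _)) // geq_max mmeasureN (leq_trans (szf k)) //=.
  rewrite /g comp_mpolyEX (leq_trans (msize_sum _ _ _)) //.
  rewrite big_seq_cond; apply/bigmax_leqP_seq => m mt _.
  rewrite (leq_trans (msizeZ_le _ _)) // comp_mpolyX.
  have lt_m : (mnmwgt m < D)%N.
    have lt_w : (mnmwgt m < mweight t)%N by apply: mmeasure_mnm_lt.
    by rewrite (leq_trans lt_w) // (leq_trans wt) // (leq_trans (szf _)).
  apply: (leq_trans _ lt_m); rewrite /mnmwgt.
  apply: msize_prod_leq => i; apply: msizeX_leq.
  by rewrite tnth_mktuple msize_mesym.
by rewrite /E /g tS subrr.
Qed.

Section RatEval.
Variables (N : nat) (v : 'I_N -> algC).
Definition rat_eval (p : {mpoly rat[N]}) : algC := (map_mpoly ratr p).@[v].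

Lemma rat_evalM p q : rat_eval (p * q) = rat_eval p * rat_eval q.
Proof. by rewrite /rat_eval rmorphM mevalM. Qed.
Lemma rat_evalD p q : rat_eval (p + q) = rat_eval p + rat_eval q.
Proof. by rewrite /rat_eval rmorphD mevalD. Qed.
Lemma rat_eval0 : rat_eval 0 = 0.
Proof. by rewrite /rat_eval rmorph0 meval0. Qed.
Lemma rat_evalB p q : rat_eval (p - q) = rat_eval p - rat_eval q.
Proof. by rewrite /rat_eval rmorphB mevalB. Qed.
Lemma rat_eval_sum (I : Type) (r : seq I) (P : pred I) (F : I -> {mpoly rat[N]}) :
  rat_eval (\sum_(i <- r | P i) F i) = \sum_(i <- r | P i) rat_eval (F i).
Proof. exact: (big_morph _ rat_evalD rat_eval0). Qed.
Lemma rat_eval_prod (I : Type) (r : seq I) (P : pred I) (F : I -> {mpoly rat[N]}) :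
  rat_eval (\prod_(i <- r | P i) F i) = \prod_(i <- r | P i) rat_eval (F i).
Proof. by rewrite /rat_eval rmorph_prod /= rmorph_prod. Qed.
Lemma rat_evalXn p k : rat_eval (p ^+ k) = rat_eval p ^+ k.
Proof. by rewrite /rat_eval rmorphXn /= rmorphXn. Qed.
Lemma rat_evalC c : rat_eval c%:MP = ratr c.
Proof. by rewrite /rat_eval map_mpolyC mevalC. Qed.
Lemma rat_evalZ c p : rat_eval (c *: p) = ratr c * rat_eval p.
Proof. by rewrite -mul_mpolyC rat_evalM rat_evalC. Qed.
Lemma rat_evalX i : rat_eval 'X_i = v i.
Proof. by rewrite /rat_eval map_mpolyX mevalXU. Qed.

Lemma rat_eval_mesym k : rat_eval (mesym N rat k) = (mesym N algC k).@[v].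
Proof.
rewrite rat_eval_sum raddf_sum; apply: eq_bigr => h _ /=.
by rewrite rat_eval_prod rmorph_prod; apply: eq_bigr => i _; rewrite rat_evalX /= mevalXU.
Qed.

Lemma rat_evalE p : rat_eval p = \sum_(m <- msupp p) ratr p@_m * \prod_i v i ^+ m i.
Proof.
rewrite {1}(mpolyE p) rat_eval_sum; apply: eq_bigr => m _.
by rewrite rat_evalZ /rat_eval map_mpolyX mevalX.
Qed.
End RatEval.

Lemma rat_eval_comp N d (t : {mpoly rat[d]}) (lq : d.-tuple {mpoly rat[N]}) v :
  rat_eval v (t \mPo lq) = rat_eval (fun i => rat_eval v (tnth lq i)) t.
Proof.
rewrite comp_mpolyEX rat_eval_sum rat_evalE; apply: eq_bigr => m _.
rewrite rat_evalZ comp_mpolyX rat_eval_prod; congr (_ * _).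
by apply: eq_bigr => i _; rewrite rat_evalXn.
Qed.

Lemma prod_unity_roots k : (0 < k)%N ->
  \prod_(z <- unity_roots k) ('X - z%:P) = 'X^k - 1 :> {poly algC}.
Proof.
move=> k_gt0; rewrite /unity_roots; case: closed_field_poly_normal => r /= ->.
by rewrite -polyC1 lead_coefXnsubC // scale1r.
Qed.

Lemma size_unity_roots k : (0 < k)%N -> size (unity_roots k) = k.
Proof.
move=> k_gt0; have := congr1 (fun p : {poly algC} => size p) (prod_unity_roots k_gt0).
by rewrite size_prod_XsubC -polyC1 size_XnsubC // => -[].
Qed.

Lemma size_Xi mu : is_comp mu -> size (Xi mu) = sumn mu.
Proof.
rewrite /is_comp /Xi => nz; rewrite size_flatten /shape -map_comp; congr sumn.
rewrite -[RHS]map_id; apply/eq_in_map => k kmu /=; rewrite size_unity_roots // lt0n.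
by apply: contraNneq nz => <-.
Qed.

Lemma prod_Xi mu : is_comp mu ->
  \prod_(z <- Xi mu) ('X - z%:P) = \prod_(k <- mu) ('X^k - 1) :> {poly algC}.
Proof.
rewrite /is_comp /Xi => nz; rewrite big_flatten big_map big_seq [RHS]big_seq.
apply: eq_bigr => k kmu; rewrite prod_unity_roots // lt0n.
by apply: contraNneq nz => <-.
Qed.

(** The two products are reciprocal polynomials. The product of the [1 - 'X^i] is the useful one,
    because its coefficient of degree [k] involves only the parts up to [k]. *)
Lemma coef_rev_prod (mu : seq nat) k :
  (\prod_(i <- mu) (1 - 'X^i) : {poly algC})`_k =
  if (k <= sumn mu)%N then (\prod_(i <- mu) ('X^i - 1) : {poly algC})`_(sumn mu - k) else 0.
Proof.
have szA s : (size (\prod_(i <- s) ('X^i - 1) : {poly algC})%R <= (sumn s).+1)%N.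
  elim: s => [|i s IH]; first by rewrite big_nil size_poly1.
  rewrite big_cons; apply: leq_trans (size_polyMleq _ _) _.
  have : (size ('X^i - 1 : {poly algC})%R <= i.+1)%N.
    by rewrite (leq_trans (size_polyD _ _)) // size_polyN size_polyXn size_poly1 geq_max leqnn.
  by move: IH => /=; lia.
elim: mu k => [|i mu IH] k.
  by rewrite !big_nil /= !coef1 leqn0 sub0n; case: eqP.
rewrite !big_cons /= !mulrBl !mul1r !coefB !coefXnM !IH.
set Q := \prod_(j <- mu) ('X^j - 1) : {poly algC}; set t := sumn mu.
have Qbig j : (t < j)%N -> Q`_j = 0.
  by move=> lt_j; rewrite nth_default // (leq_trans (szA mu)).
have [lt_ki|le_ik] := ltnP k i.
  rewrite [(k <= i + t)%N](_ : _ = true) ?(Qbig (i + t - k)%N) ?subr0; try lia.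
  have [le_k|lt_k] := leqP k t; last by rewrite ifT //; lia.
  by rewrite ifF; [congr (_`__); lia | lia].
have [le_k|lt_k] := leqP k t.
  have -> : (k - i <= t)%N by lia.
  have -> : (k <= i + t)%N by lia.
  have -> : (i + t - k < i)%N = false by lia.
  by congr (_`__ - _`__); lia.
have [le_k|lt_k'] := leqP (k - i) t.
  have -> : (k <= i + t)%N by lia.
  have -> : (i + t - k < i)%N by lia.
  by congr (_ - _`__); lia.
have -> : (k <= i + t)%N = false by lia.
by rewrite subrr.
Qed.

(** By Vieta, the alternating generating function of the elementary functions at the roots of unity
    is the product of the factors [1 - 'X^i] over the parts. *)
Lemma mesym_Xi mu k : is_comp mu ->
  (mesym (sumn mu) algC k).@[fun i => (Xi mu)`_i] =
  (-1) ^+ k * (\prod_(i <- mu) (1 - 'X^i) : {poly algC})`_k.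
Proof.
move=> cmu; rewrite coef_rev_prod; case: leqP => le_k; last first.
  by rewrite mesym_geqnE // meval0 mulr0.
have sz : size (Xi mu) == sumn mu by rewrite size_Xi.
have le_k' : (k < (sumn mu).+1)%N by [].
have := mroots_coeff (Tuple sz) (Ordinal le_k'); rewrite /= prod_Xi // => ->.
rewrite mulrA -signr_odd -signr_addb addbb mul1r.
by apply: meval_eq => i; rewrite (tnth_nth 0).
Qed.

Lemma sf_eval_elementary f d (t : {mpoly rat[d]}) mu : is_comp mu ->
    (forall n, f n = t \mPo [tuple mesym n rat i.+1 | i < d]) ->
  sf_eval f mu = (map_mpoly ratr t).@[fun i : 'I_d =>
     (-1) ^+ i.+1 * (\prod_(j <- mu) (1 - 'X^j) : {poly algC})`_i.+1].
Proof.
move=> cmu ft; rewrite /sf_eval ft -/(rat_eval _ _) rat_eval_comp.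
by apply: meval_eq => i; rewrite tnth_mktuple rat_eval_mesym mesym_Xi.
Qed.

Definition cyc_prod (m : nat -> nat) (d : nat) : {poly algC} :=
  \prod_(0 <= i < d) (1 - 'X^(i.+1)) ^+ m i.

Lemma coef_cyc_lt (p : {poly algC}) j a k : (k < j)%N -> (p * (1 - 'X^j) ^+ a)`_k = p`_k.
Proof.
move=> lt_k; elim: a => [|a IH]; first by rewrite expr0 mulr1.
by rewrite exprSr mulrA mulrBr mulr1 coefB coefMXn lt_k subr0.
Qed.

(** The source of triangularity: the multiplicity of the part [j] enters the coefficient of degree
    [j] linearly and, by [coef_cyc_lt], the lower ones not at all. *)
Lemma coef_cyc_eq (p : {poly algC}) j a : (0 < j)%N ->
  (p * (1 - 'X^j) ^+ a)`_j = p`_j - p`_0 *+ a.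
Proof.
move=> j_gt0; elim: a => [|a IH]; first by rewrite expr0 mulr1 mulr0n subr0.
rewrite exprSr mulrA mulrBr mulr1 coefB coefMXn ltnn subnn IH coef_cyc_lt //.
by rewrite mulrSr opprD addrA.
Qed.

Lemma coef_cyc_prod m d k : (k < d)%N -> (cyc_prod m d)`_k.+1 = (cyc_prod m k.+1)`_k.+1.
Proof.
elim: d => // d IH; rewrite ltnS leq_eqVlt => /predU1P[->//|lt_k].
by rewrite /cyc_prod big_nat_recr //= coef_cyc_lt // -/(cyc_prod m d) IH.
Qed.

Lemma cyc_prod0 m d : (cyc_prod m d)`_0 = 1.
Proof.
elim: d => [|d IH]; first by rewrite /cyc_prod big_geq // coef1.
by rewrite /cyc_prod big_nat_recr //= coef_cyc_lt.
Qed.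

Definition cyc_part (m : nat -> nat) (d : nat) : seq nat :=
  sort geq (flatten [seq nseq (m i) i.+1 | i <- iota 0 d]).

Lemma cyc_part_is_part m d : is_part (cyc_part m d).
Proof.
apply/andP; split; first by apply: sort_sorted => x y; apply: leq_total.
by rewrite mem_sort; apply/flattenP => -[s /mapP[i _ ->]]; rewrite mem_nseq => /andP[].
Qed.

Lemma cyc_part_prod m d : \prod_(j <- cyc_part m d) (1 - 'X^j) = cyc_prod m d.
Proof.
rewrite /cyc_part (perm_big _ (permEl (perm_sort _ _))) /= big_flatten big_map.
rewrite /cyc_prod /index_iota subn0; apply: eq_bigr => i _.
by rewrite big_nseq -Monoid.iteropE.
Qed.

(** In terms of elementary functions, the evaluation points have coordinates of which the [k]-th
    depends only on the multiplicities of the parts up to [k+1], and injectively on the last of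
    these. So [mpoly_triangular_zeros] applies. *)
Lemma symfun_vanish (f : symfam) n0 : is_symfun f ->
    (forall mu, is_part mu -> (n0 <= sumn mu)%N -> sf_eval f mu = 0) ->
  forall n, f n = 0.
Proof.
move=> /symfun_elementary[d [t ft]] f0 n.
suff t0 : t = 0 by rewrite ft t0 comp_mpoly0.
suff : map_mpoly ratr t = 0 :> {mpoly algC[d.+1]}.
  move=> e; apply/mpolyP => m; have := congr1 (mcoeff m) e.
  by rewrite mcoeff_map_mpoly !mcoeff0 => /eqP; rewrite fmorph_eq0 => /eqP.
(* Adding [n0] parts equal to 1 makes every partition large enough without spoiling injectivity. *)
pose m' (m : nat -> nat) k := if k == 0%N then (m 0 + n0)%N else m k.
have m'K m1 m2 k : m' m1 k = m' m2 k <-> m1 k = m2 k.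
  by rewrite /m'; case: eqP => [->|//]; split=> [/addIn|->].
pose v m k := (-1) ^+ k.+1 * (cyc_prod (m' m) k.+1)`_k.+1.
have eq_cyc m1 m2 k : (forall j, (j < k)%N -> m1 j = m2 j) -> cyc_prod (m' m1) k = cyc_prod (m' m2) k.
  move=> e; rewrite /cyc_prod !big_nat; apply: eq_bigr => i /andP[_ lt_i].
  by have /m'K -> := e i lt_i.
apply: (@mpoly_triangular_zeros _ v) => [m1 m2 k e|m1 m2 k e|m].
- by rewrite /v (@eq_cyc m1 m2).
- rewrite /v => /(congr1 (fun z => (-1) ^+ k.+1 * z)); rewrite !mulrA -signr_odd -signr_addb addbb !mul1r.
  rewrite /cyc_prod !big_nat_recr //= !coef_cyc_eq // -!/(cyc_prod _ _) (@eq_cyc m1 m2) //.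
  rewrite cyc_prod0 => /addrI/oppr_inj/eqP; rewrite eqr_nat => /eqP e2.
  by apply/m'K.
have := f0 (cyc_part (m' m) d.+1) (cyc_part_is_part _ _).
rewrite (@sf_eval_elementary f d.+1 t); [|by case/andP: (cyc_part_is_part (m' m) d.+1)|exact: ft].
move=> H; rewrite -[RHS]H; last first.
  rewrite /cyc_part (perm_sumn (permEl (perm_sort _ _))) /= sumn_cat sumn_nseq /m' eqxx.
  by rewrite mul1n -addnA addnCA leq_addr.
by apply: meval_eq => i; rewrite /v cyc_part_prod coef_cyc_prod.
Qed.
End SymmetricFunctions.

(** * Partitions and cycle types *)

Lemma geq_trans : transitive geq. Proof. exact: rev_trans leq_trans. Qed.
Lemma geq_total : total geq. Proof. by move=> x y; apply: leq_total. Qed.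
Lemma geq_anti : antisymmetric geq. Proof. by move=> x y /anti_leq. Qed.

Lemma part_perm_eq mu nu : is_part mu -> is_part nu -> perm_eq mu nu -> mu = nu.
Proof. by move=> /andP[s1 _] /andP[s2 _]; apply: (sorted_eq geq_trans geq_anti). Qed.

Lemma part_eq mu nu : is_part mu -> is_part nu -> (forall k, nth 0 mu k = nth 0 nu k) -> mu = nu.
Proof.
have le_size a b : is_part a -> (forall k, nth 0 a k = nth 0 b k) -> size a <= size b.
  move=> /andP[_ nz] e; rewrite leqNgt; apply/negP => lt.
  by case/negP: nz; rewrite -(nth_default 0 (leqnn (size b))) -e mem_nth.
move=> pm pn e; apply: (@eq_from_nth _ 0) => //.
by apply/eqP; rewrite eqn_leq !le_size.
Qed.

Definition all_parts n := [seq part_of_ffun p | p <- enum (partitions n n)].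

Lemma mem_all_parts n mu : (mu \in all_parts n) = is_part mu && (sumn mu == n).
Proof.
apply/mapP/andP => [[p]|[mup /eqP sum_mu]].
  by rewrite mem_enum => Pp ->; rewrite part_of_ffun_part ?sumn_part_of_ffun.
have [p Pp ep] := part_ffun (leqnn n) mup sum_mu.
exists p; rewrite ?mem_enum //; apply: part_eq => //; first exact: part_of_ffun_part.
move=> k; rewrite nth_part_of_ffun //; case: (ltnP k n) => [/ep//|le_k].
rewrite nth_default; last by rewrite (leq_trans _ le_k) // -sum_mu size_part.
by rewrite /fn insubF // ltnNge le_k.
Qed.

Lemma uniq_all_parts n : uniq (all_parts n).
Proof.
rewrite map_inj_in_uniq ?enum_uniq // => p q; rewrite !mem_enum => Pp Pq e.
by apply: fn_inj => k; rewrite -!nth_part_of_ffun // e.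
Qed.

Section CycleType.
Variables (n : nat) (s : 'S_n).

Definition orbit_seq := sort (relpre (fun A : {set 'I_n} => #|A|) geq) (enum (porbits s)).

Lemma cycle_typeE : cycle_type s = [seq #|pred_of_set A| | A <- orbit_seq].
Proof. by rewrite /cycle_type -sort_map. Qed.

Lemma mem_orbit_seq A : (A \in orbit_seq) = (A \in porbits s).
Proof. by rewrite mem_sort mem_enum. Qed.

Lemma uniq_orbit_seq : uniq orbit_seq. Proof. by rewrite sort_uniq enum_uniq. Qed.

Lemma cycle_type_part : is_part (cycle_type s).
Proof.
apply/andP; split; first exact/sort_sorted/geq_total.
rewrite mem_sort; apply/mapP => -[A]; rewrite mem_enum => /imsetP[x _ ->] /esym/eqP.
by rewrite cards_eq0 => /eqP/setP/(_ x); rewrite porbit_id inE.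
Qed.

Definition orbit_idx (x : 'I_n) := index (porbit s x) orbit_seq.

Lemma orbit_idx_lt x : orbit_idx x < size (cycle_type s).
Proof.
by rewrite cycle_typeE size_map index_mem mem_orbit_seq; apply/imsetP; exists x.
Qed.

Lemma card_orbit_idx (j : nat) : j < size (cycle_type s) ->
  \sum_(x | orbit_idx x == j) 1 = nth 0 (cycle_type s) j.
Proof.
rewrite cycle_typeE size_map => lt_j; rewrite (nth_map set0) // sum1_card.
have Aj : nth set0 orbit_seq j \in porbits s by rewrite -mem_orbit_seq mem_nth.
apply: eq_card => x; rewrite unfold_in /=; apply/eqP/idP => [<-|xA].
  by rewrite nth_index ?porbit_id // mem_orbit_seq; apply/imsetP; exists x.
case/imsetP: Aj => y _ ey; rewrite ey in xA.
have e : porbit s x = nth set0 orbit_seq j by rewrite ey; apply/eqP; rewrite eq_porbit_mem.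
by rewrite /orbit_idx e index_uniq // uniq_orbit_seq.
Qed.

Lemma sumn_cycle_type : sumn (cycle_type s) = n.
Proof.
rewrite -[in RHS](card_ord n) -sum1_card (partition_big (fun x => Ordinal (orbit_idx_lt x)) xpredT) //=.
rewrite sumnE (big_nth 0) big_mkord; apply: eq_bigr => j _.
by rewrite -card_orbit_idx.
Qed.

Lemma stable_porbit (A : finType) (f : {ffun 'I_n -> A}) x y :
  stable s f -> y \in porbit s x -> f y = f x.
Proof.
move=> /stableP sf /porbitP[i ->]; elim: i => [|i IH]; first by rewrite perm1.
by rewrite expgSr permM sf.
Qed.

Local Notation p := (size (cycle_type s)).
Local Notation om := (fun j : 'I_p => nth 0 (cycle_type s) j).

(** A word fixed by [s] is a colouring of the cycles of [s], in which a cycle counts with its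
    length. *)
Lemma card_fixed_words (A : finType) (c : A -> nat) :
  #|fixed_words c s| = #|weighted_words om id c|.
Proof.
pose F (phi : {ffun 'I_p -> A}) : {ffun 'I_n -> A} := [ffun x => phi (Ordinal (orbit_idx_lt x))].
have rep (j : 'I_p) : {x | Ordinal (orbit_idx_lt x) = j}.
  apply: sig_eqW; have lt_j : j < size orbit_seq by rewrite -(size_map (fun A : {set 'I_n} => #|A|)) -cycle_typeE.
  have : nth set0 orbit_seq j \in porbits s by rewrite -mem_orbit_seq mem_nth.
  case/imsetP => x _ ex; exists x; apply/val_inj => /=.
  by rewrite /orbit_idx -ex index_uniq // uniq_orbit_seq.
have F_inj : injective F.
  move=> phi phi' /ffunP e; apply/ffunP => j; have [x ex] := rep j.
  by have := e x; rewrite !ffunE ex.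
have occF phi a : occ (F phi) a = \sum_(j | phi j == a) om j.
  rewrite /occ (partition_big (fun x => Ordinal (orbit_idx_lt x)) (fun j => phi j == a)) /=; last first.
    by move=> x; rewrite ffunE.
  apply: eq_bigr => j /eqP ej; rewrite -card_orbit_idx //; apply: eq_bigl => x.
  by rewrite ffunE -val_eqE /= andb_idl // => /eqP e; rewrite -ej; apply/eqP; congr (phi _); apply/val_inj.
rewrite -[RHS](card_imset _ F_inj); apply: eq_card => f; apply/idP/imsetP => [|[phi]].
  rewrite inE => /andP[sf /has_contentP cf].
  pose phi : {ffun 'I_p -> A} := [ffun j => f (sval (rep j))].
  have eF : f = F phi.
    apply/ffunP => x; rewrite !ffunE; case: (rep _) => y /= /(congr1 val) /= ey.
    apply: stable_porbit => //; rewrite -eq_porbit_mem; apply/eqP.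
    have mx z : porbit s z \in orbit_seq by rewrite mem_orbit_seq; apply/imsetP; exists z.
    by rewrite -(nth_index set0 (mx x)) -[RHS](nth_index set0 (mx y)) -/(orbit_idx x) -/(orbit_idx y) ey.
  exists phi => //; rewrite inE; apply/andP; split; first by apply/forallP.
  by apply/forallP => a; rewrite -occF -eF cf.
rewrite inE => /andP[_ /forallP cphi] ->; rewrite inE; apply/andP; split.
  apply/stableP => x; rewrite !ffunE; congr (phi _); apply/val_inj; rewrite /= /orbit_idx.
  congr index; apply/eqP; rewrite eq_porbit_mem.
  by have := mem_porbit s 1 x; rewrite expg1.
by apply/has_contentP => a; rewrite occF; apply/eqP.
Qed.
End CycleType.

Section RealizeType.
Variables (n : nat) (mu : seq nat).
Hypotheses (mu_part : is_part mu) (sum_mu : sumn mu = n).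
Local Notation idx := (reshape_index mu).
Local Notation off := (reshape_offset mu).

Let ltx (x : 'I_n) : x < sumn mu. Proof. by rewrite sum_mu. Qed.

(** Rotation by [k] steps inside each row of the tableau of shape [mu] filled row by row. For one
    step the rows become the cycles, so every partition is a cycle type. *)
Definition rot_nat (x : 'I_n) k := flatten_index mu (idx x) ((off x + k) %% nth 0 mu (idx x)).

Lemma rot_off_lt x k : (off (val (x : 'I_n)) + k) %% nth 0 mu (idx x) < nth 0 mu (idx x).
Proof. by rewrite ltn_mod (leq_ltn_trans _ (reshape_offsetP (ltx x))). Qed.

Lemma rot_nat_lt x k : rot_nat x k < n.
Proof. by rewrite -sum_mu flatten_indexP // rot_off_lt. Qed.

Definition rot_fun k x : 'I_n := Ordinal (rot_nat_lt x k).

Lemma idx_rot k x : idx (rot_fun k x) = idx x.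
Proof. by rewrite /= flatten_indexKl // rot_off_lt. Qed.

Lemma off_rot k x : off (rot_fun k x) = (off x + k) %% nth 0 mu (idx x).
Proof. by rewrite /= flatten_indexKr // rot_off_lt. Qed.

Lemma rot_fun_inj : injective (rot_fun 1).
Proof.
move=> x y e; have ei : idx x = idx y by rewrite -(idx_rot 1 x) e idx_rot.
apply: (@reshape_inj n mu) => //; have := congr1 (fun z : 'I_n => off z) e.
rewrite !off_rot ei => /eqP; rewrite eqn_modDr => /eqP; rewrite !modn_small //.
  by rewrite reshape_offsetP.
by rewrite -ei reshape_offsetP.
Qed.

Definition rot_perm : 'S_n := perm rot_fun_inj.

Lemma rot_permX k x : (rot_perm ^+ k)%g x = rot_fun k x.
Proof.
elim: k => [|k IH].
  rewrite expg0 perm1; apply: (@reshape_inj n mu); first by rewrite idx_rot.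
  by rewrite off_rot addn0 modn_small // reshape_offsetP.
rewrite expgSr permM IH permE; apply: (@reshape_inj n mu); first by rewrite !idx_rot.
by rewrite !off_rot idx_rot modnDml addn1 addnS.
Qed.

Lemma porbit_rot x : porbit rot_perm x = [set y : 'I_n | idx y == idx x].
Proof.
apply/setP => y; rewrite inE; apply/porbitP/eqP => [[k ->]|ey].
  by rewrite rot_permX idx_rot.
exists (off y + (nth 0 mu (idx x) - off x)); rewrite rot_permX.
apply: (@reshape_inj n mu); first by rewrite idx_rot.
have := reshape_offsetP (ltx x); have := reshape_offsetP (ltx y); rewrite ey => ly lx.
rewrite off_rot (_ : off x + _ = off y + nth 0 mu (idx x)); last by lia.
by rewrite modnDr modn_small.
Qed.

Lemma cycle_type_rot : cycle_type rot_perm = mu.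
Proof.
apply: part_perm_eq => //; first exact: cycle_type_part.
rewrite /cycle_type perm_sort.
pose B (r : 'I_(size mu)) : {set 'I_n} := [set y : 'I_n | idx y == r].
have cardB r : #|B r| = nth 0 mu r.
  by rewrite -(count_reshape_index sum_mu) sum1_card; apply: eq_card => y; rewrite inE.
have mu_gt0 (r : 'I_(size mu)) : 0 < nth 0 mu r.
  rewrite lt0n; apply: contraTneq mu_part => e; rewrite /is_part negb_and negbK.
  by rewrite -e mem_nth ?orbT.
have Bne (r : 'I_(size mu)) : exists y, y \in B r by apply/card_gt0P; rewrite cardB.
have B_inj : injective B.
  move=> r r' e; have [y yB] := Bne r; have yB' : y \in B r' by rewrite -e.
  by move: yB yB'; rewrite !inE => /eqP ey /eqP ey'; apply/val_inj; rewrite /= -ey -ey'.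
have eO : porbits rot_perm = B @: [set: 'I_(size mu)].
  apply/setP => A; apply/imsetP/imsetP => [[x _ ->]|[r _ ->]].
    by exists (Ordinal (reshape_indexP (ltx x))) => //; rewrite porbit_rot.
  have [y] := Bne r; rewrite inE => /eqP ey; exists y => //.
  by rewrite porbit_rot; apply/setP => z; rewrite !inE ey.
have pE : perm_eq (enum (porbits rot_perm)) [seq B r | r <- enum 'I_(size mu)].
  apply: uniq_perm => [||A]; first exact: enum_uniq.
    by rewrite (map_inj_uniq B_inj); apply: enum_uniq.
  rewrite mem_enum eO; apply/imsetP/mapP => -[r _ ->]; exists r => //.
  by rewrite mem_enum.
apply: (perm_trans (perm_map _ pE)); rewrite -map_comp.
rewrite (eq_map (g := fun r : 'I_(size mu) => nth 0 mu r)); last by move=> r /=.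
by rewrite (map_comp (nth 0 mu) val) val_enum_ord map_nth_iota0 // take_size.
Qed.
End RealizeType.

(** * Power sums, the Hall inner product and subset characters *)

Section Hall.
Local Open Scope ring_scope.

(** A term of the expanded product chooses a variable for each part: a word over the variables,
    weighted by the parts. *)
Lemma mcoeff_sf_p mu N (m : 'X_{1..N}) : (sf_p mu N)@_m =
  #|weighted_words (fun j : 'I_(size mu) => nth 0%N mu j) id (fun i : 'I_N => m i)|%:R.
Proof.
rewrite /sf_p (big_nth 0%N) big_mkord bigA_distr_bigA /= raddf_sum /=.
rewrite -sum1_card natr_sum [RHS]big_mkcond; apply: eq_bigr => f _.
pose mf : 'X_{1..N} := [multinom (\sum_(j | f j == i) nth 0%N mu j)%N | i < N].
have -> : \prod_(j < size mu) 'X_(f j) ^+ nth 0%N mu j = 'X_[mf] :> {mpoly rat[N]}.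
  rewrite (eq_bigr (fun j => 'X_[(U_(f j) *+ nth 0%N mu j)%MM])); last by move=> j _; rewrite mpolyXn.
  rewrite mprodXE; congr 'X_[_]; apply/mnmP => i; rewrite mnm_sumE mnmE [in RHS]big_mkcond /=.
  by apply: eq_bigr => j _; rewrite mulmnE mnm1E; case: eqP; rewrite ?mul1n ?mul0n ?muln1 ?muln0.
rewrite mcoeffX inE [X in X && _](_ : _ = true) /=; last by apply/forallP.
have -> : [forall i, (\sum_(j | f j == i) nth 0%N mu j)%N == m i] = (mf == m).
  apply/forallP/eqP => [H|<- i]; last by rewrite mnmE.
  by apply/mnmP => i; rewrite mnmE; apply/eqP.
by case: (mf == m).
Qed.

Lemma sumn_filter_pos (s : seq nat) : sumn [seq e <- s | e != 0%N] = sumn s.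
Proof. by elim: s => //= e s IH; case: eqP => [->|] //=; rewrite IH. Qed.

Lemma mdeg_sumn N (m : 'X_{1..N}) : mdeg m = sumn (m : seq nat).
Proof. by rewrite /mdeg sumnE. Qed.

Lemma mcoeff_sf_m nu N (m : 'X_{1..N}) :
  (sf_m nu N)@_m = (perm_eq [seq e <- (m : seq nat) | e != 0%N] nu)%:R.
Proof.
rewrite /sf_m raddf_sum /=.
rewrite (eq_bigr (fun m' : 'X_{1..N < (sumn nu).+1} => (val m' == m)%:R)); last first.
  by move=> m' _; rewrite mcoeffX.
case: (boolP (perm_eq _ _)) => pm; last first.
  rewrite big1 // => m' pm'; case: eqP => // e; rewrite -e in pm.
  by rewrite pm' in pm.
have lt_m : (mdeg m < (sumn nu).+1)%N.
  by rewrite mdeg_sumn -(perm_sumn pm) sumn_filter_pos.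
rewrite (bigD1 (BMultinom lt_m)) //= eqxx big1 ?addr0 // => m' /andP[_].
by rewrite -val_eqE /= => /negbTE->.
Qed.

Lemma map_multinom N (m : 'X_{1..N}) : [seq m i | i <- enum 'I_N] = m.
Proof. by rewrite -[RHS](map_tnth_enum (multinom_val m)). Qed.

Definition power_coef (mu nu : seq nat) : nat :=
  #|weighted_words (fun j : 'I_(size mu) => nth 0%N mu j) id (fun k : 'I_(size nu) => nth 0%N nu k)|.

(** By [card_weighted_words] the coefficient of a monomial depends only on its nonzero exponents up
    to order, so it may be computed at the partition [nu] formed by them. *)
Lemma sf_p_expand n mu : is_part mu -> sumn mu = n -> (0 < n)%N ->
  forall N, sf_p mu N = \sum_(nu <- all_parts n) (power_coef mu nu)%:R *: sf_m nu N.
Proof.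
move=> mu_part sum_mu n_gt0 N; apply/mpolyP => m; rewrite mcoeff_sf_p raddf_sum /=.
pose nu := sort geq [seq e <- (m : seq nat) | e != 0%N].
have nu_part : is_part nu.
  by rewrite /is_part sort_sorted ?mem_sort ?mem_filter //; apply: geq_total.
have pnu : perm_eq [seq e <- (m : seq nat) | e != 0%N] nu by rewrite perm_sym perm_sort.
have om_gt0 (j : 'I_(size mu)) : (0 < nth 0%N mu j)%N.
  rewrite lt0n; apply: contraTneq mu_part => e; rewrite /is_part negb_and negbK.
  by rewrite -e mem_nth ?orbT.
have other tau : tau \in all_parts n -> tau != nu ->
    ((power_coef mu tau)%:R *: sf_m tau N)@_m = 0.
  rewrite mem_all_parts => /andP[tau_part _] ne; rewrite mcoeffZ mcoeff_sf_m.
  case: (boolP (perm_eq _ _)) => [pt|_]; last by rewrite mulr0.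
  case/eqP: ne; apply: part_perm_eq => //.
  by rewrite perm_sym; apply: perm_trans pt; rewrite perm_sym.
have sum_nu : sumn nu = mdeg m by rewrite mdeg_sumn -(perm_sumn pnu) sumn_filter_pos.
have [eqn|nen] := eqVneq (mdeg m) n; last first.
  rewrite big_seq big1 => [|tau taun]; last first.
    apply: other => //; apply: contraNneq nen => e.
    by move: taun; rewrite mem_all_parts e sum_nu => /andP[].
  apply/eqP; rewrite pnatr_eq0 cards_eq0 -subset0; apply/subsetP => f.
  rewrite inE => /andP[_ /forallP H]; case/eqP: nen.
  rewrite mdegE -sum_mu sumnE (big_nth 0%N) big_mkord.
  rewrite [RHS](partition_big f xpredT) //=; apply: eq_bigr => i _.
  by rewrite -(eqP (H i)).
have nu_in : nu \in all_parts n by rewrite mem_all_parts nu_part sum_nu eqn eqxx.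
rewrite (bigD1_seq nu) ?uniq_all_parts //= big_seq_cond big1 ?addr0; last first.
  by move=> tau /andP[tin ne]; apply: other.
rewrite mcoeffZ mcoeff_sf_m pnu mulr1; congr (_%:R).
have [i0 _] : exists i : 'I_N, true.
  case: (posnP N) => [N0|N_gt0]; last by exists (Ordinal N_gt0).
  by exfalso; move: n_gt0; rewrite -eqn mdegE big1 // => i _; have := ltn_ord i; lia.
have k0 : 'I_(size nu).
  by exists 0%N; rewrite lt0n; apply: contraTneq n_gt0 => /size0nil e; rewrite -eqn -sum_nu e.
apply: (card_weighted_words id om_gt0 i0 k0).
rewrite map_multinom (perm_trans pnu) //.
rewrite (map_comp (nth 0%N nu) val) val_enum_ord map_nth_iota0 // take_size.
by rewrite (all_filterP _) //; apply/allP => v; rewrite mem_sort mem_filter => /andP[].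
Qed.

Section Htilde.
Variables (n a : nat) (s : 'S_n).
Hypotheses (a_gt0 : (0 < a)%N) (le_an : (a + a <= n)%N).

(** Duality with the monomial functions picks a single coefficient of the power sum, a number of
    cycle colourings and hence of fixed words. The bound on [a] makes [(n-a, a)] a partition. *)
Lemma hall_wordchar :
  hall_eq (sf_h (add_row n [:: a])) (sf_p (cycle_type s))
    #|fixed_words (fun k : 'I_2 => nth 0%N [:: (n - a)%N; a] k) s|%:R.
Proof.
have n_gt0 : (0 < n)%N by lia.
pose nu := [:: (n - a)%N; a].
have nu_in : nu \in all_parts n.
  rewrite mem_all_parts /is_part /= !inE andbT; apply/andP; split; last by apply/eqP; lia.
  by apply/andP; split; [rewrite /geq /=; lia | rewrite negb_or; apply/andP; split; apply/eqP; lia].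
have row_nu : add_row n [:: a] = nu by rewrite /add_row /= addn0.
exists (all_parts n), (fun tau => (tau == nu)%:R), (fun tau => (power_coef (cycle_type s) tau)%:R).
split.
- exact: uniq_all_parts.
- by apply/allP => tau; rewrite mem_all_parts => /andP[].
- move=> N; rewrite row_nu (bigD1_seq nu) ?uniq_all_parts //= eqxx scale1r big1 ?addr0 // => tau ne.
  by rewrite (negbTE ne) scale0r.
- by apply: sf_p_expand; rewrite ?cycle_type_part ?sumn_cycle_type.
rewrite (bigD1_seq nu) ?uniq_all_parts //= eqxx mul1r big1 ?addr0 => [|tau ne]; last first.
  by rewrite (negbTE ne) mul0r.
by rewrite card_fixed_words.
Qed.

Lemma htilde_eval f : is_htilde [:: a] f ->
  sf_eval f (cycle_type s) = wordchar n (fun k : 'I_2 => nth 0%N [:: (n - a)%N; a] k) s.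
Proof.
case=> _ /(_ n (cycle_type s)) H; rewrite wordcharE -(ratr_nat algC); apply: H.
- by rewrite /= addn0.
- exact: cycle_type_part.
- exact: sumn_cycle_type.
- exact: hall_wordchar.
Qed.
End Htilde.
End Hall.

(** * Expansion of the product *)

(* [S] is read as the bitmask of a subset of [0, l), listed in decreasing order. *)
Fixpoint mask_set (l S : nat) : seq nat :=
  if l is l'.+1 then
    if 2 ^ l' <= S then l' :: mask_set l' (S - 2 ^ l') else mask_set l' S
  else [::].

Lemma mask_set_lt l S i : i \in mask_set l S -> i < l.
Proof.
elim: l S => //= l IH S; case: ifP => _; rewrite ?inE; last by move/IH/leqW.
by move=> /predU1P[->//|/IH/leqW].
Qed.

Section Blocks.
Variables (n K : nat).
Hypothesis n_gt0 : 0 < n.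

Lemma sum_blocks (F : nat -> nat) :
  \sum_(0 <= c < K * n) F c = \sum_(0 <= S < K) \sum_(0 <= j < n) F (S * n + j).
Proof.
elim: K => [|k IH]; first by rewrite mul0n !big_geq.
rewrite big_nat_recr //= -IH mulSnr (@big_cat_nat _ _ _ (k * n)) ?leq_addr //=; congr addn.
rewrite -{1}[k * n]add0n big_addn addKn.
by apply: eq_bigr => j _; rewrite addnC.
Qed.

Lemma block_lt S j : S < K -> j < n -> S * n + j < K * n.
Proof. by move=> lt_S lt_j; apply: (@leq_trans (S.+1 * n)); rewrite ?leq_mul2r ?lt_S ?orbT // mulSn; lia. Qed.

Lemma block_div S j : j < n -> (S * n + j) %/ n = S.
Proof. by move=> lt_j; rewrite divnMDl // divn_small // addn0. Qed.

Lemma block_mod S j : j < n -> (S * n + j) %% n = j.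
Proof. by move=> lt_j; rewrite modnMDl modn_small. Qed.

Lemma div_lt c : c < K * n -> c %/ n < K.
Proof. by rewrite ltn_divLR. Qed.

Lemma block_eq S j c : j < n -> (c == S * n + j) = (c %% n == j) && (c %/ n == S).
Proof.
move=> lt_j; apply/eqP/andP => [->|[/eqP <- /eqP <-]]; first by rewrite block_mod ?block_div.
by rewrite -divn_eq.
Qed.

(** From here on the pair ([S], [j]) with [j < n] is coded by [S * n + j], and [m] gives
    multiplicities of pairs. The two sums are the content in the letters [j] and the number of
    occurrences of an element [i] in the sets. *)
Definition jsum (m : nat -> nat) j := \sum_(0 <= S < K) m (S * n + j).
Definition asum (l : nat) (m : nat -> nat) i :=
  \sum_(0 <= S < K | i \in mask_set l S) \sum_(0 <= j < n) m (S * n + j).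

(** Transposes each [n] by [n] block: the letter [j] and the tableau row [r] change places while [S]
    stays. *)
Definition blocktr (t : nat -> nat -> nat) c r := t (c %/ n * n + r) (c %% n).

Lemma sum_jsum m : \sum_(0 <= j < n) jsum m j = \sum_(0 <= c < K * n) m c.
Proof. by rewrite sum_blocks exchange_big. Qed.

Lemma colsum_blocktr t r : r < n -> colsum (K * n) (blocktr t) r = jsum (rowsum n t) r.
Proof.
move=> lt_r; rewrite /colsum sum_blocks; apply: eq_bigr => S _; rewrite /rowsum.
rewrite !big_nat; apply: eq_bigr => j /andP[_ lt_j].
by rewrite /blocktr block_div ?block_mod.
Qed.

Lemma jsum_rowsum_blocktr t j : j < n -> jsum (rowsum n (blocktr t)) j = colsum (K * n) t j.
Proof.
move=> lt_j; rewrite /colsum sum_blocks; apply: eq_bigr => S _; rewrite /rowsum.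
by apply: eq_bigr => r _; rewrite /blocktr block_div ?block_mod.
Qed.

Lemma asum_rowsum_blocktr l t i : asum l (rowsum n (blocktr t)) i = asum l (rowsum n t) i.
Proof.
apply: eq_bigr => S _; rewrite /rowsum [RHS]exchange_big /= !big_nat.
apply: eq_bigr => j /andP[_ lt_j].
by apply: eq_bigr => r _; rewrite /blocktr block_div ?block_mod.
Qed.

Lemma blocktrK t c r : r < n -> c < K * n -> blocktr (blocktr t) c r = t c r.
Proof. by move=> lt_r lt_c; rewrite /blocktr block_div ?block_mod // -divn_eq. Qed.

Lemma eq_jsum m m' j : j < n -> (forall c, c < K * n -> m c = m' c) -> jsum m j = jsum m' j.
Proof.
move=> lt_j e; rewrite /jsum !big_nat; apply: eq_bigr => S /andP[_ lt_S].
by apply: e; apply: block_lt.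
Qed.

Lemma eq_asum l m m' i : (forall c, c < K * n -> m c = m' c) -> asum l m i = asum l m' i.
Proof.
move=> e; rewrite /asum big_nat_cond [RHS]big_nat_cond; apply: eq_bigr => S /andP[/andP[_ lt_S] _].
by rewrite !big_nat; apply: eq_bigr => j /andP[_ lt_j]; apply: e; apply: block_lt.
Qed.

Section Occurrences.
Variables (X : finType) (h : X -> nat).
Hypothesis h_lt : forall x, h x < K * n.
Let m c := \sum_(x | h x == c) 1.

Lemma jsum_occ j : j < n -> jsum m j = \sum_(x | h x %% n == j) 1.
Proof.
move=> lt_j; rewrite [RHS](partition_big (fun x => Ordinal (div_lt (h_lt x))) xpredT) //=.
rewrite /jsum big_mkord; apply: eq_bigr => S _; apply: eq_bigl => x.
by rewrite block_eq // -val_eqE.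
Qed.

Lemma block_occ S : \sum_(0 <= j < n) m (S * n + j) = \sum_(x | h x %/ n == S) 1.
Proof.
have lt_mod x : h x %% n < n by rewrite ltn_mod.
rewrite [RHS](partition_big (fun x => Ordinal (lt_mod x)) xpredT) //= big_mkord.
by apply: eq_bigr => j _; apply: eq_bigl => x; rewrite block_eq // -val_eqE andbC.
Qed.

Lemma asum_occ l i : asum l m i = \sum_(x | i \in mask_set l (h x %/ n)) 1.
Proof.
rewrite [RHS](partition_big (fun x => Ordinal (div_lt (h_lt x)))
  (fun S : 'I_K => i \in mask_set l S)) //=.
rewrite /asum big_mkord; apply: eq_bigr => S iS; rewrite block_occ; apply: eq_bigl => x.
by rewrite -val_eqE /= andb_idl // => /eqP ->.
Qed.
End Occurrences.
End Blocks.

Section SubsetWords.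
Variables (n : nat) (s : 'S_n) (al : nat -> nat).
Hypothesis n_gt0 : 0 < n.

Definition pair_content a : 'I_2 -> nat := fun k => nth 0 [:: n - a; a] k.

Definition mask_words l : {set {ffun 'I_n -> 'I_(2 ^ l)}} :=
  [set g : {ffun 'I_n -> 'I_(2 ^ l)} | stable s g && [forall i : 'I_l, \sum_(x | (i : nat) \in mask_set l (g x)) 1 == al i]].

(** The bits of a word over bitmasks are independent two-letter words, one for each subset
    character; the induction splits off the top bit. *)
Lemma card_mask_words l : (forall i, i < l -> al i <= n) ->
  #|mask_words l| = \prod_(i < l) #|fixed_words (pair_content (al i)) s|.
Proof.
elim: l => [|l IH] le_al.
  rewrite big_ord0; have lt0 : 0 < 2 ^ 0 by [].
  apply/eqP/cards1P; exists [ffun=> Ordinal lt0]; apply/setP => g; rewrite !inE.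
  have gE : g = [ffun=> Ordinal lt0] by apply/ffunP => x; rewrite ffunE; apply/val_inj; case: (g x) => -[].
  rewrite gE eqxx; apply/andP; split; last by apply/forallP => -[].
  by apply/stableP => x; rewrite !ffunE.
rewrite big_ord_recr /= -IH; last by move=> i lt_i; apply: le_al; apply: leqW.
rewrite -cardsX.
have lt1 (g : 'I_(2 ^ l)) (b : 'I_2) : b * 2 ^ l + g < 2 ^ l.+1.
  by rewrite expnS; have := ltn_ord g; have := ltn_ord b; case: (nat_of_ord b) => [|[|]] //; lia.
pose F (p : {ffun 'I_n -> 'I_(2 ^ l)} * {ffun 'I_n -> 'I_2}) : {ffun 'I_n -> 'I_(2 ^ l.+1)} :=
  [ffun x => Ordinal (lt1 (p.1 x) (p.2 x))].
have maskF (g : 'I_(2 ^ l)) (b : 'I_2) :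
    mask_set l.+1 (b * 2 ^ l + g) = if b == 0 :> nat then mask_set l g else l :: mask_set l g.
  rewrite /=; case: (ltnP _) => [lt|le] /=.
    have -> : b = 0 :> nat by case: (nat_of_ord b) lt => // b'; rewrite mulSn; lia.
    by rewrite mul0n add0n.
  have [b0|b1] := eqVneq (nat_of_ord b) 0.
    by move: le; rewrite b0 mul0n add0n leqNgt ltn_ord.
  have -> : b = 1 :> nat by have := ltn_ord b; lia.
  by rewrite mul1n addKn.
have F_inj : injective F.
  move=> [g b] [g' b'] /ffunP e; have e' x : g x = g' x /\ b x = b' x.
    have := congr1 val (e x); rewrite !ffunE /= => ex.
    have := ltn_ord (g x); have := ltn_ord (g' x) => h1 h2.
    have := congr1 (fun z => z %/ 2 ^ l) ex; have := congr1 (fun z => z %% 2 ^ l) ex.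
    rewrite !modnMDl !modn_small // !divnMDl ?expn_gt0 // !divn_small // !addn0.
    by move=> e1 e2; split; apply/val_inj.
  by congr pair; apply/ffunP => x; case: (e' x).
rewrite -[RHS](card_imset _ F_inj); apply: eq_card => h.
have condF (p : {ffun 'I_n -> 'I_(2 ^ l)} * {ffun 'I_n -> 'I_2}) :
    (F p \in mask_words l.+1) = (p \in setX (mask_words l) (fixed_words (pair_content (al l)) s)).
  case: p => g b; rewrite inE [RHS]inE !inE /=.
  have -> : stable s (F (g, b)) = stable s g && stable s b.
    apply/stableP/andP => [st|[/stableP sg /stableP sb] x]; last by rewrite !ffunE /= sg sb.
    have e x : g (s x) = g x /\ b (s x) = b x.
      have := congr1 val (st x); rewrite !ffunE /= => ex.
      have := ltn_ord (g x); have := ltn_ord (g (s x)) => h1 h2.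
      have := congr1 (fun z => z %/ 2 ^ l) ex; have := congr1 (fun z => z %% 2 ^ l) ex.
      rewrite !modnMDl !modn_small // !divnMDl ?expn_gt0 // !divn_small // !addn0.
      by move=> e1 e2; split; apply/val_inj.
    by split; apply/stableP => x; case: (e x).
  have cntF i : i < l -> \sum_(x | i \in mask_set l.+1 (F (g, b) x)) 1 = \sum_(x | i \in mask_set l (g x)) 1.
    move=> lt_i; apply: eq_bigl => x; rewrite ffunE; rewrite [LHS]/= -[X in X = _]/(i \in mask_set l.+1 _) maskF.
    by case: ifP => // _; rewrite inE ltn_eqF.
  have cntl : \sum_(x | l \in mask_set l.+1 (F (g, b) x)) 1 = occ b (inord 1).
    apply: eq_bigl => x; rewrite ffunE; rewrite -[X in X = _]/(l \in mask_set l.+1 _) maskF.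
    have nl : (l \in mask_set l (g x)) = false by apply/negP => /mask_set_lt; rewrite ltnn.
    rewrite -val_eqE /= inordK //; have := ltn_ord (b x).
    by case: (nat_of_ord (b x)) => [|[|]] // _; rewrite /= ?inE ?eqxx ?nl.
  have contb : has_content (pair_content (al l)) b = (occ b (inord 1) == al l).
    have o2 : occ b (inord 0) + occ b (inord 1) = n.
      rewrite -[RHS](sum_occ b) big_ord_recl big_ord1.
      by congr (occ b _ + occ b _); apply/val_inj; rewrite /= inordK.
    have le_l : al l <= n by apply: le_al.
    apply/has_contentP/eqP => [->|e]; first by rewrite /pair_content inordK.
    move=> k; rewrite -[k]inord_val /pair_content; have := ltn_ord k.
    by case: (nat_of_ord k) => [|[|]] // _; rewrite inordK //=; lia.
  rewrite contb -cntl; case: (stable s g) => //=; case: (stable s b) => /=; last by rewrite andbF.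
  apply/forallP/andP => [H|[/forallP H1 /eqP H2] i].
    split; last exact: (H ord_max).
    apply/forallP => i; have := H (widen_ord (leqnSn l) i); rewrite /= -cntF //.
  have [lt_i|le_i] := ltnP i l; first by rewrite cntF //; apply: (H1 (Ordinal lt_i)).
  have -> : nat_of_ord i = l by apply/eqP; rewrite eqn_leq le_i -ltnS ltn_ord.
  by rewrite H2.
apply/idP/imsetP => [hm|[p pm ->]]; last by rewrite condF.
have lt_mod (x : 'I_n) : h x %% 2 ^ l < 2 ^ l by rewrite ltn_mod expn_gt0.
have lt_div (x : 'I_n) : h x %/ 2 ^ l < 2.
  by rewrite ltn_divLR ?expn_gt0 // -expnS ltn_ord.
pose p := ([ffun x => Ordinal (lt_mod x)] : {ffun 'I_n -> 'I_(2 ^ l)},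
           [ffun x => Ordinal (lt_div x)] : {ffun 'I_n -> 'I_2}).
have hF : h = F p by apply/ffunP => x; apply/val_inj; rewrite !ffunE /= -divn_eq.
by exists p => //; rewrite -condF -hF.
Qed.
End SubsetWords.

(** * Coefficients of the product as numbers of matrices *)

Section Coefficient.
Variables (n l : nat) (la al : nat -> nat).
Hypothesis n_gt0 : 0 < n.
Hypothesis la_dec : decreasing n la.
Hypothesis sum_la : \sum_(k < n) la k = n.
Hypothesis al_le : forall i, i < l -> al i <= n.
Local Notation K := (2 ^ l).
Local Notation N := (K * n).
Local Notation contents := {ffun 'I_N -> 'I_n.+1}.

Definition acond (m : nat -> nat) := [forall i : 'I_l, asum n K l m i == al i].
Definition jcond (m p : nat -> nat) := [forall j : 'I_n, jsum n K m j == p j].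

Definition balanced (M : contents) := \sum_c M c == n.

Lemma sum_fn_nat (M : contents) : \sum_(0 <= c < N) fn M c = \sum_c M c.
Proof. by rewrite big_mkord; apply: eq_bigr => c _; rewrite fnE. Qed.

(** A word in the letters [j] and a word in the sets [S] combine to one word over codes. Only
    marginals of its content are prescribed, so the count is split by the full content [M], which
    makes each summand a word character. *)
Lemma prod_words (s : 'S_n) (ka : nat -> nat) :
  #|fixed_words (fun k : 'I_n => ka k) s| * #|mask_words s al l| =
  \sum_(M : contents | [&& balanced M, jcond (fn M) ka & acond (fn M)])
    #|fixed_words (fun c => M c : nat) s|.
Proof.
pose cont (h : {ffun 'I_n -> 'I_N}) : contents := [ffun c => inord (occ h c)].
have contE h c : cont h c = occ h c :> nat by rewrite ffunE inordK // occ_le.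
have fnc h c : fn (cont h) c = \sum_(x | val (h x) == c) 1.
  rewrite /fn; case: insubP => [c' _ <-|nlt]; first by rewrite contE.
  by rewrite big_pred0 // => x; apply/negP => /eqP e; move: nlt; rewrite -e ltn_ord.
pose W := [set h : {ffun 'I_n -> 'I_N} | [&& stable s h, jcond (fn (cont h)) ka & acond (fn (cont h))]].
have eqf h : fn (cont h) =1 (fun c => \sum_(x | val (h x) == c) 1) by move=> c; apply: fnc.
have jE h j : j < n -> jsum n K (fn (cont h)) j = \sum_(x | val (h x) %% n == j) 1.
  move=> lt_j; rewrite -(jsum_occ n_gt0 (K := K) (h := fun x => val (h x)) (fun x => ltn_ord (h x)) lt_j).
  by apply: eq_bigr => S _; rewrite fnc.
have aE h i : asum n K l (fn (cont h)) i = \sum_(x | i \in mask_set l (val (h x) %/ n)) 1.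
  rewrite -(asum_occ n_gt0 (K := K) (h := fun x => val (h x)) (fun x => ltn_ord (h x))).
  by apply: eq_bigr => S _; apply: eq_bigr => j _; rewrite fnc.
transitivity #|W|; last first.
  rewrite -sum1_card (partition_big cont
    (fun M : contents => [&& balanced M, jcond (fn M) ka & acond (fn M)])) /=; last first.
    move=> h; rewrite inE => /and3P[_ -> ->]; rewrite !andbT.
    by rewrite /balanced (eq_bigr (occ h)) ?sum_occ // => c _; rewrite contE.
  apply: eq_bigr => M /and3P[_ jM aM]; rewrite sum1_card; apply: eq_card => h.
  rewrite unfold_in /= !inE -!andbA; congr (_ && _).
  apply/and3P/has_contentP => [[_ _ /eqP <-] c|cM]; first by rewrite contE.
  have eM : cont h = M by apply/ffunP => c; apply/val_inj; rewrite /= contE cM.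
  by rewrite eM jM aM eqxx.
rewrite -cardsX.
have ltF (f : 'I_n) (g : 'I_K) : g * n + f < N by apply: block_lt.
pose F (q : {ffun 'I_n -> 'I_n} * {ffun 'I_n -> 'I_K}) : {ffun 'I_n -> 'I_N} :=
  [ffun x => Ordinal (ltF (q.1 x) (q.2 x))].
have F1 q x : val (F q x) %% n = q.1 x by rewrite ffunE /= block_mod.
have F2 q x : val (F q x) %/ n = q.2 x by rewrite ffunE /= block_div.
have F_inj : injective F.
  move=> [f g] [f' g'] /ffunP e; congr pair; apply/ffunP => x; apply/val_inj.
    by rewrite /= -(F1 (f, g)) -(F1 (f', g')) e.
  by rewrite /= -(F2 (f, g)) -(F2 (f', g')) e.
have condF q : (F q \in W) = (q \in setX (fixed_words (fun k : 'I_n => ka k) s) (mask_words s al l)).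
  case: q => f g; rewrite [RHS]inE !inE /=.
  have -> : stable s (F (f, g)) = stable s f && stable s g.
    apply/stableP/andP => [st|[/stableP sf /stableP sg] x]; last first.
      by apply/val_inj; rewrite !ffunE /= sf sg.
    by split; apply/stableP => x; apply/val_inj => /=;
      [rewrite -(F1 (f, g)) -[RHS](F1 (f, g)) st | rewrite -(F2 (f, g)) -[RHS](F2 (f, g)) st].
  have -> : jcond (fn (cont (F (f, g)))) ka = has_content (fun k : 'I_n => ka k) f.
    apply: eq_forallb => j; rewrite jE //; congr (_ == _); apply: eq_bigl => x.
    by rewrite F1 /= -val_eqE.
  have -> : acond (fn (cont (F (f, g)))) = [forall i : 'I_l, \sum_(x | (i : nat) \in mask_set l (g x)) 1 == al i].
    apply: eq_forallb => i; rewrite aE; congr (_ == _); apply: eq_bigl => x.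
    by rewrite F2.
  by rewrite -!andbA; do !bool_congr.
rewrite -(card_imset _ F_inj); apply: eq_card => h; apply/imsetP/idP => [[q qW ->]|hW].
  by rewrite condF.
have lt_mod (x : 'I_n) : h x %% n < n by rewrite ltn_mod.
have lt_div (x : 'I_n) : h x %/ n < K by apply: div_lt.
pose q := ([ffun x => Ordinal (lt_mod x)] : {ffun 'I_n -> 'I_n},
           [ffun x => Ordinal (lt_div x)] : {ffun 'I_n -> 'I_K}).
have hF : h = F q by apply/ffunP => x; apply/val_inj; rewrite !ffunE /= -divn_eq.
by exists q => //; rewrite -condF -hF.
Qed.

Definition alt_jsum (m : nat -> nat) (w : 'S_n) :=
  [forall j : 'I_n, jsum n K m j + (n - j) == la (w j) + (n - w j)].

Lemma product_char (s : 'S_n) :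
  ((\prod_(i < l) wordchar n (pair_content n (al i)) s) * schar n n la s =
   \sum_(w : 'S_n) \sum_(M : contents | [&& balanced M, alt_jsum (fn M) w & acond (fn M)])
     (-1) ^+ odd_perm w * wordchar n (fun c => M c : nat) s)%R.
Proof.
rewrite /schar sum_cfunE mulr_sumr; apply: eq_bigr => w _.
rewrite sum_cfunE mulr_sumr.
have -> : (\prod_(i < l) wordchar n (pair_content n (al i)) s = #|mask_words s al l|%:R)%R.
  rewrite card_mask_words // natr_prod; apply: eq_bigr => i _.
  by rewrite wordcharE.
pose ka (M : contents) : {ffun 'I_n -> 'I_n.+1} := [ffun j : 'I_n => inord (jsum n K (fn M) j)].
have kaE (M : contents) (j : 'I_n) : balanced M -> ka M j = jsum n K (fn M) j :> nat.
  move=> /eqP sM; rewrite ffunE inordK // ltnS.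
  have : \sum_(0 <= j < n) jsum n K (fn M) j = n by rewrite sum_jsum sum_fn_nat.
  by rewrite big_mkord (bigD1 j) //=; lia.
rewrite [RHS](partition_big ka (alternant_content la w)) /=; last first.
  by move=> M /and3P[sM /forallP altM _]; apply/forallP => j; rewrite kaE.
apply: eq_bigr => kap Hk; rewrite cfunE wordcharE mulrCA -natrM mulnC.
have -> : fixed_words (fun k : 'I_n => kap k : nat) s = fixed_words (fun k : 'I_n => fn kap k) s.
  by apply/setP => f; rewrite !inE; congr andb; apply: eq_forallb => k; rewrite fnE.
rewrite prod_words natr_sum mulr_sumr; apply: eq_big => [M|M _]; last by rewrite wordcharE.
rewrite -!andbA; case sM: (balanced M) => //=; case aM: (acond (fn M)); rewrite ?andbF //=.
rewrite !andbT; apply/forallP/andP => [jM|[_ /eqP <-] j]; last by rewrite fnE kaE.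
have eM : ka M = kap by apply/ffunP => j; apply/val_inj; rewrite /= kaE // -fnE; apply/eqP.
split; last exact/eqP.
by apply/forallP => j; rewrite -kaE // eM; apply: (forallP Hk).
Qed.

Section Coef.
Variable p : nat -> nat.
Hypothesis sum_p : \sum_(k < n) p k = n.
Local Notation Mx := 'M['I_n.+1]_(N, n).

(* Row [S * n + r], column [j] of a matrix is the number of cells in row [r] of the
   filling with label [(S, j)]; [blocktr] lists these multiplicities by label and row. *)
Definition colstrict (t : nat -> nat -> nat) := dominant N n (fun=> 0) (blocktr n t).

Definition rsums (T : Mx) := rowsum n (entry T).

(** The rows of [T] are ordered by [S] and then by tableau row, which is the reading order, so
    [dominant] is the lattice condition. [jcond] prescribes the row lengths [p], and [acond] the
    unbarred content. *)
Definition lr_matrices : {set Mx} :=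
  [set T : Mx | [&& colstrict (entry T), dominant N n (fun=> 0) (entry T),
     [forall k : 'I_n, colsum N (entry T) k == la k], jcond (rsums T) p & acond (rsums T)]].

Lemma entry_le m L b (T : 'M['I_b.+1]_(m, L)) i k : entry T i k <= b.
Proof. by rewrite /entry; do 2 case: insubP => // *; rewrite -ltnS ltn_ord. Qed.

Definition blockM (T : Mx) : Mx := matrix_of N n n (blocktr n (entry T)).

Lemma entry_blockM T c r : c < N -> r < n -> entry (blockM T) c r = blocktr n (entry T) c r.
Proof. by move=> lt_c lt_r; rewrite entry_matrix_of // entry_le. Qed.

Lemma blockMK : involutive blockM.
Proof.
move=> T; apply: entry_inj => c r lt_c lt_r; rewrite entry_blockM // {1}/blocktr.
have lt1 : c %/ n * n + r < N by apply: block_lt => //; apply: div_lt.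
by rewrite entry_blockM ?ltn_mod // -[RHS](@blocktrK n K).
Qed.

Lemma sum_rsums (T : Mx) : jcond (rsums T) p -> \sum_(0 <= c < N) rsums T c = n.
Proof.
move=> /forallP jT; rewrite -sum_jsum // -[RHS]sum_p big_mkord.
by apply: eq_bigr => j _; apply/eqP.
Qed.

Lemma pchain_block t r S j : r < n -> j <= n ->
  pchain (fun=> 0) (fun r c => blocktr n t c r) r (S * n + j) =
  \sum_(0 <= S' < S) rowsum n t (S' * n + r) + \sum_(0 <= j' < j) t (S * n + r) j'.
Proof.
move=> lt_r le_j; rewrite /pchain add0n (@big_cat_nat _ _ _ (S * n)) ?leq_addr //=.
rewrite (sum_blocks n S); congr addn.
  apply: eq_bigr => S' _; rewrite /rowsum !big_nat; apply: eq_bigr => j' /andP[_ lt_j'].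
  by rewrite /blocktr block_div ?block_mod.
rewrite -{1}[S * n]add0n big_addn addKn !big_nat; apply: eq_bigr => j' /andP[_ lt_j'].
by rewrite addnC /blocktr block_div ?block_mod //; lia.
Qed.

(** The cells with unbarred part [S] form a skew tableau whose inner shape is occupied by the cells
    with smaller sets. The first term separates the skew shapes for different [S], so that a single
    [interlacing] governs all of them. *)
Definition block_rho (R : nat -> nat) i :=
  (K - i %/ n) * n + \sum_(0 <= S < i %/ n) R (S * n + i %% n).

(** Inside a block both conditions are the same inequality up to a common shift. From the last row
    of a block to the first row of the next one the offset [n] suffices, because tableau row 0 has
    length at most [n]. *)
Lemma block_interlacing (T : Mx) (R : nat -> nat) :
  (forall c, c < N -> rsums T c = R c) -> jcond (rsums T) p ->
  interlacing N n (block_rho R) (entry T) = colstrict (entry T).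
Proof.
move=> eR jT; set t := entry T.
have pE S r j : S < K -> r < n -> j <= n -> pchain (block_rho R) t (S * n + r) j =
    (K - S) * n + pchain (fun=> 0) (fun r c => blocktr n t c r) r (S * n + j).
  move=> lt_S lt_r le_j; rewrite pchain_block // /pchain /block_rho block_div ?block_mod // -addnA.
  congr (_ + (_ + _)); rewrite !big_nat; apply: eq_bigr => S' /andP[_ lt_S'].
  by rewrite -eR //; apply: block_lt => //; apply: ltn_trans lt_S' lt_S.
apply/interlacingP/interlacingP => H.
  move=> r c lt_r lt_c; have lt_S := div_lt n_gt0 lt_c.
  have lt_j : c %% n < n by rewrite ltn_mod.
  have lt1 : (c %/ n * n + r).+1 < N by rewrite -addnS; apply: block_lt.
  have := H _ _ lt1 lt_j; rewrite -addnS (pE _ r.+1 _ lt_S lt_r lt_j).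
  by rewrite (pE _ r _ lt_S (ltnW lt_r) (ltnW lt_j)) addnS -divn_eq leq_add2l.
move=> i c lt_i lt_c; have lt_iN : i < N by apply: ltnW.
have lt_S := div_lt n_gt0 lt_iN; have lt_r : i %% n < n by rewrite ltn_mod.
have e2 := pE _ _ _ lt_S lt_r (ltnW lt_c); rewrite -divn_eq in e2.
have [lt_r1|ge_r1] := ltnP (i %% n).+1 n.
  have e1 : i.+1 = i %/ n * n + (i %% n).+1 by rewrite addnS -divn_eq.
  rewrite e2 e1 (pE _ _ _ lt_S lt_r1 lt_c) leq_add2l addnS.
  by apply: H => //; apply: block_lt.
have ei : i.+1 = (i %/ n).+1 * n + 0.
  by rewrite addn0 mulSnr {1}(divn_eq i n); lia.
have lt_S1 : (i %/ n).+1 < K.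
  by move: lt_i; rewrite ei addn0 ltn_mul2r n_gt0.
rewrite e2 ei (pE _ _ _ lt_S1 n_gt0 lt_c).
apply: leq_trans (leq_addr _ _).
have -> : K - i %/ n = (K - (i %/ n).+1).+1 by lia.
rewrite [X in _ <= X]mulSnr leq_add2l pchain_block //.
have le1 : \sum_(0 <= j' < c.+1) t ((i %/ n).+1 * n + 0) j' <= rowsum n t ((i %/ n).+1 * n + 0).
  by rewrite /rowsum (@big_cat_nat _ _ _ c.+1 0 n) //= leq_addr.
apply: leq_trans (leq_add (leqnn _) le1) _.
have -> : \sum_(0 <= S' < (i %/ n).+1) rowsum n t (S' * n + 0) + rowsum n t ((i %/ n).+1 * n + 0)
   = \sum_(0 <= S' < (i %/ n).+2) rowsum n t (S' * n + 0) by rewrite [RHS]big_nat_recr.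
apply: (@leq_trans (jsum n K (rsums T) 0)).
  by rewrite /jsum (@big_cat_nat _ _ _ (i %/ n).+2 0 K) //= leq_addr.
have /forallP/(_ (Ordinal n_gt0))/eqP /= -> := jT.
by rewrite -[X in _ <= X]sum_p (bigD1 (Ordinal n_gt0)) //= leq_addr.
Qed.

Lemma eq_jcond m m' q : (forall c, c < N -> m c = m' c) -> jcond m q = jcond m' q.
Proof. by move=> e; apply: eq_forallb => j; rewrite (@eq_jsum n K n_gt0 m m'). Qed.

Lemma eq_acond m m' : (forall c, c < N -> m c = m' c) -> acond m = acond m'.
Proof. by move=> e; apply: eq_forallb => i; rewrite (@eq_asum n K n_gt0 l m m'). Qed.

Definition rcont (T : Mx) : contents := [ffun c : 'I_N => inord (rsums T c)].

Lemma rcontE (T : Mx) c : \sum_(0 <= c < N) rsums T c = n -> c < N -> fn (rcont T) c = rsums T c.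
Proof.
move=> sT lt_c; rewrite (fnE (rcont T) (Ordinal lt_c)) ffunE inordK //= ltnS.
by move: sT; rewrite big_mkord (bigD1 (Ordinal lt_c)) //=; lia.
Qed.

Lemma rcont_eq (T : Mx) (M : contents) :
  has_rowsums N n (fn M) (entry T) -> (\sum_(0 <= c < N) rsums T c = n -> rcont T = M).
Proof.
move=> /forallP rT sT; apply/ffunP => c; apply/val_inj.
by rewrite /= -!fnE rcontE // -(eqP (rT c)).
Qed.

Lemma sum_rsums_col (T : Mx) q : \sum_(k < n) q k = n ->
  [forall k : 'I_n, colsum N (entry T) k == q k] -> \sum_(0 <= c < N) rsums T c = n.
Proof.
move=> sum_q /forallP cT; rewrite -[RHS]sum_q /rsums /rowsum exchange_big /= big_mkord.
by apply: eq_bigr => k _; apply/eqP/cT.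
Qed.

Let Q (T : Mx) := [&& colstrict (entry T), jcond (rsums T) p & acond (rsums T)].

(** Kostka matrices list multiplicities by code and tableau row. [blockM] converts them to matrices
    with rows ([S], [r]) and columns [j], where the alternating condition on the letters [j] becomes
    a weight. *)
Lemma alternating_coef (w : 'S_n) :
  (\sum_(M : contents | [&& balanced M, alt_jsum (fn M) w & acond (fn M)])
     (-1) ^+ odd_perm w * #|kostka_mx n n N (fn M) p|%:R =
   \sum_(T : Mx | Q T && has_weight N (fun=> 0%N) la (entry T) w) (-1) ^+ odd_perm w :> algC)%R.
Proof.
rewrite [RHS](reindex_inj (inv_inj blockMK)) /=.
have rsB T c : c < N -> rsums (blockM T) c = rowsum n (blocktr n (entry T)) c.
  move=> lt_c; rewrite /rsums /rowsum !big_nat; apply: eq_bigr => r /andP[_ lt_r].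
  by rewrite entry_blockM.
have colB T j : j < n -> colsum N (entry T) j = jsum n K (rsums (blockM T)) j.
  move=> lt_j; rewrite (@eq_jsum n K n_gt0 _ (rowsum n (blocktr n (entry T)))) ?jsum_rowsum_blocktr //.
  exact: rsB.
have E1 T : colstrict (entry (blockM T)) = dominant N n (fun=> 0) (entry T).
  apply: eq_interlacing => r c lt_r lt_c; rewrite {1}/blocktr entry_blockM ?ltn_mod //.
    by rewrite -[RHS](@blocktrK n K).
  by apply: block_lt => //; apply: div_lt.
have E2 T : jcond (rsums (blockM T)) p = [forall k : 'I_n, colsum N (entry T) k == p k].
  by apply: eq_forallb => j; rewrite colB.
have E3 T : acond (rsums (blockM T)) = acond (rsums T).
  apply: eq_forallb => i; rewrite (@eq_asum n K n_gt0 l _ (rowsum n (blocktr n (entry T)))); last exact: rsB.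
  by rewrite asum_rowsum_blocktr.
have E4 T : has_weight N (fun=> 0) la (entry (blockM T)) w = alt_jsum (rsums T) w.
  by apply: eq_forallb => j; rewrite add0n colB // blockMK.
have eq_alt m m' : (forall c, c < N -> m c = m' c) -> alt_jsum m w = alt_jsum m' w.
  by move=> e; apply: eq_forallb => j; rewrite (@eq_jsum n K n_gt0 m m').
under [RHS]eq_bigl => T do rewrite /Q E1 E2 E3 E4.
rewrite [RHS](partition_big rcont (fun M => [&& balanced M, alt_jsum (fn M) w & acond (fn M)])) /=; last first.
  move=> T /andP[/and3P[_ cT aT] wT]; have sT := sum_rsums_col sum_p cT.
  rewrite (@eq_alt _ (rsums T)) ?(@eq_acond _ (rsums T)) ?wT ?aT ?andbT; try by move=> c; apply: rcontE.
  apply/eqP; rewrite -sum_fn_nat -[RHS]sT !big_nat; apply: eq_bigr => c /andP[_ lt_c].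
  exact: rcontE.
apply: eq_bigr => M /and3P[sM wM aM]; rewrite -sum1_card natr_sum mulr_sumr.
apply: eq_big => [T|T _]; last by rewrite mulr1.
rewrite inE; case dT: (dominant N n (fun=> 0) (entry T)); last by rewrite andbF.
case cT: [forall k : 'I_n, colsum N (entry T) k == p k]; last by rewrite /= !andbF.
have sT := sum_rsums_col sum_p cT; rewrite /= !andbT.
apply/idP/andP => [rT|[_ /eqP <-]]; last first.
  by apply/forallP => c; rewrite rcontE.
have eM := rcont_eq rT sT; have eqM c : c < N -> rsums T c = fn M c by move=> lt_c; rewrite -eM rcontE.
by rewrite (@eq_acond _ (fn M)) // (@eq_alt _ (fn M)) // wM aM eM eqxx.
Qed.

(** Once the row sums [R] are fixed, so are the skew shapes of all blocks, and the signed sum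
    applies with inner shape [block_rho (fn R)]. *)
Lemma coef_lr_matrices :
  (\sum_(w : 'S_n) \sum_(M : contents | [&& balanced M, alt_jsum (fn M) w & acond (fn M)])
     (-1) ^+ odd_perm w * #|kostka_mx n n N (fn M) p|%:R = #|lr_matrices|%:R :> algC)%R.
Proof.
under eq_bigr => w _ do rewrite alternating_coef.
pose Rok (R : contents) := [&& balanced R, jcond (fn R) p & acond (fn R)].
have rokT T : Q T -> Rok (rcont T) /\ \sum_(0 <= c < N) rsums T c = n.
  move=> /and3P[_ jT aT]; have sT := sum_rsums jT; split=> //.
  rewrite /Rok (@eq_jcond _ (rsums T)) ?(@eq_acond _ (rsums T)) ?jT ?aT ?andbT; try by move=> c; apply: rcontE.
  apply/eqP; rewrite -sum_fn_nat -[RHS]sT !big_nat; apply: eq_bigr => c /andP[_ lt_c].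
  exact: rcontE.
transitivity (\sum_(w : 'S_n) \sum_(R | Rok R)
   \sum_(T : Mx | tabP (block_rho (fn R)) (fn R) T && has_weight N (fun=> 0%N) la (entry T) w)
    (-1) ^+ odd_perm w : algC)%R.
  apply: eq_bigr => w _; rewrite (partition_big rcont Rok) /=; last first.
    by move=> T /andP[/rokT[]].
  apply: eq_bigr => R /and3P[sR jR aR]; apply: eq_bigl => T.
  rewrite andbAC; congr andb; rewrite /tabP; apply/andP/andP => [[QT /eqP eR]|[rT iT]].
    have [_ sT] := rokT T QT; have eqR c : c < N -> rsums T c = fn R c.
      by move=> lt_c; rewrite -eR rcontE.
    case/and3P: QT => cT jT aT; rewrite (block_interlacing eqR jT) cT; split=> //.
    by apply/forallP => c; apply/eqP/eqR.
  have eqR c : c < N -> rsums T c = fn R c.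
    by move=> lt_c; apply/eqP; apply: (forallP rT (Ordinal lt_c)).
  have jT : jcond (rsums T) p by rewrite (@eq_jcond _ (fn R)).
  rewrite /Q -(block_interlacing eqR jT) iT jT (@eq_acond _ (fn R)) // aR; split=> //.
  by apply/eqP; apply: rcont_eq => //; apply: sum_rsums.
rewrite exchange_big /= -sum1_card natr_sum.
rewrite [RHS](partition_big rcont Rok) /=; last first.
  move=> T; rewrite inE => /and5P[c1 _ _ c4 c5]; have QT : Q T by apply/and3P.
  by case: (rokT T QT).
apply: eq_bigr => R /and3P[sR jR aR].
have leR c : c < N -> fn R c <= n by move=> lt_c; rewrite /fn; case: insubP => // c' _ _; rewrite -ltnS ltn_ord.
rewrite (signed_sum_dominant (mu := fun=> 0) (block_rho (fn R)) leR (fun _ _ => leqnn _) la_dec algC).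
rewrite -sum1_card natr_sum; apply: eq_bigl => T; rewrite !inE.
apply/and3P/andP => [[/andP[rT iT] dT cT]|[/and5P[c1 c2 c3 c4 c5] /eqP eR]].
  have eqR c : c < N -> rsums T c = fn R c.
    by move=> lt_c; apply/eqP; apply: (forallP rT (Ordinal lt_c)).
  have jT : jcond (rsums T) p by rewrite (@eq_jcond _ (fn R)).
  split; last by apply/eqP; apply: rcont_eq => //; apply: sum_rsums.
  by apply/and5P; split=> //; [rewrite -(block_interlacing eqR jT) | rewrite (@eq_acond _ (fn R))].
have QT : Q T by apply/and3P.
have [_ sT] := rokT T QT; have eqR c : c < N -> rsums T c = fn R c.
  by move=> lt_c; rewrite -eR rcontE.
split=> //; rewrite /tabP (block_interlacing eqR c4) c1 andbT.
by apply/forallP => c; apply/eqP/eqR.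
Qed.
End Coef.

Lemma product_expansion (s : 'S_n) :
  ((\prod_(i < l) wordchar n (pair_content n (al i)) s) * schar n n la s =
   \sum_(p in partitions n n) #|lr_matrices (fn p)|%:R * schar n n (fn p) s)%R.
Proof.
rewrite product_char.
transitivity (\sum_(w : 'S_n) \sum_(M : contents | [&& balanced M, alt_jsum (fn M) w & acond (fn M)])
   \sum_(p in partitions n n)
     ((-1) ^+ odd_perm w * #|kostka_mx n n N (fn M) (fn p)|%:R) * schar n n (fn p) s)%R.
  apply: eq_bigr => w _; apply: eq_bigr => M /and3P[sM _ _].
  have eM : wordchar n (fun c => M c : nat) = wordchar n (fun c : 'I_N => fn M c).
    by apply: eq_wordchar => c; rewrite fnE.
  have sM' : \sum_(c < N) fn M c = n by rewrite -[RHS](eqP sM); apply: eq_bigr => c _; rewrite fnE.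
  rewrite eM (wordchar_young n_gt0 (leqnn n) sM').
  rewrite sum_cfunE mulr_sumr; apply: eq_bigr => q _.
  by rewrite cfunE mulrA.
under eq_bigr => w _ do rewrite exchange_big /=.
rewrite exchange_big /=; apply: eq_bigr => q Pq.
rewrite -coef_lr_matrices ?sum_fn // mulr_suml; apply: eq_bigr => w _.
by rewrite mulr_suml.
Qed.
End Coefficient.

(** * Labels and tableaux *)

Lemma leq_letterF i j : (((false, i) : letter) <= (false, j))%O = (i <= j).
Proof. by rewrite lexi_pair lexx /= leEnat. Qed.

Lemma leq_letterT i j : (((true, i) : letter) <= (true, j))%O = (i <= j).
Proof. by rewrite lexi_pair lexx /= leEnat. Qed.

Lemma leq_letterFT i j : (((false, i) : letter) <= (true, j))%O.
Proof. by rewrite lexi_pair. Qed.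

Lemma leq_letterTF i j : (((true, i) : letter) <= (false, j))%O = false.
Proof. by rewrite lexi_pair. Qed.

Definition letter_leE := (leq_letterF, leq_letterT, leq_letterFT, leq_letterTF).

Definition mask_label (l S : nat) : label := [seq ((true, i) : letter) | i <- mask_set l S].

Definition bar_tail (j : nat) : seq letter :=
  if j is j'.+1 then [:: ((false, j') : letter)] else [::].

(* The letter bar(j) is at [c %% n = j], where [c %% n = 0] means no barred letter,
   and the unbarred part is given by the bitmask [c %/ n]. *)
Definition code_label (n l c : nat) : label := mask_label l (c %/ n) ++ bar_tail (c %% n).

(** Comparing sets from the largest element down is comparing bitmasks. The tail [B] has to be
    barred so that it stays below any further unbarred letter of the larger set. *)
Lemma mask_label_lt l S S' (B B' : seq letter) : all barred B -> S < S' -> S' < 2 ^ l ->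
  ((mask_label l S ++ B : label) < (mask_label l S' ++ B' : label))%O.
Proof.
move=> bB; elim: l S S' => [|l IH] S S' lt_S; first by case: S' lt_S.
rewrite expnS mul2n -addnn => lt_S'.
rewrite /mask_label /=; have [le'|lt'] := leqP (2 ^ l) S'; last first.
  by rewrite leqNgt (ltn_trans lt_S lt') /=; apply: IH.
have [le|lt] := leqP (2 ^ l) S.
  by rewrite /= ltxi_cons lexx /=; apply: IH; lia.
case eM: (mask_set l S) => [|i s] /=.
  case: B bB {IH} => [|[[] j] B] //= _.
rewrite ltxi_cons !letter_leE; have : i < l by apply: (@mask_set_lt l S); rewrite eM inE eqxx.
by move=> lt_i; rewrite ltnW //= leqNgt lt_i.
Qed.

(** Reverse lex order becomes the order of codes: first the sets are compared, then the barred
    letters, where residue 0 puts a missing barred letter first. *)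
Lemma code_label_lt n l c c' : c < c' -> c' < 2 ^ l * n ->
  (code_label n l c < code_label n l c')%O.
Proof.
case: n => [|n]; first by rewrite muln0.
move=> lt_c lt_c'; have le_d := leq_div2r n.+1 (ltnW lt_c).
have b_tail j : all barred (bar_tail j) by case: j.
have [e|ne] := eqVneq (c %/ n.+1) (c' %/ n.+1); last first.
  apply: mask_label_lt => //; first by rewrite ltn_neqAle ne.
  by rewrite ltn_divLR.
rewrite /code_label e /mask_label; have : c %% n.+1 < c' %% n.+1.
  by have := divn_eq c n.+1; have := divn_eq c' n.+1; rewrite e; lia.
elim: (mask_set l (c' %/ n.+1)) => [|i s IH] /= lt_m; last first.
  by rewrite ltxi_cons lexx /=; apply: IH.
case: (c %% _) (c' %% _) lt_m => [|j] [|j'] //=; rewrite ltnS => lt_j.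
by rewrite ltxi_cons !letter_leE ltnW //= leqNgt lt_j.
Qed.

Lemma code_label_le n l : {in gtn (2 ^ l * n) &, {mono code_label n l : c c' / c <= c' >-> (c <= c')%O}}.
Proof.
move=> c c'; rewrite !inE => lt_c lt_c'; case: (ltngtP c c') => [lt|lt|->].
- by rewrite ltW // code_label_lt.
- by rewrite leNgt code_label_lt.
- by rewrite lexx.
Qed.

Lemma code_label_ltn n l : {in gtn (2 ^ l * n) &, {mono code_label n l : c c' / c < c' >-> (c < c')%O}}.
Proof.
move=> c c'; rewrite !inE => lt_c lt_c'.
by rewrite !ltnNge ltNge code_label_le ?inE.
Qed.

Lemma code_label_inj n l : {in gtn (2 ^ l * n) &, injective (code_label n l)}.
Proof.
move=> c c' lt_c lt_c' e; apply/eqP; rewrite eqn_leq.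
by rewrite -!(@code_label_le n l) // e lexx.
Qed.

Lemma count_barred_mask l S : count barred (mask_label l S) = 0.
Proof. by rewrite /mask_label count_map; apply/eqP; rewrite eqn0Ngt -has_count; apply/hasPn. Qed.

Lemma mask_set_sorted l S : sorted gtn (mask_set l S).
Proof.
elim: l S => //= l IH S; case: ifP => // _ /=.
rewrite path_min_sorted //; apply/allP => i; exact: mask_set_lt.
Qed.

Lemma mask_set0 l : mask_set l 0 = [::].
Proof. by elim: l => //= l ->; rewrite leqn0 expn_eq0. Qed.

Lemma mask_set_uniq l S : uniq (mask_set l S).
Proof. by apply: sorted_uniq (mask_set_sorted l S); [move=> ? ? ?; lia | move=> ?; rewrite /= ltnn]. Qed.

Lemma unbarred_code n l c : unbarred_part (code_label n l c) = mask_label l (c %/ n).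
Proof.
rewrite /unbarred_part /code_label filter_cat.
have -> : [seq x <- bar_tail (c %% n) | ~~ barred x] = [::] by case: (c %% n).
by rewrite cats0; apply/all_filterP/allP => x /mapP[i _ ->].
Qed.

Lemma barred_code n l c :
  barred_indices (code_label n l c) = if c %% n is j.+1 then [:: j] else [::].
Proof.
rewrite /barred_indices /code_label filter_cat.
have -> : [seq x <- mask_label l (c %/ n) | barred x] = [::].
  by apply/eqP; rewrite -size_eq0 size_filter count_barred_mask.
by case: (c %% n).
Qed.

Lemma count_code_bar n l c k :
  count_mem ((false, k) : letter) (code_label n l c) = (c %% n == k.+1).
Proof.
rewrite count_cat; have -> : count_mem ((false, k) : letter) (mask_label l (c %/ n)) = 0.
  by rewrite count_map; apply/eqP; rewrite eqn0Ngt -has_count; apply/hasPn.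
by case: (c %% n) => //= j; rewrite addn0 xpair_eqE eqxx eqSS.
Qed.

Lemma count_code_mask n l c i :
  count_mem ((true, i) : letter) (code_label n l c) = (i \in mask_set l (c %/ n)).
Proof.
rewrite count_cat; have -> : count_mem ((true, i) : letter) (bar_tail (c %% n)) = 0.
  by case: (c %% n).
rewrite addn0 count_map -(count_uniq_mem _ (mask_set_uniq _ _)).
by apply: eq_count => k /=; rewrite xpair_eqE eqxx.
Qed.

Lemma all_barred_code n l c : c < 2 ^ l * n -> all barred (code_label n l c) = (c < n).
Proof.
case: n => [|n]; first by rewrite muln0.
move=> lt_c; have [lt_cn|le_nc] := ltnP c n.+1.
  by rewrite /code_label divn_small // /mask_label mask_set0 /=; case: (c %% _).
rewrite /code_label all_cat; apply/negbTE/negP => /andP[+ _].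
have d_gt0 : 0 < c %/ n.+1 by rewrite divn_gt0.
have /(@mask_label_lt l 0 (c %/ n.+1) [::] [::] isT d_gt0) : c %/ n.+1 < 2 ^ l by rewrite ltn_divLR.
rewrite /mask_label mask_set0 /= cats0 ltxi0s.
by case: (mask_set l _).
Qed.

Lemma is_label_code n l c : 0 < c -> c < 2 ^ l * n -> is_label (code_label n l c).
Proof.
move=> c_gt0 lt_c; have := code_label_lt c_gt0 lt_c.
rewrite {1}/code_label div0n mod0n /mask_label mask_set0 /= ltxi0s /is_label => -> /=.
apply/andP; split; last first.
  by rewrite /code_label count_cat count_barred_mask; case: (c %% n).
rewrite /code_label /mask_label.
have := mask_set_sorted l (c %/ n); case: (mask_set _ _) => [|i s] /=; first by case: (c %% n).
rewrite cat_path path_map => ps; apply/andP; split.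
  apply: sub_path ps => x y /= lt_y.
  by change (((true, y) : letter) <= (true, x))%O; rewrite letter_leE ltnW.
case: (c %% n) => //= j; rewrite andbT last_map.
by change (((false, j) : letter) <= (true, last i s))%O; rewrite letter_leE.
Qed.

Lemma uniq_code n l c : uniq (code_label n l c : seq letter).
Proof.
rewrite cat_uniq map_inj_uniq ?mask_set_uniq /=; last by move=> ? ? [].
case: (c %% n) => //= j; rewrite orbF andbT; apply/negP => /mapP[i _ //].
Qed.

Lemma mask_label_surj l (M : seq letter) :
  sorted >=%O M -> uniq M -> (forall i, ((true, i) : letter) \in M -> i < l) ->
  exists2 S, S < 2 ^ l & M = mask_label l S ++ [seq x <- M | barred x].
Proof.
elim: l M => [|l IH] M sM uM ltM.
  exists 0 => //=; symmetry; apply/all_filterP/allP => -[[] i] // /ltM; lia.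
have [hl|nl] := boolP (((true, l) : letter) \in M); last first.
  have [|S lt_S eM] := IH M sM uM.
    by move=> i iM; have := ltM i iM; rewrite ltnS leq_eqVlt => /predU1P[ei|//]; rewrite -ei iM in nl.
  exists S; first by rewrite expnS; lia.
  by rewrite /mask_label /= leqNgt lt_S /= {1}eM.
case: M sM uM ltM hl => [|x M] //= sM /andP[nx uM] ltM hl.
have ex : x = (true, l).
  move: hl; rewrite inE => /predU1P[//|hl]; move: sM; rewrite path_sortedE; last exact: ge_trans.
  case/andP=> /allP/(_ _ hl) + _; case: x nx ltM => -[] i nx ltM.
    move=> h; have {h} : (((true, l) : letter) <= (true, i))%O by exact: h.
    rewrite letter_leE => le_i; have := ltM i; rewrite inE eqxx => /(_ isT) lt_i.
    by congr pair; lia.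
  by move=> h; have {h} : (((true, l) : letter) <= (false, i))%O by exact: h.
subst x.
have [|i iM|S lt_S eM] := IH M _ uM.
- exact: path_sorted sM.
- have := ltM i; rewrite inE iM orbT => /(_ isT); rewrite ltnS leq_eqVlt => /predU1P[ei|//].
  by rewrite -ei iM in nx.
exists (2 ^ l + S); first by rewrite expnS; lia.
by rewrite /mask_label /= leq_addr addKn /= {1}eM.
Qed.

Lemma code_label_surj n l (M : label) : is_label M -> uniq (M : seq letter) ->
  (forall i, ((true, i) : letter) \in (M : seq letter) -> i < l) ->
  (forall i, ((false, i) : letter) \in (M : seq letter) -> i.+1 < n) -> 0 < n ->
  exists2 c, 0 < c < 2 ^ l * n & M = code_label n l c.
Proof.
move=> /and3P[nM sM cM] uM lt1 lt2 n_gt0.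
have [S lt_S eM] := mask_label_surj sM uM lt1.
have [j lt_j ej] : exists2 j, j < n & [seq x <- (M : seq letter) | barred x] = bar_tail j.
  move: cM lt2; rewrite -size_filter.
  case eB: [seq x <- (M : seq letter) | barred x] => [|x [|y s]] //= _ lt2; first by exists 0.
  have : x \in [seq x <- (M : seq letter) | barred x] by rewrite eB inE.
  rewrite mem_filter; case: x {eB} => -[] j //= jM.
  by exists j.+1 => //; apply: lt2.
have ec : M = code_label n l (S * n + j).
  by rewrite /code_label block_div // block_mod // {1}eM ej.
exists (S * n + j) => //; rewrite block_lt // andbT lt0n.
apply: contraNneq nM => e0; rewrite ec e0 /code_label div0n mod0n /mask_label mask_set0.
by [].
Qed.

(** * Lattice words and strict columns as counting conditions *)

Lemma sorted_geq_split j v : sorted geq v ->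
  v = [seq x <- v | j < x] ++ [seq x <- v | x <= j].
Proof.
elim: v => //= x v IH p; have [lt|le] := ltnP j x; first by rewrite /= -IH //; apply: path_sorted p.
move: p; rewrite path_sortedE; last by move=> ? ? ?; lia.
case/andP=> /allP ge_x _; have -> : [seq y <- v | j < y] = [::].
  by apply/eqP; rewrite -size_eq0 size_filter eqn0Ngt -has_count; apply/hasPn => y /ge_x /=; lia.
by rewrite /=; congr cons; symmetry; apply/all_filterP/allP => y /ge_x /=; lia.
Qed.

Lemma leq_count_take (w : seq nat) (P : pred nat) k : count P (take k w) <= count P w.
Proof. by rewrite -{2}(cat_take_drop k w) count_cat leq_addr. Qed.

(** In a weakly decreasing block the critical prefix for [j] stops just before the letters [<= j]:
    it contains every [j+1] and no [j] of the block. *)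
Lemma lattice_word_cat w v : sorted geq v ->
  lattice_word (w ++ v) <->
  lattice_word w /\ forall j, count_mem j.+1 (w ++ v) <= count_mem j w.
Proof.
move=> sv; split=> [lw|[lw cv] k j]; last first.
  rewrite take_cat; case: ltnP => [_|le_k]; first exact: lw.
  rewrite !count_cat; apply: leq_trans (leq_addr _ _); apply: leq_trans (cv j).
  by rewrite count_cat leq_add2l leq_count_take.
split=> [k j|j].
  have := lw (minn k (size w)) j; rewrite take_cat; case: ltnP => [lt|ge].
    by rewrite (_ : minn k (size w) = k) //; lia.
  have -> : minn k (size w) - size w = 0 by lia.
  by rewrite take0 cats0 take_oversize //; lia.
have := lw (size w + size [seq x <- v | j < x]) j.
rewrite take_cat ltnNge leq_addr /= addKn.
have -> : take (size [seq x <- v | j < x]) v = [seq x <- v | j < x].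
  by rewrite {2}(sorted_geq_split j sv) take_size_cat.
rewrite !count_cat !count_filter.
have -> : count (predI (pred1 j.+1) (leq j.+1)) v = count_mem j.+1 v.
  by apply: eq_count => x /=; lia.
have -> : count (predI (pred1 j) (leq j.+1)) v = count pred0 v.
  by apply: eq_count => x /=; lia.
by rewrite count_pred0 addn0.
Qed.

Lemma count_flatten_sum (T : Type) (P : pred T) (b : seq (seq T)) :
  count P (flatten b) = \sum_(0 <= i < size b) count P (nth [::] b i).
Proof.
elim: b => [|s b IH] /=; first by rewrite big_geq.
by rewrite count_cat IH big_nat_recl.
Qed.

Lemma lattice_word_flatten (b : seq (seq nat)) : all (sorted geq) b ->
  lattice_word (flatten b) <->
  forall i j, i < size b ->
    \sum_(0 <= i' < i.+1) count_mem j.+1 (nth [::] b i') <=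
    \sum_(0 <= i' < i) count_mem j (nth [::] b i').
Proof.
elim/last_ind: b => [|b v IH]; first by move=> _; split.
rewrite all_rcons => /andP[sv sb]; rewrite flatten_rcons.
have nthb (m : nat) P : m <= size b ->
   \sum_(0 <= i' < m) count P (nth [::] (rcons b v) i') = \sum_(0 <= i' < m) count P (nth [::] b i').
  move=> le_m; rewrite !big_nat; apply: eq_bigr => i' /andP[_ lt_i'].
  by rewrite nth_rcons (leq_trans lt_i' le_m).
have sumb P : \sum_(0 <= i' < (size b).+1) count P (nth [::] (rcons b v) i') = count P (flatten b ++ v).
  rewrite big_nat_recr // nthb //=.
  by rewrite nth_rcons ltnn eqxx count_cat count_flatten_sum.
have {IH} IH := IH sb; split.
  case/(lattice_word_cat _ sv) => /IH lb lv i j; rewrite size_rcons ltnS leq_eqVlt.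
  case/predU1P=> [->|lt_i]; last by rewrite !nthb ?(ltnW lt_i) //; apply: lb.
  by rewrite sumb nthb // -count_flatten_sum.
move=> H; apply/(lattice_word_cat _ sv); split=> [|j].
  apply/IH => i j lt_i; have := H i j; rewrite size_rcons => /(_ (ltnW lt_i)).
  by rewrite !nthb // ltnW.
by have := H (size b) j; rewrite size_rcons => /(_ (ltnSn _)); rewrite sumb nthb // -count_flatten_sum.
Qed.

(** Brings strictness of columns into the form of [interlacing]. [zip] stops at the shorter list, so
    the size hypothesis ensures that each entry of the upper row is compared. *)
Lemma zip_ltnP (s s' : seq nat) : sorted leq s -> sorted leq s' -> size s' <= size s ->
  reflect (forall c, count (fun x => x <= c) s' <= count (fun x => x < c) s)
    (all (fun p => p.1 < p.2) (zip s s')).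
Proof.
elim: s s' => [|x s IH] [|x' s'] //=; try by constructor.
move=> ps ps' le_s; have := ps; rewrite path_sortedE; last exact: leq_trans.
have := ps'; rewrite path_sortedE; last exact: leq_trans.
case/andP=> /allP ge_x' ss' /andP[/allP ge_x ss].
apply: (iffP andP) => [[lt_x /(IH s' ss ss' le_s) H] c|H].
  have := H c; case: (leqP x' c) => [le_x'|]; case: (ltnP x c) => //; lia.
have lt_x : x < x'.
  have := H x'; rewrite leqnn /=; case: (ltnP x x') => // le_x'.
  rewrite [X in 0 + X](_ : _ = 0) //; apply/eqP; rewrite eqn0Ngt -has_count.
  by apply/hasPn => y /ge_x; lia.
split=> //; apply/(IH s' ss ss' le_s) => c; have := H c.
case: (leqP x' c) => [le_x'|gt_x'].
  by rewrite (leq_trans lt_x le_x').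
move=> _; rewrite [X in X <= _](_ : _ = 0) //; apply/eqP; rewrite eqn0Ngt -has_count.
by apply/hasPn => y /ge_x'; lia.
Qed.

(* The weakly increasing word on [1, ..., m - 1] with letter multiplicities [x];
   [x 0] is ignored. *)
Definition expand (m : nat) (x : nat -> nat) : seq nat :=
  flatten [seq nseq (x c) c | c <- iota 1 m.-1].

Lemma count_expand P m x : count P (expand m x) = \sum_(1 <= c < m) P c * x c.
Proof.
rewrite /expand count_flatten -map_comp sumnE big_map /index_iota subn1.
by apply: eq_bigr => c _; rewrite /= count_nseq.
Qed.

Lemma count_mem_expand m x c : 0 < c < m -> count_mem c (expand m x) = x c.
Proof.
move=> lt_c; rewrite count_expand (bigD1_seq c) ?mem_index_iota ?iota_uniq //= eqxx mul1n.
by rewrite big1 ?addn0 // => c' /negbTE ->.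
Qed.

Lemma mem_expand m x c : c \in expand m x -> 0 < c < m.
Proof.
by case/flatten_mapP=> c' lt_c' /nseqP[-> _]; move: lt_c'; rewrite mem_iota; lia.
Qed.

Lemma size_expand m x : size (expand m x) = \sum_(1 <= c < m) x c.
Proof. by rewrite -count_predT count_expand; apply: eq_bigr => c _; rewrite mul1n. Qed.

Lemma expand_sorted m x : sorted leq (expand m x).
Proof.
rewrite sorted_pairwise; last exact: leq_trans.
rewrite /expand; have := iota_sorted 1 m.-1; elim: (iota _ _) => //= c s IH.
rewrite path_sortedE; last exact: leq_trans.
case/andP=> /allP ge_c ss; rewrite pairwise_cat IH // andbT; apply/andP; split.
  apply/allrelP => y z /nseqP[-> _] /flatten_mapP[c' lt_c' /nseqP[-> _]]; exact: ge_c.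
rewrite -sorted_pairwise; last exact: leq_trans.
by elim: (x c) => //= k; case: k => //= k ->; rewrite leqnn.
Qed.

Lemma expand_count m s : sorted leq s -> {in s, forall c, 0 < c < m} ->
  expand m (fun c => count_mem c s) = s.
Proof.
move=> ss lt_s; apply: (sorted_eq leq_trans anti_leq) => //; first exact: expand_sorted.
apply/allP => c; rewrite mem_cat => c_in.
have lt_c : 0 < c < m by case/orP: c_in => [/mem_expand|/lt_s].
by rewrite /= count_mem_expand.
Qed.

Lemma eq_expand m x y : (forall c, 0 < c < m -> x c = y c) -> expand m x = expand m y.
Proof.
move=> e; congr flatten; apply/eq_in_map => c; rewrite mem_iota => lt_c.
by rewrite e //; lia.
Qed.

Lemma sum_nth_pad m (s : seq nat) : size s <= m -> \sum_(0 <= i < m) nth 0 s i = sumn s.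
Proof.
elim: s m => [|x s IH] m le_m /=; first by rewrite big1 // => i _; rewrite nth_nil.
by case: m le_m => // m le_m; rewrite big_nat_recl //= IH.
Qed.

Lemma sum_add_row m n (s : seq nat) : size s < m -> sumn s <= n ->
  \sum_(0 <= i < m) nth 0 (add_row n s) i = n.
Proof. by move=> lt_s le_s; rewrite sum_nth_pad //= subnK. Qed.

Lemma sum_expand m x (f : nat -> nat) :
  \sum_(c <- expand m x) f c = \sum_(1 <= c < m) f c * x c.
Proof.
rewrite /expand big_flatten big_map /index_iota subn1; apply: eq_bigr => c _.
by rewrite big_nseq iter_addn_0.
Qed.

Lemma count_flatten_nseq (T : eqType) (f : nat -> T) (s : seq nat) k : injective f ->
  count_mem (f k) (flatten [seq nseq (nth 0 s i) (f i) | i <- iota 0 (size s)]) = nth 0 s k.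
Proof.
move=> f_inj; rewrite count_flatten -map_comp sumnE big_map.
have [lt_k|le_k] := ltnP k (size s).
  rewrite (bigD1_seq k) ?mem_iota ?iota_uniq //= count_nseq /= eqxx mul1n.
  rewrite big1 ?addn0 // => i /negbTE ne; rewrite count_nseq /=.
  by rewrite (inj_eq f_inj) ne.
rewrite nth_default // big_seq big1 // => i; rewrite mem_iota => lt_i.
by rewrite /= count_nseq /= (inj_eq f_inj); case: eqP lt_i => [->|]; lia.
Qed.

Lemma count_flatten_nseq0 (T : eqType) (f : nat -> T) (s : seq nat) z : (forall i, f i != z) ->
  count_mem z (flatten [seq nseq (nth 0 s i) (f i) | i <- iota 0 (size s)]) = 0.
Proof.
move=> ne; rewrite count_flatten -map_comp sumnE big_map big1 // => i _.
by rewrite /= count_nseq /= (negbTE (ne i)).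
Qed.

Lemma count_content_bar la al k : count_mem ((false, k) : letter) (content la al) = nth 0 la k.
Proof.
rewrite count_cat (@count_flatten_nseq letter (fun i => (false, i))); last by move=> ? ? [].
by rewrite (@count_flatten_nseq0 letter (fun i => (true, i))) ?addn0.
Qed.

Lemma count_content_unbar la al i : count_mem ((true, i) : letter) (content la al) = nth 0 al i.
Proof.
rewrite count_cat (@count_flatten_nseq letter (fun i => (true, i))); last by move=> ? ? [].
by rewrite (@count_flatten_nseq0 letter (fun i => (false, i))).
Qed.

Lemma size_content la al : size (content la al) = sumn la + sumn al.
Proof.
have szf (f : nat -> letter) s : size (flatten [seq nseq (nth 0 s i) (f i) | i <- iota 0 (size s)]) = sumn s.
  rewrite size_flatten /shape -map_comp; congr sumn; apply: (@eq_from_nth _ 0).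
    by rewrite size_map size_iota.
  move=> i; rewrite size_map size_iota => lt_i.
  by rewrite (nth_map 0) ?size_iota //= size_nseq nth_iota.
by rewrite size_cat !szf.
Qed.

Definition letters (F : filling) : seq letter :=
  flatten [seq flatten (R : seq (seq letter)) | R <- F].

Lemma mem_letters (F : filling) R (M : label) z : R \in F -> M \in R -> z \in (M : seq letter) ->
  z \in letters F.
Proof. by move=> RF MR zM; apply/flattenP; exists (flatten (R : seq (seq letter))); [apply: map_f | apply/flattenP; exists M]. Qed.

Lemma cells_le_letters (F : filling) : all (all is_label) F ->
  sumn (shape F) <= size (letters F).
Proof.
move=> lF; rewrite /letters size_flatten /shape -map_comp.
elim: F lF => //= R F IH /andP[lR lF]; apply: leq_add; last exact: IH.
elim: R lR => //= M R IHR /andP[/and3P[nM _ _] lR].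
rewrite size_cat -add1n leq_add ?IHR //.
by rewrite lt0n size_eq0.
Qed.

Lemma mask_label_inj l S S' : S < 2 ^ l -> S' < 2 ^ l -> mask_label l S = mask_label l S' -> S = S'.
Proof.
move=> lt_S lt_S' e; case: (ltngtP S S') => // lt.
  by have := @mask_label_lt l S S' [::] [::] isT lt lt_S'; rewrite e ltxx.
by have := @mask_label_lt l S' S [::] [::] isT lt lt_S; rewrite e ltxx.
Qed.

Lemma all_zip_map_mono (A B : Type) (P : pred A) (f : A -> B) (r : rel A) (r' : rel B) s t :
  {in P &, {mono f : x y / r x y >-> r' x y}} -> all P s -> all P t ->
  all (fun p => r' p.1 p.2) (zip (map f s) (map f t)) = all (fun p => r p.1 p.2) (zip s t).
Proof.
move=> fr; elim: s t => [|x s IH] [|y t] //= /andP[Px Ps] /andP[Py Pt].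
by rewrite fr // IH.
Qed.

(** * Lattice set tableaux correspond to matrices *)

Section Tableaux.
Variables (n : nat) (la al ga : seq nat).
Local Notation l := (size al).
Local Notation K := (2 ^ l).
Local Notation N := (K * n).
Local Notation Mx := 'M['I_n.+1]_(N, n).
Local Notation lab := (code_label n l).
Local Notation p := (nth 0 (add_row n ga)).
Local Notation laN := (nth 0 (add_row n la)).
Hypothesis size_la : size la < n.
Hypothesis size_ga : size ga < n.
Hypothesis ga_part : sorted geq ga.
Hypothesis sum_ga : sumn ga <= n.
Hypothesis n_large : (sumn la + sumn al).*2 <= n.

Let n_gt0 : 0 < n. Proof. exact: leq_ltn_trans size_la. Qed.
Let K_gt0 : 0 < K. Proof. by rewrite expn_gt0. Qed.
Let N_gt0 : 0 < N. Proof. by rewrite muln_gt0 K_gt0. Qed.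

Definition mult (T : Mx) r c := blocktr n (entry T) c r.
(** [expand] starts at 1, so the cells of code 0, the empty label, are deleted here. *)
Definition crow (T : Mx) r := expand N (mult T r).
Definition tab_rows (T : Mx) rs : filling := [seq [seq lab c | c <- crow T r] | r <- rs].
Definition tab (T : Mx) : filling := tab_rows T (iota 0 (size ga).+1).

Lemma mem_crow T r c : c \in crow T r -> 0 < c < N. Proof. exact: mem_expand. Qed.

Lemma nth_tab T r : r <= size ga -> nth [::] (tab T) r = [seq lab c | c <- crow T r].
Proof. by move=> le_r; rewrite (nth_map 0) ?size_iota ?nth_iota. Qed.

Lemma size_tab T : size (tab T) = (size ga).+1. Proof. by rewrite size_map size_iota. Qed.

Lemma sum_mult T r : r < n -> jcond n l (rsums T) p -> \sum_(0 <= c < N) mult T r c = p r.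
Proof.
move=> lt_r /forallP/(_ (Ordinal lt_r))/eqP /= <-.
by rewrite -(colsum_blocktr K n_gt0 (entry T) lt_r).
Qed.

Lemma mult_block T S r j : j < n -> mult T r (S * n + j) = entry T (S * n + r) j.
Proof. by move=> lt_j; rewrite /mult /blocktr block_div // block_mod. Qed.

Section Admissible.
Variable T : Mx.
Hypothesis jT : jcond n l (rsums T) p.
Hypothesis T0 : forall r, 0 < r < n -> mult T r 0 = 0.

Lemma sum_mult1 r : 0 < r < n -> \sum_(1 <= c < N) mult T r c = p r.
Proof.
by move=> lt_r; case/andP: (lt_r) => _ lt_rn; rewrite -(sum_mult lt_rn jT) [RHS]big_ltn // T0.
Qed.

Lemma size_crow r : 0 < r < n -> size (crow T r) = p r.
Proof. by move=> lt_r; rewrite size_expand sum_mult1. Qed.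

Lemma size_crow0 : size (crow T 0) + mult T 0 0 = n - sumn ga.
Proof. by rewrite size_expand addnC -[RHS](sum_mult n_gt0 jT) [RHS]big_ltn. Qed.

Lemma mult_out r c : size ga < r -> r < n -> c < N -> mult T r c = 0.
Proof.
move=> lt_r lt_rn lt_c; have := sum_mult lt_rn jT; rewrite nth_default // => /eqP.
by rewrite big_mkord sum_nat_eq0 => /forallP/(_ (Ordinal lt_c))/eqP.
Qed.

Lemma crow_out r : size ga < r -> r < n -> crow T r = [::].
Proof.
move=> lt_r lt_rn; apply/nilP; rewrite /nilp size_crow ?lt_rn ?andbT ?nth_default //.
exact: leq_ltn_trans lt_r.
Qed.

Lemma shape_tab : shape (behead (tab T)) = ga.
Proof.
apply: (@eq_from_nth _ 0); first by rewrite size_map size_behead size_tab.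
move=> i; rewrite size_map size_behead size_tab -pred_Sn => lt_i.
rewrite (nth_map [::]) ?size_behead ?size_tab // nth_behead nth_tab //.
by rewrite size_map size_crow //=; lia.
Qed.

Lemma count_letters P : count P (letters (tab T)) =
  \sum_(0 <= r < n) \sum_(0 <= c < N) count P (lab c : seq letter) * mult T r c.
Proof.
rewrite /letters count_flatten /tab /tab_rows -!map_comp sumnE big_map.
rewrite (@big_cat_nat _ _ _ (size ga).+1 0 n) //=.
rewrite [X in _ = _ + X]big_nat [X in _ = _ + X]big1 ?addn0; last first.
  move=> r /andP[lt_r lt_rn]; rewrite big_nat big1 // => c /andP[_ lt_c].
  by rewrite mult_out // muln0.
rewrite /index_iota subn0; apply: eq_bigr => r _.
rewrite count_flatten sumnE !big_map sum_expand [RHS]big_ltn //.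
by rewrite {2}/code_label div0n mod0n /mask_label mask_set0.
Qed.

Lemma count_tab_bar k : count_mem ((false, k) : letter) (letters (tab T)) =
  if k.+1 < n then colsum N (entry T) k.+1 else 0.
Proof.
rewrite count_letters exchange_big /= sum_blocks //.
case: ltnP => [lt_k|le_k]; last first.
  rewrite big1 // => S _; rewrite big_nat big1 // => j /andP[_ lt_j].
  by rewrite big1 // => r _; rewrite count_code_bar block_mod // ltn_eqF // (leq_trans lt_j).
rewrite /colsum sum_blocks; apply: eq_bigr => S _.
rewrite big_mkord (bigD1 (Ordinal lt_k)) //= [X in _ + X]big1 ?addn0.
  apply: eq_bigr => r _; rewrite count_code_bar block_mod // eqxx mul1n mult_block //.
move=> j /negbTE; rewrite -val_eqE /= => ne; apply: big1 => r _.
by rewrite count_code_bar block_mod // ne.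
Qed.

Lemma count_tab_unbar i : count_mem ((true, i) : letter) (letters (tab T)) =
  asum n K l (rsums T) i.
Proof.
rewrite count_letters exchange_big /= sum_blocks // /asum [RHS]big_mkcond /=.
apply: eq_bigr => S _; case: ifP => iS.
  rewrite [RHS]exchange_big /= !big_nat; apply: eq_bigr => j /andP[_ lt_j].
  apply: eq_bigr => r _; rewrite count_code_mask block_div // iS mul1n mult_block //.
rewrite big_nat big1 // => j /andP[_ lt_j]; apply: big1 => r _.
by rewrite count_code_mask block_div // iS.
Qed.

Lemma sum_all_mult : \sum_(0 <= r < n) \sum_(0 <= c < N) mult T r c = n.
Proof.
rewrite -[RHS](@sum_add_row n n ga) // !big_nat; apply: eq_bigr => r /andP[_ lt_r].
exact: sum_mult.
Qed.

Lemma sum_colsums : \sum_(0 <= k < n) colsum N (entry T) k = n.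
Proof.
rewrite -[RHS]sum_all_mult [RHS]exchange_big /= sum_blocks //.
under eq_bigr => k _ do rewrite /colsum sum_blocks.
rewrite exchange_big /=; apply: eq_bigr => S _; rewrite exchange_big /=.
rewrite [RHS]exchange_big /=; apply: eq_bigr => r _; rewrite !big_nat.
by apply: eq_bigr => j /andP[_ lt_j]; rewrite mult_block.
Qed.

(** The labels do not show the multiplicity of [j = 0]; it is recovered from the total number [n] of
    cells, empty ones included. *)
Lemma content_tabE : perm_eq (letters (tab T)) (content la al) =
  [forall k : 'I_n, colsum N (entry T) k == laN k] && acond n l (nth 0 al) (rsums T).
Proof.
apply/idP/andP => [/seq.permP cT|[/forallP cT /forallP aT]].
  have cb k : k.+1 < n -> colsum N (entry T) k.+1 = nth 0 la k.
    by move=> lt_k; have := count_tab_bar k; rewrite lt_k cT count_content_bar.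
  split; apply/forallP => k; last by rewrite -count_tab_unbar cT count_content_unbar.
  case: k => -[|k] lt_k /=; last by rewrite cb.
  have := sum_colsums; rewrite big_ltn // big_add1 /=.
  have -> : \sum_(0 <= i < n.-1) colsum N (entry T) i.+1 = sumn la.
    rewrite -(@sum_nth_pad n.-1 la); last by lia.
    by rewrite !big_nat; apply: eq_bigr => i lt_i; rewrite cb //; lia.
  by move=> e; apply/eqP; lia.
apply/allP => -[[] i] _ /=; apply/eqP.
  rewrite count_tab_unbar count_content_unbar.
  have [lt_i|le_i] := ltnP i l; first by apply/eqP: (aT (Ordinal lt_i)).
  rewrite nth_default // /asum big1 // => S iS.
  by have := mask_set_lt iS; rewrite ltnNge le_i.
rewrite count_tab_bar count_content_bar; case: ltnP => [lt_i|le_i].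
  by apply/eqP: (cT (Ordinal lt_i)).
by rewrite nth_default //; lia.
Qed.

(** A nonempty label uses at least one letter, so all but [sumn la + sumn al] of the [n] cells are
    empty, and the empty ones lie in the bottom row. *)
Lemma mult00_ge : perm_eq (letters (tab T)) (content la al) ->
  n <= sumn la + sumn al + mult T 0 0.
Proof.
move=> /perm_size; rewrite size_content -count_predT count_letters => <-.
have -> : mult T 0 0 = \sum_(0 <= r < n) \sum_(0 <= c < N) (c == 0) * mult T r c.
  rewrite big_ltn // big_ltn // mul1n big1_seq ?addn0; last first.
    by move=> c; rewrite mem_index_iota => /= lt_c; rewrite gtn_eqF //; case/andP: lt_c.
  rewrite big_nat big1 ?addn0 // => r lt_r; rewrite big_ltn // T0 // muln0 add0n.
  by rewrite big_nat big1 // => c /andP[lt_c _]; rewrite gtn_eqF.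
rewrite -big_split /= -{1}sum_all_mult; apply: leq_sum => r _.
rewrite -big_split /= !big_nat; apply: leq_sum => c /andP[_ lt_c].
rewrite -mulnDl leq_pmull //; case: c lt_c => [|c] lt_c; first by rewrite addn1.
have /and3P[nM _ _] := is_label_code (ltn0Sn c) lt_c.
by rewrite count_predT addn0 lt0n size_eq0.
Qed.

Lemma first_row_tab : all (fun M : label => ~~ all barred M) (head [::] (tab T)) =
  [forall j : 'I_n, (0 < j) ==> (entry T 0 j == 0)].
Proof.
rewrite /= all_map; apply/allP/forallP => [H j|H c cT /=].
  apply/implyP => j_gt0; rewrite -[_ == 0]negbK -lt0n; apply/negP => e_gt0.
  have lt_jN : j < N by apply: leq_trans (ltn_ord j) _; rewrite leq_pmull.
  have : (j : nat) \in crow T 0.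
    rewrite -has_pred1 has_count count_mem_expand ?j_gt0 //.
    by rewrite -[X in mult T 0 X]add0n -(mul0n n) mult_block.
  by move/H; rewrite /= all_barred_code // ltn_ord.
have /andP[c_gt0 lt_c] := mem_crow cT.
rewrite all_barred_code //; apply/negP => lt_cn.
have := H (Ordinal lt_cn); rewrite /= c_gt0 /= => /eqP e0.
have := count_mem_expand (m := N) (mult T 0) (c := c); rewrite c_gt0 lt_c => /(_ isT).
rewrite (_ : mult T 0 c = 0); last by rewrite -[c]add0n -(mul0n n) mult_block.
by move/eqP; rewrite -leqn0 leqNgt -has_count has_pred1 cT.
Qed.

Lemma count_crow_le r c : c < N ->
  count (fun x => x <= c) (crow T r) = \sum_(1 <= c' < c.+1) mult T r c'.
Proof.
move=> lt_c; rewrite count_expand (@big_cat_nat _ _ _ c.+1) //=.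
rewrite [X in _ + X]big_nat [X in _ + X]big1 ?addn0; last by move=> c' /andP[lt_c' _]; rewrite leqNgt lt_c'.
by rewrite !big_nat; apply: eq_bigr => c' /andP[_ lt_c']; rewrite -ltnS lt_c' mul1n.
Qed.

Lemma count_crow_lt r c : c < N ->
  count (fun x => x < c) (crow T r) = \sum_(1 <= c' < c) mult T r c'.
Proof.
case: c => [|c] lt_c; last by rewrite -count_crow_le // ltnW.
by rewrite big_geq // -size_filter filter_pred0.
Qed.

Lemma sum_mult0 r c : 0 < r < n -> \sum_(0 <= c' < c) mult T r c' = \sum_(1 <= c' < c) mult T r c'.
Proof.
by move=> lt_r; case: c => [|c]; [rewrite !big_geq | rewrite big_ltn // T0].
Qed.

(** The comparison of the bottom row with the row above it is absent from the tableau condition. It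
    is automatic, because the bottom row begins with at least [ga_1] empty cells. *)
Lemma colstrict_tab : head 0 ga <= mult T 0 0 ->
  colstrict n l (entry T) =
  sorted (fun R R' : seq label => all (fun p => (p.1 < p.2)%O) (zip R R')) (behead (tab T)).
Proof.
move=> ge00.
have zipE r : all (fun p => (p.1 < p.2)%O) (zip [seq lab c | c <- crow T r] [seq lab c | c <- crow T r.+1])
   = all (fun p => p.1 < p.2) (zip (crow T r) (crow T r.+1)).
  have allN i : all (gtn N) (crow T i) by apply/allP => c /mem_crow/andP[].
  exact: (all_zip_map_mono (@code_label_ltn n l) (allN r) (allN r.+1)).
have zipP r : 0 < r -> r.+1 <= size ga ->
    reflect (forall c, c < N -> \sum_(0 <= c' < c.+1) mult T r.+1 c' <= \sum_(0 <= c' < c) mult T r c')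
      (all (fun p => p.1 < p.2) (zip (crow T r) (crow T r.+1))).
  move=> r_gt0 le_r.
  have lt1 : 0 < r < n by lia.
  have lt2 : 0 < r.+1 < n by lia.
  have le_sz : size (crow T r.+1) <= size (crow T r).
    rewrite !size_crow //; case: r r_gt0 le_r {lt1 lt2} => // r _ lt_r /=.
    by move/(sortedP 0): ga_part; apply.
  apply: (iffP (zip_ltnP (expand_sorted _ _) (expand_sorted _ _) le_sz)) => H c.
    by move=> lt_c; have := H c; rewrite count_crow_le // count_crow_lt // !sum_mult0.
  have [lt_c|le_c] := ltnP c N.
    by rewrite count_crow_le // count_crow_lt // -!sum_mult0 //; apply: H.
  apply: leq_trans (count_size _ _) _; apply: leq_trans le_sz _.
  rewrite -[X in X <= _]count_predT (eq_in_count (a2 := fun x => x < c)) // => x.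
  by move=> /mem_crow/andP[_ lt_x]; symmetry; apply: leq_trans lt_x le_c.
apply/interlacingP/(sortedP [::]) => [H i|H r c lt_r lt_c].
  rewrite size_behead size_tab -pred_Sn => lt_i; rewrite !nth_behead !nth_tab ?(ltnW lt_i) // zipE.
  apply/zipP => // c lt_c; have := H i.+1 c; rewrite /pchain !add0n; apply=> //; lia.
rewrite /pchain !add0n -!/(mult _ _ _).
have [le_r|gt_r] := leqP r.+1 (size ga); last first.
  rewrite big_nat big1 // => c' /andP[_ lt_c']; apply: mult_out => //.
  exact: leq_trans lt_c' lt_c.
case: r lt_r le_r => [|r] lt_r le_r; last first.
  have := H r; rewrite size_behead size_tab -pred_Sn => /(_ le_r).
  rewrite !nth_behead !nth_tab ?(ltnW le_r) // zipE => /zipP; apply=> //.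
have lt1 : 0 < 1 < n by lia.
case: c lt_c => [|c] lt_c; first by rewrite big_nat1 big_geq // -/(mult T 1 0) T0.
apply: (@leq_trans (p 1)).
  rewrite -(sum_mult lt_r jT) (@big_cat_nat _ _ _ c.+2 0 N) //=; exact: leq_addr.
rewrite /= nth0; apply: leq_trans ge00 _.
by rewrite big_ltn // leq_addr.
Qed.

(** The contribution of row [r] and set [S] to the reading word. The predecessor undoes the shift by
    which residue 0 stands for no barred letter. *)
Definition block S r : seq nat :=
  [seq (c %% n).-1 | c <- rev (crow T r) & (c %/ n == S) && (c %% n != 0)].

Lemma block_sorted S r : sorted geq (block S r).
Proof.
have := expand_sorted N (mult T r); rewrite -/(crow T r) -rev_sorted => srt.
rewrite /block sorted_map.
have tr : transitive (fun y x : nat => x <= y) by move=> x y z h1 h2; apply: leq_trans h2 h1.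
have := sorted_filter tr (fun c => (c %/ n == S) && (c %% n != 0)) srt.
set s := filter _ _ => srt'; have Hs : all (fun c => c %/ n == S) s.
  by apply/allP => c; rewrite mem_filter => /andP[/andP[]].
apply: (@sub_in_sorted _ (fun c => c %/ n == S)) srt' => //.
move=> c c' /eqP e /eqP e' le_c; rewrite /relpre /=.
have := divn_eq c n; have := divn_eq c' n; rewrite e e' => h h'.
have : c' %% n <= c %% n by rewrite -(leq_add2l (S * n)) -h -h'.
by rewrite -!subn1; apply: leq_sub2r.
Qed.

Lemma count_block S r j : S < K -> r < n ->
  count_mem j (block S r) = if j.+1 < n then entry T (S * n + r) j.+1 else 0.
Proof.
move=> lt_S lt_r; rewrite /block count_map count_filter count_rev.
case: ltnP => [lt_j|le_j]; last first.
  apply/eqP; rewrite eqn0Ngt -has_count; apply/hasPn => c _ /=.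
  have := ltn_pmod c n_gt0; case: (c %% n) => [|m] lt_m; rewrite ?andbF //= andbT.
  by apply/negP => /andP[/eqP]; lia.
rewrite -mult_block // -(@count_mem_expand N); last by rewrite block_lt // addnS.
apply: eq_count => c /=; rewrite block_eq //.
by case: (c %% n) => [|m] /=; rewrite ?andbF ?eqSS // andbT.
Qed.

Lemma read_cells S (s : seq nat) : S < K -> all (fun c => c < N) s ->
  flatten [seq barred_indices M | M <- [seq lab c | c <- s] & unbarred_part M == mask_label l S]
  = [seq (c %% n).-1 | c <- s & (c %/ n == S) && (c %% n != 0)].
Proof.
move=> lt_S; elim: s => //= c s IH /andP[lt_c lt_s]; rewrite unbarred_code.
have -> : (mask_label l (c %/ n) == mask_label l S) = (c %/ n == S).
  apply/eqP/eqP => [|-> //]; apply: mask_label_inj => //; exact: div_lt.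
case: eqP => //= _; last exact: IH.
by rewrite barred_code IH //; case ec: (c %% n) => [|j] //=; rewrite ec.
Qed.

Lemma read_at_rows S rs : S < K ->
  read_at (tab_rows T rs) (mask_label l S) = flatten [seq block S r | r <- rs].
Proof.
move=> lt_S; elim: rs => //= r rs IH.
rewrite /read_at /reading /= filter_cat map_cat flatten_cat -/(reading _) -/(read_at _ _) IH.
congr cat; rewrite -map_rev read_cells //.
by apply/allP => c; rewrite mem_rev => /mem_crow/andP[].
Qed.

Lemma block_out S r : size ga < r -> r < n -> block S r = [::].
Proof. by move=> lt_r lt_rn; rewrite /block crow_out. Qed.

Lemma read_at_tab S : S < K ->
  read_at (tab T) (mask_label l S) = flatten [seq block S r | r <- iota 0 n].
Proof.
move=> lt_S; rewrite /tab read_at_rows //.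
have {1}-> : n = (size ga).+1 + (n - (size ga).+1) by lia.
rewrite iotaD map_cat flatten_cat [X in _ = _ ++ X](_ : _ = [::]) ?cats0 //.
apply/nilP; rewrite /nilp size_flatten sumnE /shape -map_comp big_map big_seq big1 //.
by move=> r; rewrite mem_iota => lt_r /=; rewrite block_out //; lia.
Qed.

Definition occurs S := has (fun c => c %/ n == S) (flatten [seq crow T r | r <- iota 0 (size ga).+1]).

Lemma mem_reading_tab M : reflect (exists2 c, c \in flatten [seq crow T r | r <- iota 0 (size ga).+1] & M = lab c)
  (M \in reading (tab T)).
Proof.
apply: (iffP flatten_mapP) => [[R /mapP[r rg ->]]|[c /flatten_mapP[r rg cr] ->]].
  rewrite mem_rev => /mapP[c cr ->]; exists c => //; apply/flatten_mapP; by exists r.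
exists [seq lab c | c <- crow T r]; first exact: (map_f (fun r => [seq lab c | c <- crow T r])).
by rewrite mem_rev map_f.
Qed.

Lemma cell_lt c : c \in flatten [seq crow T r | r <- iota 0 (size ga).+1] -> c < N.
Proof. by case/flatten_mapP=> r _ /mem_crow/andP[]. Qed.

Lemma mask_label_nil S : S < K -> (mask_label l S == [::]) = (S == 0).
Proof.
move=> lt_S; apply/eqP/eqP => [e|->]; last by rewrite /mask_label mask_set0.
by apply: (@mask_label_inj l) => //; rewrite e /mask_label mask_set0.
Qed.

Lemma unbarred_parts_tab :
  unbarred_parts (tab T) = [seq mask_label l u | u <- iota 1 K.-1 & occurs u].
Proof.
apply: lt_sorted_eq.
- by rewrite /unbarred_parts sort_lt_sorted undup_uniq.
- have : sorted ltn [seq u <- iota 1 K.-1 | occurs u].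
    by apply: sorted_filter; [exact: ltn_trans | exact: iota_ltn_sorted].
  have : all (fun u => u < K) [seq u <- iota 1 K.-1 | occurs u].
    by apply/allP => u; rewrite mem_filter mem_iota; lia.
  move=> Hs srt; rewrite sorted_map; apply: (@sub_in_sorted _ (fun u => u < K)) srt => //.
  move=> u u' _ lt_S' lt_S; rewrite /relpre /=.
  by have := @mask_label_lt l u u' [::] [::] isT lt_S lt_S'; rewrite !cats0.
move=> U; rewrite /unbarred_parts mem_sort mem_undup mem_filter.
apply/andP/mapP => [[nU /mapP[M /mem_reading_tab[c cT ->]]]|[u]].
  rewrite unbarred_code => eU; exists (c %/ n) => //.
  have lt_c := cell_lt cT; have lt_d := div_lt n_gt0 lt_c.
  rewrite mem_filter mem_iota; apply/andP; split; first by apply/hasP; exists c.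
  by move: nU; rewrite eU mask_label_nil // lt0n add1n prednK // => ->.
rewrite mem_filter mem_iota => /andP[/hasP[c cT /eqP ec] lt_S] ->.
rewrite mask_label_nil; last by lia.
split; first by lia.
apply/mapP; exists (lab c); first by apply/mem_reading_tab; exists c.
by rewrite unbarred_code ec.
Qed.

Lemma flatten_map_filter (A B : Type) (q : pred A) (f : A -> seq B) s :
  (forall x, ~~ q x -> f x = [::]) -> flatten [seq f x | x <- s & q x] = flatten [seq f x | x <- s].
Proof.
move=> f0; elim: s => //= x s IH; case: ifP => [_|/negbT/f0 ->] //=; by rewrite IH.
Qed.

Lemma iota_blocks (A : Type) k m (f : nat -> nat -> seq A) : 0 < m ->
  flatten [seq flatten [seq f u r | r <- iota 0 m] | u <- iota 0 k] =
  flatten [seq f (i %/ m) (i %% m) | i <- iota 0 (k * m)].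
Proof.
move=> m_gt0; elim: k => // k IH.
rewrite -addn1 iotaD map_cat flatten_cat IH mulnDl mul1n iotaD map_cat flatten_cat !add0n.
congr cat; rewrite /= cats0 -[k * m]addn0 iotaDl -map_comp; congr flatten.
apply/eq_in_map => r; rewrite mem_iota /= => lt_r.
by rewrite block_div // block_mod.
Qed.

(** Sets that do not occur contribute nothing, so the word may run over all bitmasks and all rows,
    which is the row order of the matrix. *)
Lemma word_tab : read_at (tab T) [::] ++ flatten [seq read_at (tab T) U | U <- unbarred_parts (tab T)] =
  flatten [seq block (i %/ n) (i %% n) | i <- iota 0 N].
Proof.
have e0 : mask_label l 0 = [::] by rewrite /mask_label mask_set0.
rewrite -[X in read_at _ X]e0 unbarred_parts_tab -map_comp.
have eK : iota 0 K = 0 :: iota 1 K.-1 by rewrite -{1}(prednK K_gt0).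
rewrite -iota_blocks // eK /=.
congr cat; first by rewrite read_at_tab.
transitivity (flatten [seq flatten [seq block u r | r <- iota 0 (size ga).+1] | u <- iota 1 K.-1 & occurs u]).
  congr flatten; apply/eq_in_map => u; rewrite mem_filter mem_iota => lt_u.
  by rewrite /= /tab read_at_rows //; lia.
rewrite flatten_map_filter.
  congr flatten; apply/eq_in_map => u; rewrite mem_iota => lt_S.
  by rewrite -read_at_tab ?/tab ?read_at_rows //; lia.
move=> u /hasPn nS; apply/nilP; rewrite /nilp size_flatten sumnE /shape -map_comp big_map big_seq big1 //.
move=> r rg /=; rewrite size_map size_filter count_rev; apply/eqP; rewrite eqn0Ngt -has_count.
apply/hasPn => c cr; rewrite negb_and (nS c) //; apply/flatten_mapP; by exists r.
Qed.

(** Column 0 of the matrix holds the cells without barred letter, which are not read; hence the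
    indices [k.+1] and [k.+2]. *)
Lemma lattice_tabE : lattice_tableau (tab T) <->
  forall i k, i < N -> k.+2 < n ->
    \sum_(0 <= i' < i.+1) entry T i' k.+2 <= \sum_(0 <= i' < i) entry T i' k.+1.
Proof.
rewrite /lattice_tableau word_tab.
have cnt j m : m <= N ->
    \sum_(0 <= i' < m) count_mem j (nth [::] [seq block (i %/ n) (i %% n) | i <- iota 0 N] i') =
    if j.+1 < n then \sum_(0 <= i' < m) entry T i' j.+1 else 0.
  move=> le_m; case: ifP => lt_j; [rewrite !big_nat; apply: eq_bigr|rewrite big_nat big1 //];
    move=> i /andP[_ lt_i]; have lt_iN := leq_trans lt_i le_m;
    rewrite (nth_map 0) ?size_iota // nth_iota // add0n count_block ?div_lt ?ltn_pmod // lt_j //.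
  by rewrite -divn_eq.
rewrite lattice_word_flatten; last by apply/allP => w /mapP[i _ ->]; apply: block_sorted.
rewrite size_map size_iota; split=> H i k lt_i.
  by move=> lt_k; have := H i k lt_i; rewrite !cnt ?lt_k ?(ltnW lt_k) // ltnW.
rewrite !cnt //; last exact: ltnW.
by case: ifP => // lt_k; rewrite (ltnW lt_k); apply: H.
Qed.

(** The first matrix row, with empty [S] and [r = 0], yields the condition on the bottom row. Later
    tests of [j = 1] against [j = 0] hold because that row already contains at least [la_1] empty
    cells, by [n_large]. *)
Lemma dominant_tab : perm_eq (letters (tab T)) (content la al) ->
  dominant N n (fun=> 0) (entry T) <->
  lattice_tableau (tab T) /\ all (fun M : label => ~~ all barred M) (head [::] (tab T)).
Proof.
move=> cT; rewrite first_row_tab lattice_tabE; split.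
  move/interlacingP => H; split=> [i k lt_i lt_k|].
    by have := H k.+1 i lt_k lt_i; rewrite /pchain !add0n.
  apply/forallP => -[[|j] lt_j] //=; have := H j 0 lt_j N_gt0.
  by rewrite /pchain !add0n big_nat1 big_geq // leqn0.
case=> H /forallP H0; apply/interlacingP => k i lt_k lt_i; rewrite /pchain !add0n.
case: k lt_k => [|k] lt_k; last exact: H.
case: i lt_i => [|i] lt_i.
  by rewrite big_nat1 (eqP (implyP (H0 (Ordinal lt_k)) isT)).
have := cT; rewrite content_tabE => /andP[/forallP/(_ (Ordinal lt_k))/eqP /= c1 _].
apply: (@leq_trans (nth 0 la 0)).
  rewrite -c1 /colsum (@big_cat_nat _ _ _ i.+2 0 N) //=; exact: leq_addr.
have := mult00_ge cT; rewrite -[X in mult T 0 X](addn0 (0 * n)) mult_block // addn0 mul0n => ge00.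
have le_la : nth 0 la 0 <= sumn la by case: (la) => //= *; apply: leq_addr.
rewrite big_ltn //; apply: leq_trans (leq_addr _ _); lia.
Qed.

Lemma lr_matrices_tab : T \in lr_matrices n l laN (nth 0 al) p <->
  [/\ MCT ga la al (tab T), set_valued (tab T) & lattice_tableau (tab T)].
Proof.
have sv : set_valued (tab T).
  by apply/allP => R /mapP[r _ ->]; apply/allP => M /mapP[c _ ->]; apply: uniq_code.
have MCTE : MCT ga la al (tab T) =
   [&& sorted (fun R R' : seq label => all (fun p => (p.1 < p.2)%O) (zip R R')) (behead (tab T)),
     perm_eq (letters (tab T)) (content la al) & all (fun M : label => ~~ all barred M) (head [::] (tab T))].
  rewrite /MCT shape_tab eqxx -/(letters _).
  have -> : tab T != [::] by rewrite -size_eq0 size_tab.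
  have -> : all (all is_label) (tab T).
    apply/allP => R /mapP[r _ ->]; apply/allP => M /mapP[c /mem_crow/andP[c_gt0 lt_c] ->].
    exact: is_label_code.
  have -> // : all (sorted <=%O) (tab T).
  apply/allP => R /mapP[r _ ->]; rewrite (mono_sorted_in (@code_label_le n l)).
    exact: expand_sorted.
  by apply/allP => c /mem_crow/andP[].
(* The cells above the bottom row are nonempty, so [ga_1] is at most [sumn la + sumn al], which by
   [n_large] does not exceed the number of empty cells. *)
have ge00 : perm_eq (letters (tab T)) (content la al) -> head 0 ga <= mult T 0 0.
  move=> cT; have h3 := mult00_ge cT; have h2 := perm_size cT; rewrite size_content in h2.
  have h1 : sumn (shape (tab T)) <= size (letters (tab T)).
    apply: cells_le_letters; apply/allP => R /mapP[r _ ->]; apply/allP => M /mapP[c /mem_crow/andP[c_gt0 lt_c] ->].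
    exact: is_label_code.
  have e1 : sumn (shape (tab T)) = size (head [::] (tab T)) + sumn (shape (behead (tab T))) by [].
  rewrite e1 shape_tab in h1.
  have h4 : head 0 ga <= sumn ga by case: (ga) => //= *; apply: leq_addr.
  have h5 := leq_trans h1 (eq_leq h2); lia.
rewrite inE MCTE jT content_tabE; split.
  case/and5P=> c1 c2 c3 _ c5; have cT : perm_eq (letters (tab T)) (content la al).
    by rewrite content_tabE c3.
  have [lat r1] := (dominant_tab cT).1 c2.
  by split=> //; rewrite -colstrict_tab ?c1 ?ge00 // c3 c5.
case=> /and3P[c1 c3 r1] _ lat; have cT : perm_eq (letters (tab T)) (content la al).
  by rewrite content_tabE.
by rewrite colstrict_tab ?ge00 // c1 (dominant_tab cT).2.
Qed.
End Admissible.

Lemma mult_tab (T : Mx) r c : r <= size ga -> 0 < c < N ->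
  mult T r c = count_mem (lab c) (nth [::] (tab T) r).
Proof.
move=> le_r lt_c; rewrite nth_tab // count_map -(count_mem_expand (mult T r) lt_c).
apply: eq_in_count => c' /mem_crow/andP[_ lt_c'] /=.
apply/eqP/eqP => [-> //|]; apply: code_label_inj => //.
by case/andP: lt_c.
Qed.

Lemma entry_mult (T : Mx) i k : k < n -> entry T i k = mult T (i %% n) (i %/ n * n + k).
Proof. by move=> lt_k; rewrite mult_block // -divn_eq. Qed.

Lemma tab_inj (T T' : Mx) : jcond n l (rsums T) p -> jcond n l (rsums T') p ->
  (forall r, 0 < r < n -> mult T r 0 = 0) -> (forall r, 0 < r < n -> mult T' r 0 = 0) ->
  tab T = tab T' -> T = T'.
Proof.
move=> jT jT' T0 T0' e; apply: entry_inj => i k lt_i lt_k; rewrite !entry_mult //.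
have lt_r : i %% n < n by rewrite ltn_mod.
have lt_c : i %/ n * n + k < N by apply: block_lt => //; apply: div_lt.
move: (i %% n) (i %/ n * n + k) lt_r lt_c => r c lt_r lt_c.
have [le_r|gt_r] := leqP r (size ga); last by rewrite !mult_out.
have [-> |c_gt0] := posnP c; last by rewrite !mult_tab ?c_gt0 // e.
have [->|r_gt0] := posnP r; last by rewrite T0 ?T0' ?r_gt0.
(* The number of empty cells is invisible in the tableau but follows from the prescribed length of
   the bottom row. *)
have := size_crow0 jT; have := size_crow0 jT'.
have szE U : size (crow U 0) = size (nth [::] (tab U) 0) by rewrite nth_tab // size_map.
by rewrite !szE e; lia.
Qed.

Lemma label_codes (F : filling) R : MCT ga la al F -> set_valued F -> R \in F ->
  exists2 s, all (fun c => 0 < c < N) s & R = [seq lab c | c <- s].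
Proof.
move=> /and5P[_ _ lF _ /and3P[_ cF _]] sF RF.
have cnt z : count_mem z (letters F) = count_mem z (content la al) by apply/seq.permP.
have labR : {in R, forall M, exists2 c, 0 < c < N & M = lab c}.
  move=> M MR; apply: code_label_surj => //.
  - exact: (allP (allP lF R RF)).
  - exact: (allP (allP sF R RF)).
  - move=> i iM; have := mem_letters RF MR iM; rewrite -has_pred1 has_count cnt count_content_unbar.
    by case: (ltnP i l) => // le_i; rewrite nth_default.
  move=> i iM; have := mem_letters RF MR iM; rewrite -has_pred1 has_count cnt count_content_bar.
  by case: (ltnP i (size la)) => [lt_i _|le_i]; [lia | rewrite nth_default].
elim: R labR {RF} => [|M R IH] labR; first by exists [::].
have [|s lt_s ->] := IH; first by move=> M' M'R; apply: labR; rewrite inE M'R orbT.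
have [|c lt_c ->] := labR M; first by rewrite inE eqxx.
by exists (c :: s) => //=; rewrite lt_c.
Qed.

Lemma tab_surj (F : filling) : MCT ga la al F -> set_valued F ->
  exists T : Mx, [/\ jcond n l (rsums T) p, forall r, 0 < r < n -> mult T r 0 = 0 & tab T = F].
Proof.
move=> mF sF; have := mF => /and5P[nF /eqP shF lF oF /and3P[_ cF _]].
have szF : size F = (size ga).+1 by case: F nF shF {mF sF lF oF cF} => //= R F _ <-; rewrite size_map.
have nilF r : [::] \notin nth [::] F r.
  have [lt_r|le_r] := ltnP r (size F); last by rewrite nth_default.
  by apply/negP => /(allP (allP lF _ (mem_nth [::] lt_r))).
have sz_cells : size (head [::] F) + sumn ga <= n.
  have := cells_le_letters lF; rewrite (perm_size cF) size_content.
  have -> : sumn (shape F) = size (head [::] F) + sumn (shape (behead F)) by case: (F) nF.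
  by rewrite shF; lia.
have szr r : 0 < r -> size (nth [::] F r) = p r.
  case: r => // r _; rewrite /= -shF; case: (F) nF => //= R F' _.
  have [lt_r|le_r] := ltnP r (size F'); first by rewrite (nth_map [::]).
  by rewrite !nth_default // size_map.
have szn r : size (nth [::] F r) <= n.
  have [->|r_gt0] := posnP r; first by rewrite nth0; lia.
  rewrite szr //; case: r {r_gt0} => //= [|r]; first exact: leq_subr.
  apply: leq_trans sum_ga; have [lt_r|le_r] := ltnP r (size ga); last by rewrite nth_default.
  by rewrite (perm_sumn (perm_to_rem (mem_nth 0 lt_r))) /= leq_addr.
(* Code 0 is used in the bottom row only, as often as needed to bring that row to the length
   [n - sumn ga]. *)
pose X r c := if (r == 0) && (c == 0) then n - sumn ga - size (head [::] F)
              else count_mem (lab c) (nth [::] F r).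
have leX r c : X r c <= n.
  by rewrite /X; case: ifP => _; [rewrite -subnDA leq_subr | apply: leq_trans (count_size _ _) _].
pose T : Mx := matrix_of N n n (fun i k => X (i %% n) (i %/ n * n + k)).
have mT r c : r < n -> c < N -> mult T r c = X r c.
  move=> lt_r lt_c; rewrite /mult /blocktr entry_matrix_of ?ltn_mod //.
    by rewrite block_mod // block_div // -divn_eq.
  by apply: block_lt => //; apply: div_lt.
have X0 r : 0 < r -> X r 0 = 0.
  case: r => // r _; rewrite /X /= {1}/code_label div0n mod0n /mask_label mask_set0 /=.
  by apply/eqP; rewrite eqn0Ngt -has_count has_pred1.
have rowE r : r <= size ga -> [seq lab c | c <- crow T r] = nth [::] F r.
  move=> le_r; have lt_r : r < size F by rewrite szF.
  have RF := mem_nth [::] lt_r; have [s lt_s eR] := label_codes mF sF RF.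
  have ltN_s : all (gtn N) s by apply: sub_all lt_s => c /andP[].
  have srt : sorted leq s.
    have := allP oF _ RF; rewrite eR (mono_sorted_in (@code_label_le n l)) //.
  rewrite eR; congr map; rewrite -[RHS](@expand_count N s srt); last exact/allP.
  apply: eq_expand => c /andP[c_gt0 lt_c]; rewrite mT ?(leq_ltn_trans le_r) //.
  rewrite /X (gtn_eqF c_gt0) andbF.
  rewrite eR count_map; apply: eq_in_count => c' /(allP ltN_s) lt_c' /=.
  by apply/eqP/eqP => [|-> //]; apply: code_label_inj.
have tabE : tab T = F.
  apply: (@eq_from_nth _ [::]); first by rewrite size_tab.
  by move=> r; rewrite size_tab ltnS => le_r; rewrite nth_tab // rowE.
have T0 r : 0 < r < n -> mult T r 0 = 0 by case/andP=> r_gt0 lt_r; rewrite mT ?X0.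
exists T; split=> //; apply/forallP => -[r lt_r] /=; apply/eqP.
rewrite -(colsum_blocktr K n_gt0 (entry T) lt_r) -[LHS]/(\sum_(0 <= c < N) mult T r c).
rewrite big_ltn // -size_expand -/(crow T r).
have szc : r <= size ga -> size (crow T r) = size (nth [::] F r) by move=> le_r; rewrite -rowE // size_map.
have [r0|r_gt0] := posnP r.
  by rewrite szc r0 // mT // /X /= nth0 subnK //; lia.
rewrite T0 ?r_gt0 // add0n; have [le_r|gt_r] := leqP r (size ga); first by rewrite szc // szr.
rewrite nth_default // size_expand big_nat big1 // => c /andP[_ lt_c]; rewrite mT //.
rewrite /X gtn_eqF // nth_default ?szF //.
Qed.

Lemma colstrict_first (T : Mx) r : colstrict n l (entry T) -> 0 < r < n -> mult T r 0 = 0.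
Proof.
move=> /interlacingP H; case: r => // r lt_r; have := H r 0 lt_r N_gt0.
by rewrite /pchain !add0n big_nat1 big_geq // leqn0 => /eqP.
Qed.

Theorem card_tableaux :
  has_card (fun F : filling => [/\ MCT ga la al F, set_valued F & lattice_tableau F])
    #|lr_matrices n l laN (nth 0 al) p|.
Proof.
have admissible T : T \in lr_matrices n l laN (nth 0 al) p ->
    jcond n l (rsums T) p /\ forall r, 0 < r < n -> mult T r 0 = 0.
  by rewrite inE => /and5P[c1 _ _ c4 _]; split=> // r; apply: colstrict_first.
exists [seq tab T | T <- enum (lr_matrices n l laN (nth 0 al) p)]; split.
- rewrite map_inj_in_uniq ?enum_uniq // => T T'; rewrite !mem_enum => /admissible[jT T0] /admissible[jT' T0'].
  exact: tab_inj.
- move=> F; split=> [/mapP[T]|[mF sF lF]].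
    by rewrite mem_enum => lT ->; have [jT T0] := admissible T lT; apply/lr_matrices_tab.
  have [T [jT T0 eF]] := tab_surj mF sF; apply/mapP; exists T => //.
  by rewrite mem_enum; apply/lr_matrices_tab; rewrite ?eF.
by rewrite size_map -cardE.
Qed.
End Tableaux.

Local Open Scope ring_scope.

(** * Expansion in the basis of irreducible characters *)

Section SymfunClosure.

Lemma is_symfunM (f g : symfam) : is_symfun f -> is_symfun g -> is_symfun (fun n => f n * g n).
Proof.
move=> [sf kf [df bf]] [sg kg [dg bg]]; split=> [n|n|]; first by apply: rpredM; [apply: sf | apply: sg].
  by rewrite /kill_last rmorphM /= -!/(kill_last _) kf kg.
exists (df + dg).+1 => n; apply: msizeM_leq; exact: leqW.
Qed.

Lemma is_symfun1 : is_symfun (fun n => 1).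
Proof.
split=> [n|n|]; first exact: rpred1; first by rewrite /kill_last rmorph1.
by exists 1%N => n; rewrite msize1.
Qed.

Lemma is_symfun_prod (I : eqType) (r : seq I) (f : I -> symfam) :
  {in r, forall i, is_symfun (f i)} -> is_symfun (fun n => \prod_(i <- r) f i n).
Proof.
elim: r => [|i r IH] sf.
  have [s1 s2 [d s3]] := is_symfun1; split=> [n|n|]; rewrite ?big_nil //.
  by exists d => n; rewrite big_nil.
have [|s1 s2 [d s3]] := @is_symfunM (f i) (fun n => \prod_(i <- r) f i n) (sf i (mem_head i r)).
  by apply: IH => j jr; apply: sf; rewrite inE jr orbT.
split=> [n|n|]; rewrite ?big_cons //.
by exists d => n; rewrite big_cons.
Qed.

Lemma is_symfunD (f g : symfam) : is_symfun f -> is_symfun g -> is_symfun (fun n => f n + g n).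
Proof.
move=> [sf kf [df bf]] [sg kg [dg bg]]; split=> [n|n|]; first by apply: rpredD; [apply: sf | apply: sg].
  by rewrite /kill_last rmorphD /= -!/(kill_last _) kf kg.
exists (maxn df dg) => n; apply: leq_trans (msizeD_le _ _) _.
by rewrite geq_max !leq_max bf bg orbT.
Qed.

Lemma is_symfunB (f g : symfam) : is_symfun f -> is_symfun g -> is_symfun (fun n => f n - g n).
Proof.
move=> [sf kf [df bf]] [sg kg [dg bg]]; split=> [n|n|]; first by apply: rpredB; [apply: sf | apply: sg].
  by rewrite /kill_last rmorphB /= -!/(kill_last _) kf kg.
exists (maxn df dg) => n; apply: leq_trans (msizeD_le _ _) _.
by rewrite mmeasureN geq_max !leq_max bf bg orbT.
Qed.

Lemma is_symfunZ (c : rat) (f : symfam) : is_symfun f -> is_symfun (fun n => c *: f n).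
Proof.
move=> [sf kf [df bf]]; split=> [n|n|]; first by apply: rpredZ; apply: sf.
  by rewrite /kill_last comp_mpolyZ /= -!/(kill_last _) kf.
exists df => n; exact: leq_trans (msizeZ_le _ _) _.
Qed.

Lemma is_symfun_sum (I : eqType) (r : seq I) (c : I -> rat) (f : I -> symfam) :
  {in r, forall i, is_symfun (f i)} -> is_symfun (fun n => \sum_(i <- r) c i *: f i n).
Proof.
elim: r => [|i r IH] sf.
  split=> [n|n|]; first by rewrite big_nil; apply: rpred0.
    by rewrite !big_nil /kill_last rmorph0.
  by exists 0%N => n; rewrite big_nil msize0.
have [||s1 s2 [d s3]] := @is_symfunD (fun n => c i *: f i n) (fun n => \sum_(i <- r) c i *: f i n).
- exact: is_symfunZ (sf i (mem_head i r)).
- by apply: IH => j jr; apply: sf; rewrite inE jr orbT.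
split=> [n|n|]; rewrite ?big_cons //.
by exists d => n; rewrite big_cons.
Qed.
End SymfunClosure.

Lemma sf_evalE (f : symfam) mu : sf_eval f mu = rat_eval (fun i : 'I_(sumn mu) => (Xi mu)`_i) (f (sumn mu)).
Proof. by []. Qed.

Lemma sf_eval_sum (I : Type) (r : seq I) (c : I -> rat) (f : I -> symfam) mu :
  sf_eval (fun n => \sum_(i <- r) c i *: f i n) mu = \sum_(i <- r) ratr (c i) * sf_eval (f i) mu.
Proof. by rewrite sf_evalE rat_eval_sum; apply: eq_bigr => i _; rewrite rat_evalZ. Qed.

Lemma has_card_unique (A : eqType) (P : A -> Prop) N N' : has_card P N -> has_card P N' -> N = N'.
Proof.
move=> [s [us Ps <-]] [s' [us' Ps' <-]]; apply/perm_size/uniq_perm => // x.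
by apply/idP/idP => [/Ps/Ps'|/Ps'/Ps].
Qed.

Local Open Scope nat_scope.

Lemma head_le_sumn (s : seq nat) : head 0 s <= sumn s.
Proof. by case: s => //= *; apply: leq_addr. Qed.

Lemma add_row_part n ga : is_part ga -> (sumn ga).*2 < n -> is_part (add_row n ga).
Proof.
move=> /andP[sga nga] lt_n; apply/andP; split.
  rewrite /= path_min_sorted //; apply/allP => x xg.
  by have := perm_sumn (perm_to_rem xg); rewrite /= /geq /=; lia.
by rewrite inE negb_or nga andbT; lia.
Qed.

Lemma sumn_add_row n ga : sumn ga <= n -> sumn (add_row n ga) = n.
Proof. by move=> le; rewrite /= subnK. Qed.

Definition row_ffun n ga : {ffun 'I_n -> 'I_n.+1} := [ffun k : 'I_n => inord (nth 0 (add_row n ga) k)].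

Lemma row_ffunP n ga : is_part ga -> (sumn ga).*2 < n ->
  row_ffun n ga \in partitions n n /\ forall k, k < n -> fn (row_ffun n ga) k = nth 0 (add_row n ga) k.
Proof.
move=> ga_part lt_n.
have [|q Pq eq_q] := part_ffun (leqnn n) (add_row_part ga_part lt_n); first by rewrite sumn_add_row //; lia.
suff -> : row_ffun n ga = q by [].
by apply/ffunP => k; rewrite ffunE -eq_q // fnE inord_val.
Qed.

Lemma row_ffun_inj n ga ga' : is_part ga -> is_part ga' -> (sumn ga).*2 < n -> (sumn ga').*2 < n ->
  row_ffun n ga = row_ffun n ga' -> ga = ga'.
Proof.
move=> pg pg' lt lt' e; have [Pg eg] := row_ffunP pg lt; have [_ eg'] := row_ffunP pg' lt'.
have /(part_eq (add_row_part pg lt) (add_row_part pg' lt')) [_ //] :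
    forall k, nth 0 (add_row n ga) k = nth 0 (add_row n ga') k.
move=> k; have [lt_k|le_k] := ltnP k n; first by rewrite -eg // -eg' // e.
have := size_part pg; have := size_part pg' => h h'.
by rewrite !nth_default //=; lia.
Qed.

Lemma specht_row n ga : is_part ga -> (sumn ga).*2 < n ->
  specht_char n (add_row n ga) = schar n n (fn (row_ffun n ga)).
Proof.
move=> pg lt; have [_ eg] := row_ffunP pg lt.
rewrite (@specht_schar n n) //; [|by lia|exact: add_row_part|by rewrite sumn_add_row //; lia].
by apply: eq_schar => k lt_k; rewrite eg.
Qed.

(** * Uniqueness of the expansion *)

Section StildeBasis.
Variable stilde : seq nat -> symfam.
Hypothesis stildeP : forall nu, is_part nu -> is_stilde nu (stilde nu).

Lemma stilde_eval n ga (s : 'S_n) : is_part ga -> (sumn ga).*2 < n ->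
  sf_eval (stilde ga) (cycle_type s) = specht_char n (add_row n ga) s.
Proof.
move=> pg lt; have [_] := stildeP pg; apply=> //.
by have := head_le_sumn ga; lia.
Qed.

Lemma stilde_free (r : seq (seq nat)) (d : seq nat -> rat) : uniq r -> all is_part r ->
  (forall n, \sum_(ga <- r) d ga *: stilde ga n = 0)%R -> {in r, forall ga, d ga = 0%R}.
Proof.
(* This [n] exceeds twice the size of each partition in [r], so a first row can be added to all of
   them at once and the evaluations are distinct orthonormal characters. *)
move=> ur pr d0 ga gar; pose n := (sumn [seq sumn nu | nu <- r]).*2.+1.
have lt_n nu : nu \in r -> (sumn nu).*2 < n.
  move=> nur; have /perm_to_rem/perm_sumn := map_f sumn nur.
  by rewrite /n => -> /=; lia.
have pP nu : nu \in r -> is_part nu by move/(allP pr).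
have [Pg _] := row_ffunP (pP ga gar) (lt_n ga gar).
have S0 : (\sum_(nu <- r) ratr (d nu) *: schar n n (fn (row_ffun n nu)) = 0 :> 'CF([set: 'S_n]))%R.
  apply/cfunP => s; rewrite sum_cfunE cfunE.
  transitivity (sf_eval (fun m => \sum_(nu <- r) d nu *: stilde nu m)%R (cycle_type s)); last first.
    by rewrite sf_evalE d0 rat_eval0.
  rewrite sf_eval_sum big_seq [RHS]big_seq; apply: eq_bigr => nu nur.
  by rewrite cfunE stilde_eval ?pP ?lt_n // specht_row ?pP ?lt_n.
have := congr1 (fun phi => '[phi, schar n n (fn (row_ffun n ga))])%R S0.
rewrite cfdot0l cfdot_suml (bigD1_seq ga) //= cfdotZl schar_dot // eqxx mulr1.
rewrite big_seq_cond big1 ?addr0 => [/eqP|nu /andP[nur ne]].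
  by rewrite fmorph_eq0 => /eqP.
have [Pn _] := row_ffunP (pP nu nur) (lt_n nu nur).
rewrite cfdotZl schar_dot // (_ : _ == _ = false) ?mulr0 //.
apply/negbTE; apply: contraNneq ne => e; apply/eqP.
by apply: row_ffun_inj e; rewrite ?pP ?lt_n.
Qed.

Lemma expansion_unique (f : symfam) c c' :
  is_expansion stilde f c -> is_expansion stilde f c' -> c =1 c'.
Proof.
move=> [r [ur pr c0 ef]] [r' [ur' pr' c0' ef']] ga.
pose t := undup (r ++ r').
have sumt r0 c1 m : {subset r0 <= t} -> uniq r0 -> (forall nu, nu \notin r0 -> c1 nu = 0)%R ->
    (\sum_(nu <- r0) c1 nu *: stilde nu m = \sum_(nu <- t) c1 nu *: stilde nu m)%R.
  move=> sub u0 c10; rewrite [RHS](bigID (mem r0)) /= [X in (_ + X)%R]big1 ?addr0; last first.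
    by move=> nu /c10 ->; rewrite scale0r.
  rewrite -[RHS]big_filter; apply: perm_big; apply: uniq_perm => //.
    by rewrite filter_uniq ?undup_uniq.
  by move=> nu; rewrite mem_filter /= andb_idr // => /sub.
have pt : all is_part t.
  apply/allP => nu; rewrite mem_undup mem_cat => /orP[]; exact: allP.
have H : {in t, forall nu, c nu - c' nu = 0}%R.
  apply: (@stilde_free t (fun nu => c nu - c' nu)%R); rewrite ?undup_uniq // => m.
  under eq_bigr => nu _ do rewrite scalerBl.
  rewrite sumrB -(sumt r c) //; last by move=> nu; rewrite mem_undup mem_cat => ->.
  rewrite -(sumt r' c') //; last by move=> nu; rewrite mem_undup mem_cat orbC => ->.
  by rewrite -ef -ef' subrr.
have [gt|ngt] := boolP (ga \in t); first by apply/eqP; rewrite -subr_eq0 H.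
by move: ngt; rewrite mem_undup mem_cat negb_or => /andP[/c0 -> /c0' ->].
Qed.
End StildeBasis.

(** * The coefficients as numbers of tableaux *)

Section Coefficients.
Variables (la al : seq nat).
Hypotheses (la_part : is_part la) (al_comp : is_comp al).
Local Notation W := (sumn la + sumn al).
Local Notation good ga := (fun T : filling => [/\ MCT ga la al T, set_valued T & lattice_tableau T]).

Definition lr_coef n ga := #|lr_matrices n (size al) (nth 0 (add_row n la)) (nth 0 al) (nth 0 (add_row n ga))|.

Lemma lr_coef_card n ga : sorted geq ga -> size ga < n -> sumn ga <= n -> W.*2 < n ->
  has_card (good ga) (lr_coef n ga).
Proof.
move=> sga szga sumga ltn; apply: card_tableaux => //; last exact: ltnW.
by have := size_part la_part; lia.
Qed.

Lemma no_large_tableau ga T : MCT ga la al T -> sumn ga <= W.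
Proof.
move=> /and5P[nT /eqP shT lT _ /and3P[_ cT _]].
have := cells_le_letters lT; rewrite (perm_size cT) size_content; apply: leq_trans.
by rewrite -shT; case: T nT {shT lT cT} => //= R T _; apply: leq_addl.
Qed.

Lemma has_card_large ga m : W < sumn ga -> has_card (good ga) m -> m = 0.
Proof.
move=> lt_W [[|T s] [_ sP <-]] //.
have [/no_large_tableau] := (sP T).1 (mem_head T s).
by rewrite leqNgt lt_W.
Qed.

(** Any [n] beyond these bounds gives the same value, because [lr_coef n ga] is the number of
    tableaux of a set that does not depend on [n]. *)
Definition tab_number ga := lr_coef (W.*2.+1 + (sumn ga).*2) ga.

Lemma tab_numberP ga : is_part ga -> has_card (good ga) (tab_number ga).
Proof.
move=> pg; have := size_part pg; case/andP: (pg) => sg _ szg.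
apply: lr_coef_card => //; lia.
Qed.

Definition small_parts : seq (seq nat) := flatten [seq all_parts k | k <- iota 0 W.+1].

Lemma mem_small_parts ga : (ga \in small_parts) = is_part ga && (sumn ga <= W).
Proof.
apply/flatten_mapP/andP => [[k]|[pg le]].
  by rewrite mem_iota mem_all_parts => lt_k /andP[-> /eqP ->].
by exists (sumn ga); rewrite ?mem_iota ?mem_all_parts ?pg //=.
Qed.

Lemma uniq_small_parts : uniq small_parts.
Proof.
rewrite /small_parts; have := iota_uniq 0 W.+1; elim: (iota 0 W.+1) => //= k s IH /andP[nk us].
rewrite cat_uniq uniq_all_parts IH // andbT; apply/hasPn => mu /flatten_mapP[j js].
rewrite !mem_all_parts => /andP[-> /eqP ->] /=; apply: contraNneq nk => <- //.
Qed.

(** Removing the first row indexes the shapes independently of [n]. A shape with more than [W] cells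
    outside the first row has coefficient 0, since a tableau has at most [W] nonempty cells. *)
Lemma lr_matrices_expand n (s : 'S_n) : W.*2 < n ->
  (\sum_(p in partitions n n)
     #|lr_matrices n (size al) (nth 0 (add_row n la)) (nth 0 al) (fn p)|%:R * schar n n (fn p) s
   = \sum_(ga <- small_parts) (tab_number ga)%:R * specht_char n (add_row n ga) s :> algC)%R.
Proof.
move=> lt_n; have n_gt0 : 0 < n by lia.
have smallP ga : ga \in small_parts -> is_part ga /\ (sumn ga).*2 < n.
  by rewrite mem_small_parts => /andP[pg le]; split=> //; lia.
have eq_lr q q' : (forall k, k < n -> q k = q' k) ->
    lr_matrices n (size al) (nth 0 (add_row n la)) (nth 0 al) q =
    lr_matrices n (size al) (nth 0 (add_row n la)) (nth 0 al) q'.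
  move=> e; apply/setP => T; rewrite !inE; congr [&& _, _, _, _ & _].
  by apply: eq_forallb => j; rewrite e.
pose G (p : {ffun 'I_n -> 'I_n.+1}) : algC := (#|lr_matrices n (size al) (nth 0 (add_row n la)) (nth 0 al) (fn p)|%:R * schar n n (fn p) s)%R.
transitivity (\sum_(p <- [seq row_ffun n ga | ga <- small_parts]) G p)%R; last first.
  rewrite big_map big_seq [RHS]big_seq; apply: eq_bigr => ga gas.
  have [pg lt] := smallP ga gas; have [_ eg] := row_ffunP pg lt.
  rewrite /G -specht_row // (eq_lr _ _ eg); congr (_%:R * _)%R.
  case/andP: (pg) => sg _; have := size_part pg => sz.
  apply: has_card_unique (tab_numberP pg); apply: lr_coef_card => //; lia.
have urow : uniq [seq row_ffun n ga | ga <- small_parts].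
  rewrite map_inj_in_uniq ?uniq_small_parts // => ga ga' /smallP[pg lt] /smallP[pg' lt'].
  exact: row_ffun_inj.
rewrite [RHS]big_uniq //= big_mkcond [RHS]big_mkcond; apply: eq_bigr => q _.
case: ifP => Pq; case: ifP => // qs.
- rewrite /G; set m := #|_|; suff -> : m = 0 by rewrite mul0r.
  apply/eqP; apply: contraFT qs => m_neq0.
  (* Nothing bounds [sumn ga] by half of [n] here. The count of tableaux is still valid for such
     [ga], and its being nonzero forces [sumn ga <= W]. *)
  pose ga := behead (part_of_ffun q).
  have pq := part_of_ffun_part Pq; have sq := sumn_part_of_ffun Pq.
  have eq_row : add_row n ga = part_of_ffun q.
    rewrite /ga; case eq: (part_of_ffun q) sq => [|x t] /= sq; first by lia.
    by rewrite /add_row; congr cons; lia.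
  have pg : is_part ga.
    move: pq; rewrite /ga; case: (part_of_ffun q) => //= x t /andP[/path_sorted st].
    by rewrite inE negb_or => /andP[_ nt]; apply/andP.
  have szg : size ga < n.
    by have := size_part pq; rewrite -eq_row sumn_add_row /= //; rewrite -sq -eq_row /=; lia.
  have sumg : sumn ga <= n by rewrite -sq -eq_row /=; lia.
  have em : m = lr_coef n ga.
    by congr #|pred_of_set _|; apply: eq_lr => k _; rewrite eq_row nth_part_of_ffun.
  have cg : has_card (good ga) m by rewrite em; apply: lr_coef_card => //; case/andP: pg.
  have le_g : sumn ga <= W.
    by rewrite leqNgt; apply: contra m_neq0 => /has_card_large/(_ cg) ->.
  apply/mapP; exists ga; first by rewrite mem_small_parts pg.
  have [_ eg] := row_ffunP (n := n) pg (ltac:(lia)).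
  by apply: fn_inj => k; rewrite eg // eq_row nth_part_of_ffun.
- by move: Pq; case/mapP: qs => ga /smallP[pg lt] ->; rewrite (row_ffunP pg lt).1.
Qed.

Variables (stilde htilde : seq nat -> symfam).
Hypothesis stildeP : forall nu, is_part nu -> is_stilde nu (stilde nu).
Hypothesis htildeP : forall nu, is_part nu -> is_htilde nu (htilde nu).
Local Notation F := (fun n => (\prod_(a <- al) htilde [:: a] n) * stilde la n)%R.

Lemma is_part_single a : a \in al -> is_part [:: a].
Proof. by move=> aal; rewrite /is_part /= inE; apply: contraNneq al_comp => ->. Qed.

Lemma product_eval n (s : 'S_n) : W.*2 < n ->
  sf_eval F (cycle_type s) =
  (\sum_(ga <- small_parts) (tab_number ga)%:R * specht_char n (add_row n ga) s)%R.
Proof.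
move=> lt_n; have n_gt0 : 0 < n by lia.
have lt_la : (sumn la).*2 < n by lia.
have al_le a : a \in al -> a <= sumn al by move=> /perm_to_rem/perm_sumn ->; apply: leq_addr.
have [Pla ela] := row_ffunP la_part lt_la.
rewrite -lr_matrices_expand // -product_expansion //; last first.
- move=> i lt_i; apply: leq_trans (al_le _ (mem_nth 0 lt_i)) _; lia.
- by rewrite -[RHS](sum_fn Pla); apply: eq_bigr => k _; rewrite ela.
- by move=> k lt_k; rewrite -!ela ?(ltnW lt_k) //; apply: fn_dec.
rewrite sf_evalE rat_evalM -!sf_evalE (stilde_eval stildeP) // rat_eval_prod.
rewrite specht_row // (eq_schar _ ela); congr (_ * _)%R.
rewrite (big_nth 0) big_mkord; apply: eq_bigr => i _; have aal := mem_nth 0 (ltn_ord i).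
rewrite -sf_evalE; apply: htilde_eval.
- by rewrite lt0n; apply/eqP => e; move: aal; rewrite e; apply/negP.
- by have le_a := al_le _ aal; apply: leq_trans (leq_add le_a le_a) _; lia.
exact/htildeP/is_part_single.
Qed.

Lemma symfun_product : is_symfun F.
Proof.
apply: is_symfunM; last by case: (stildeP la_part).
by apply: is_symfun_prod => a /is_part_single/htildeP[].
Qed.

(** Every partition is the cycle type of a permutation, so the identity of characters gives
    agreement at all [Xi mu] with [sumn mu] above [W.*2], and [symfun_vanish] applies to the
    difference. *)
Lemma product_stilde n :
  (F n = \sum_(ga <- small_parts) (tab_number ga)%:R *: stilde ga n)%R.
Proof.
apply/eqP; rewrite -subr_eq0; apply/eqP.
have symS : is_symfun (fun n => \sum_(ga <- small_parts) (tab_number ga)%:R *: stilde ga n)%R.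
  by apply: is_symfun_sum => ga; rewrite mem_small_parts => /andP[/stildeP[]].
have symD : is_symfun (fun n => F n - \sum_(ga <- small_parts) (tab_number ga)%:R *: stilde ga n)%R.
  exact: is_symfunB symfun_product symS.
apply: (symfun_vanish (n0 := W.*2.+1) symD _ n).
move=> mu pmu le_mu; rewrite sf_evalE rat_evalB.
rewrite -[rat_eval _ (\sum_(_ <- _) _)]/(sf_eval (fun n => \sum_(ga <- small_parts) (tab_number ga)%:R *: stilde ga n)%R mu).
rewrite sf_eval_sum -(cycle_type_rot pmu (erefl (sumn mu))).
set s := rot_perm _; rewrite -[X in (X - _)%R]/(sf_eval F (cycle_type s)).
rewrite product_eval //; apply/eqP; rewrite subr_eq0; apply/eqP.
rewrite big_seq [RHS]big_seq; apply: eq_bigr => ga; rewrite mem_small_parts => /andP[pg le_g].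
by rewrite (stilde_eval stildeP) ?ratr_nat //; lia.
Qed.

Definition tab_coef ga : rat := if is_part ga then (tab_number ga)%:R%R else 0%R.

Lemma tab_coef_expansion : is_expansion stilde F tab_coef.
Proof.
exists small_parts; split.
- exact: uniq_small_parts.
- by apply/allP => ga; rewrite mem_small_parts => /andP[].
- move=> ga; rewrite mem_small_parts /tab_coef; case: ifP => // pg; rewrite -ltnNge => lt.
  by rewrite (has_card_large lt (tab_numberP pg)).
move=> n; rewrite product_stilde big_seq [RHS]big_seq; apply: eq_bigr => ga.
by rewrite mem_small_parts /tab_coef => /andP[-> _].
Qed.

End Coefficients.

Local Open Scope ring_scope.

Theorem mainTheorem2
    (stilde htilde : seq nat -> symfam)
    (stildeP : forall nu, is_part nu -> is_stilde nu (stilde nu))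
    (htildeP : forall nu, is_part nu -> is_htilde nu (htilde nu))
    (la ga al : seq nat) (la_part : is_part la) (ga_part : is_part ga)
    (al_comp : is_comp al) :
  let F : symfam := fun n => (\prod_(a <- al) htilde [:: a] n) * stilde la n in
  exists N : nat,
    [/\ has_card
          (fun T : filling =>
             [/\ MCT ga la al T, set_valued T & lattice_tableau T]) N,
        exists c, is_expansion stilde F c
      & forall c, is_expansion stilde F c -> c ga = N%:R].
Proof.
move=> F; have expF := tab_coef_expansion la_part al_comp stildeP htildeP.
exists (tab_number la al ga); split; first exact: tab_numberP.
  by exists (tab_coef la al).
move=> c /(expansion_unique stildeP expF) <-.
by rewrite /tab_coef ga_part.
Qed.
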